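(* Let $m\ge 1$ be an integer. In the genus 1 case, the group $\mathcal{H}$ is of order $4m$ if and only if the Weierstrass function $\wp$ with periods $(\omega_1,\omega_2)$ satisfies $$\wp(m\omega_3)=\wp(\omega_2/2),$$ where $m$ is the smallest positive integer with this property.
   Context: Let $p_{ij}\ge 0$, $-1\le i,j\le 1$, with $\sum_{i,j}p_{ij}=1$. Put $$Q(x,y)=xy\Big(1-\sum_{-1\le i,j\le 1}p_{ij}x^iy^j\Big).$$ Up to the sign of $Q$ (which is irrelevant, since only the curve $\{Q=0\}$ matters), $Q(x,y)=a(x)y^2+b(x)y+c(x)=\tilde a(y)x^2+\tilde b(y)x+\tilde c(y)$ with $a(x)=p_{1,1}x^2+p_{0,1}x+p_{-1,1}$, $b(x)=p_{1,0}x^2+(p_{0,0}-1)x+p_{-1,0}$, $c(x)=p_{1,-1}x^2+p_{0,-1}x+p_{-1,-1}$, $\tilde a(y)=p_{1,1}y^2+p_{1,0}y+p_{1,-1}$, $\tilde b(y)=p_{0,1}y^2+(p_{0,0}-1)y+p_{0,-1}$, $\tilde c(y)=p_{-1,1}y^2+p_{-1,0}y+p_{-1,-1}$. Standing assumption: $Q$ is irreducible of degree 2 in each variable and the algebraic curve $\{Q(x,y)=0\}$ has genus 1. Let $\mathbb{C}_Q(x,y)$ be the function field of this curve. Let $\xi,\eta$ be the $\mathbb{C}$-automorphisms of $\mathbb{C}_Q(x,y)$ determined by $\xi(x)=x$, $\xi(y)=\frac{c(x)}{y\,a(x)}$ and $\eta(y)=y$, $\eta(x)=\frac{\tilde c(y)}{x\,\tilde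 a(y)}$; they are involutions. The group of the random walk is $\mathcal{H}=\langle\xi,\eta\rangle$. Branch points and periods: let $D(x)=b^2(x)-4a(x)c(x)$ and $\tilde D(y)=\tilde b^2(y)-4\tilde a(y)\tilde c(y)$, each viewed as a polynomial of degree 4 (a root is $\infty$ if the leading coefficient vanishes). The four roots of $D$ are denoted $x_1,\dots,x_4$ with $|x_1|\le|x_2|\le|x_3|\le|x_4|$, and those of $\tilde D$ are denoted $y_1,\dots,y_4$ with the analogous ordering; moreover $x_1\le x_2$, $[x_1,x_2]\subset[-1,1]$ and $0\le x_2\le x_3$ (and similarly for the $y_i$). $X(y_1)$ denotes the double root $x$ of $Q(x,y_1)=0$. Set $$\omega_1=2i\int_{x_1}^{x_2}\frac{dx}{\sqrt{-D(x)}},\qquad \omega_2=2\int_{x_2}^{x_3}\frac{dx}{\sqrt{D(x)}},\qquad \omega_3=2\int_{X(y_1)}^{x_1}\frac{dx}{\sqrt{D(x)}},$$ the last integral being taken along the arc of $\mathbb{R}\cup\{\infty\}$ with endpoint $x_1$ on which $D\ge0$. Here $\omega_1$ is purely imaginary and $0<\omega_3<\omega_2$. *)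

(* Defs.v *)
From HB Require Import structures.
From mathcomp Require Import all_boot all_order all_algebra.
From mathcomp Require Import polyXY.
From mathcomp Require Import complex.
From mathcomp Require Import all_classical all_reals all_analysis.
Set Implicit Arguments.
Unset Strict Implicit.
Unset Printing Implicit Defensive.
Import Order.TTheory GRing.Theory Num.Theory.
Import numFieldNormedType.Exports.
Local Open Scope classical_set_scope.
Local Open Scope ring_scope.
Local Open Scope complex_scope.

Definition steps : seq int := [:: -1; 0; 1].

Section Kernel.
Context {R : realType}.
Implicit Types (p : int -> int -> R) (y : R).

(* Only the values [p i j] with [i, j \in steps] are meaningful. *)
Definition transition_probabilities p : Prop :=
  (forall i j, i \in steps -> j \in steps -> 0 <= p i j) /\
  \sum_(i <- steps) \sum_(j <- steps) p i j = 1.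

(* Q(x, y) = x y (1 - \sum_(i, j) p_ij x^i y^j), with the factor x y multiplied
   out so that the exponents are nonnegative.  As in polyXY, x is the outer
   variable 'X and y the inner variable 'Y. *)
Definition walk_kernel p : {poly {poly R}} :=
  'X * 'Y - \sum_(i <- steps) \sum_(j <- steps)
              (p i j)%:P%:P * 'X ^+ absz (i + 1) * 'Y ^+ absz (j + 1).

Definition walk_kernelC p : {poly {poly R[i]}} :=
  map_poly (map_poly (real_complex R)) (walk_kernel p).

(* Q(x, y) = - (a(x) y^2 + b(x) y + c(x)) = - (a~(y) x^2 + b~(y) x + c~(y)) *)
Definition coef_a p : {poly R} :=
  (p 1 1)%:P * 'X^2 + (p 0 1)%:P * 'X + (p (-1) 1)%:P.
Definition coef_b p : {poly R} :=
  (p 1 0)%:P * 'X^2 + (p 0 0 - 1)%:P * 'X + (p (-1) 0)%:P.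
Definition coef_c p : {poly R} :=
  (p 1 (-1))%:P * 'X^2 + (p 0 (-1))%:P * 'X + (p (-1) (-1))%:P.
Definition coef_at p : {poly R} :=
  (p 1 1)%:P * 'X^2 + (p 1 0)%:P * 'X + (p 1 (-1))%:P.
Definition coef_bt p : {poly R} :=
  (p 0 1)%:P * 'X^2 + (p 0 0 - 1)%:P * 'X + (p 0 (-1))%:P.
Definition coef_ct p : {poly R} :=
  (p (-1) 1)%:P * 'X^2 + (p (-1) 0)%:P * 'X + (p (-1) (-1))%:P.

Definition disc p : {poly R} :=
  coef_b p ^+ 2 - 4%:R * coef_a p * coef_c p.
Definition disct p : {poly R} :=
  coef_bt p ^+ 2 - 4%:R * coef_at p * coef_ct p.

(* the polynomial Q(x, y) in x, for a given real y *)
Definition walk_kernel_at p y : {poly R} := map_poly (horner_eval y) (walk_kernel p).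

End Kernel.

Definition irreducible_elt (A : idomainType) (q : A) : Prop :=
  [/\ q != 0, q \isn't a GRing.unit &
      forall f g : A, q = f * g -> f \is a GRing.unit \/ g \is a GRing.unit].

Section FunctionField.
Context {C K : fieldType}.
Variable iota : {rmorphism C -> K}.

Definition eval2 (P : {poly {poly C}}) (x y : K) : K :=
  (map_poly (map_poly iota) P).[x, y].

(* K is the fraction field of C[X, Y] / (Q), and x, y are the classes of X, Y.
   This determines (K, iota, x, y) up to a unique isomorphism. *)
Definition is_function_field (Q : {poly {poly C}}) (x y : K) : Prop :=
  (forall P, eval2 P x y = 0 <-> exists S, P = S * Q) /\
  (forall f : K, exists P1 P2,
     eval2 P2 x y != 0 /\ f = eval2 P1 x y / eval2 P2 x y).

(* The places of K / C, as normalized discrete valuations trivial on C.  The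
   value at 0, which should be +oo, is conventionally 0, so that each place is
   represented by exactly one function. *)
Definition place : set (K -> int) :=
  [set v | [/\ v 0 = 0,
      forall f g, f != 0 -> g != 0 -> v (f * g) = v f + v g,
      forall f g, f != 0 -> g != 0 -> f + g != 0 ->
        Num.min (v f) (v g) <= v (f + g),
      forall c, v (iota c) = 0 &
      exists2 t, t != 0 & v t = 1]].

Definition divisor (A : (K -> int) -> int) : Prop :=
  finite_set (place `&` [set v | A v != 0]).

(* When C is algebraically closed every place has degree 1. *)
Definition deg_divisor (A : (K -> int) -> int) : int := \sum_(v \in place) A v.

Definition riemann_roch_space (A : (K -> int) -> int) : set K :=
  [set f | f = 0 \/ forall v, place v -> - A v <= v f].

Definition has_dim (V : set K) (n : nat) : Prop :=
  exists e : 'I_n -> K, (forall i, V (e i)) /\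
    forall f, V f -> exists! c : {ffun 'I_n -> C},
      f = \sum_(i < n) iota (c i) * e i.

(* The genus of K / C is the maximum of deg A + 1 - l(A) over the divisors A,
   where l(A) is the dimension of the Riemann-Roch space of A (Stichtenoth,
   Algebraic Function Fields and Codes, Definition 1.4.15). *)
Definition has_genus (g : nat) : Prop :=
  (forall A n, divisor A -> has_dim (riemann_roch_space A) n ->
     deg_divisor A + 1 - n%:Z <= g%:Z) /\
  (exists A n, [/\ divisor A, has_dim (riemann_roch_space A) n &
     deg_divisor A + 1 - n%:Z = g%:Z]).

End FunctionField.

(* the subgroup of the bijections of K generated by S *)
Inductive generated (K : Type) (S : set (K -> K)) : (K -> K) -> Prop :=
| generated_id : generated S id
| generated_in f : S f -> generated S f
| generated_comp f g : generated S f -> generated S g -> generated S (f \o g)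
| generated_inv f g :
    generated S f -> cancel f g -> cancel g f -> generated S g.

Section Walk.
Context {R : realType} {K : fieldType}.
Variables (iota : {rmorphism R[i] -> K}) (p : int -> int -> R) (x y : K).

Definition evalK (q : {poly R}) (z : K) : K :=
  (map_poly (iota \o real_complex R) q).[z].

Definition fixes_constants (s : K -> K) : Prop :=
  forall c, s (iota c) = iota c.

Definition is_xi (s : {rmorphism K -> K}) : Prop :=
  [/\ bijective s, fixes_constants s, s x = x &
      s y = evalK (coef_c p) x / (y * evalK (coef_a p) x)].

Definition is_eta (s : {rmorphism K -> K}) : Prop :=
  [/\ bijective s, fixes_constants s, s y = y &
      s x = evalK (coef_ct p) y / (x * evalK (coef_at p) y)].

Definition walk_group (xi eta : {rmorphism K -> K}) : set (K -> K) :=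
  generated [set (xi : K -> K); (eta : K -> K)].

End Walk.

Section Periods.
Context {R : realType}.
Implicit Types (D P : {poly R}) (u v : option R) (z : R[i]).

(* In [option R], seen as the real projective line, [None] is infinity.
   [roots_in_degree n P s]: viewed as a polynomial of degree n, P is nonzero and
   its roots in the projective line, with multiplicity, are the items of s. *)
Definition roots_in_degree n P (s : seq (option R)) : Prop :=
  size s = n /\ P %= \prod_(r <- pmap id s) ('X - r%:P).

Definition le_abs u v : Prop :=
  match u, v with
  | _, None => True
  | None, Some _ => False
  | Some s, Some t => `|s| <= `|t|
  end.

(* Only the root of largest modulus may be infinite: in genus 1 the four roots
   are distinct. *)
Definition branch_points D (x1 x2 x3 : R) (x4 : option R) : Prop :=
  [/\ roots_in_degree 4 D [:: Some x1; Some x2; Some x3; x4],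
      [/\ le_abs (Some x1) (Some x2), le_abs (Some x2) (Some x3) &
          le_abs (Some x3) x4],
      x1 <= x2,
      `[x1, x2] `<=` `[-1, 1] &
      0 <= x2 <= x3].

(* The real part of the arc of the projective line that starts at u and
   increases (through infinity if u > x1) up to x1.  Since D < 0 on ]x1, x2[,
   this is the arc between u and x1 on which D >= 0. *)
Definition arc_to u (x1 : R) : set R :=
  match u with
  | None => `]-oo, x1]%classic
  | Some s => if s <= x1 then `[s, x1]%classic else `[s, +oo[%classic `|` `]-oo, x1]%classic
  end.

Definition omega1 D (x1 x2 : R) : R[i] :=
  (2%:R * \int[lebesgue_measure]_(x in `[x1, x2]) (Num.sqrt (- D.[x]))^-1)*i.

Definition omega2 D (x2 x3 : R) : R :=
  2%:R * \int[lebesgue_measure]_(x in `[x2, x3]) (Num.sqrt D.[x])^-1.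

Definition omega3 D u (x1 : R) : R :=
  2%:R * \int[lebesgue_measure]_(x in arc_to u x1) (Num.sqrt D.[x])^-1.

Definition lattice_point (w1 w2 : R[i]) (k l : int) : R[i] := k%:~R * w1 + l%:~R * w2.

Definition lattice (w1 w2 : R[i]) : set R[i] :=
  [set z | exists k l, z = lattice_point w1 w2 k l].

Definition wp_partial (w1 w2 : R[i]) z (N : nat) : R[i] :=
  (z ^+ 2)^-1 +
  \sum_(k < N.*2.+1) \sum_(l < N.*2.+1)
    let w := lattice_point w1 w2 (k%:Z - N%:Z) (l%:Z - N%:Z) in
    if w == 0 then 0 else ((z - w) ^+ 2)^-1 - (w ^+ 2)^-1.

(* The Weierstrass function, with value infinity ([None]) at the lattice
   points.  The series over the lattice converges absolutely, so it may be
   summed along the squares |k|, |l| <= N. *)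
Definition wp (w1 w2 : R[i]) z : option R[i] :=
  if z \in lattice w1 w2 then None
  else Some (lim (wp_partial w1 w2 z N @[N --> \oo] : set_system R[i]^o)).

End Periods.

(* Main.v *)
Require Import Defs.
From mathcomp Require Import all_boot all_order all_algebra.
From mathcomp Require Import polyXY complex.
From mathcomp Require Import ring lra zify.
From mathcomp Require Import all_classical all_reals all_analysis measurable_realfun.
Import Order.TTheory GRing.Theory Num.Theory.
Import numFieldNormedType.Exports.
Set Implicit Arguments.
Unset Strict Implicit.
Unset Printing Implicit Defensive.
Local Open Scope classical_set_scope.
Local Open Scope ring_scope.

(** Uniformize the curve. A real oval of the curve [Q = 0] carries the invariant differential
    [dx / sqrt D(x)], and integrating it gives a parameter [t] of the oval, defined modulo the
    total time [omega2]. Changing the root [y] over a given [x] reverses [t] around a branch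
    point of [x], and changing the root [x] over a given [y] reverses [t] around a branch point
    of [y]. So [xi] acts as [t -> - t] and [eta] as [t -> s - t], where [s] is, up to sign,
    twice the time from the branch point [x1] to the double point over [y1], that is
    [omega3]. A function on the irreducible curve is determined by its values on the oval,
    except at countably many parameters, so the group is the dihedral group generated by these
    two reflections of the line modulo [omega2]: its order is twice the order of [omega3]
    modulo [omega2] ([walk_group_card]).

    It is [4 m] exactly when [2 m] is the least positive [n] with [n omega3] a multiple of
    [omega2], which means that [m] is the least positive integer for which [m omega3] is
    [omega2 / 2] modulo [omega2] ([order_half_period]). On the other side, the lattice is
    rectangular, and on the real axis the Weierstrass function takes the value
    [wp (omega2 / 2)] only at the half periods [omega2 / 2 + n omega2] ([wp_half_period]):
    summed along the vertical lines of the lattice, it is, up to a constant, a series of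
    translates of the strictly convex function [(pi / tau) ^ 2 / sinh (pi t / tau) ^ 2], where
    [omega1 = i tau]; grouped in pairs symmetric with respect to [omega2 / 2], this series has
    its strict minimum over a period there.

    The parametrization stays real. The relevant oval lies over the arc from [x4] to [x1],
    which may pass through infinity but avoids [x = 1]; the coordinates [u = 1 / (x - 1)] and
    [v = 1 / (y - 1)] make it a bounded oval of a biquadratic curve, over a segment [[e1, e4]].
    There [u = m - r cos tau] regularizes the differential, and the resulting flow satisfies
    Hamilton's equations [u' = Q_v], [v' = - Q_u]. Hence [v] solves a second order equation
    [v'' = f(v)], and it is symmetric about every time at which [v' = 0]
    ([oval_flow_exists]). That the segment does not meet the abscissas of the other oval, and
    that the double point over [y1] is on the right side, comes from the signs of the
    transition probabilities ([positive_branch], [critical_outside]). A homography exchanging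
    the two ovals identifies [omega2] with the full time of the oval ([omega2E]).

    The genus enters through the branch points: if two of them coincided, the curve would be
    birational to a conic ([conic_rational]), its function field would be [C(t)], and the
    genus would be 0 ([rational_genus]). *)

(** * The reciprocal squares of hyperbolic sines *)

Section CosecantSquared.
Context {R : realType}.
Implicit Types (a b h g s : R).

Definition sinh a : R := (expR a - expR (- a)) / 2.

Lemma sinh_double a : sinh (a *+ 2) ^+ 2 = 4 * sinh a ^+ 2 * (1 + sinh a ^+ 2).
Proof.
rewrite /sinh -mulNrn !mulr2n !expRD.
have := expRxMexpNx_1 a; set e := expR a; set f := expR (- a) => ef.
transitivity (((e + f) / 2) ^+ 2 * 4 * ((e - f) / 2) ^+ 2); first by field.
have -> : ((e + f) / 2) ^+ 2 = e * f + ((e - f) / 2) ^+ 2 by field.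
by rewrite ef; ring.
Qed.

Lemma sin_double b : sin (b *+ 2) ^+ 2 = 4 * sin b ^+ 2 * (1 - sin b ^+ 2).
Proof. by rewrite sin_mulr2n -cos2sin2; ring. Qed.

Lemma sinhN a : sinh (- a) = - sinh a.
Proof. by rewrite /sinh opprK; field. Qed.

Lemma sinh_ge a : 0 <= a -> a <= sinh a.
Proof.
move=> a0; suff : 0 <= (sinh a - a) - (sinh 0 - 0).
  by rewrite /sinh oppr0 subrr mul0r; lra.
have [->|an0] := eqVneq a 0; first by rewrite subrr.
have a_gt0 : 0 < a by rewrite lt_neqAle eq_sym an0.
have dd (z : R) : is_derive z 1 (fun a => sinh a - a) ((expR z + expR (- z)) / 2 - 1).
  rewrite /sinh; apply: is_derive_eq.
  by rewrite /GRing.scale /=; field.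
have cc : {within `[0, a], continuous (fun a => sinh a - a)}.
  apply: derivable_within_continuous => z _; exact: (@ex_derive _ _ _ _ _ _ _ (dd z)).
have [c _ ->] := MVT a_gt0 (fun z _ => dd z) cc.
rewrite subr0 mulr_ge0 //.
have := expRxMexpNx_1 c; have := expR_gt0 c; have := expR_gt0 (- c).
move: (expR c) (expR (- c)) => e f f0 e0 ef; have := sqr_ge0 (e - f).
rewrite leNgt => ef2; apply/negP => ef3; have : (e + f) * (e + f) < 2 * 2 by nra.
by move: ef2; rewrite -leNgt; nra.
Qed.

Lemma sinh_gt0 a : 0 < a -> 0 < sinh a.
Proof. by move=> a0; apply: lt_le_trans (sinh_ge (ltW a0)). Qed.

Lemma sinh2_ge a : a ^+ 2 <= sinh a ^+ 2.
Proof.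
wlog a0 : a / 0 <= a.
  move=> H; have [|/ltW a0] := leP 0 a; first exact: H.
  by have := H (- a); rewrite sinhN !sqrrN; apply; rewrite oppr_ge0.
by rewrite ler_sqr ?nnegrE ?sinh_ge // (le_trans a0) ?sinh_ge.
Qed.

Lemma sinh2_gt0 a : a != 0 -> 0 < sinh a ^+ 2.
Proof. by move=> a0; apply: lt_le_trans (sinh2_ge a); rewrite exprn_even_gt0. Qed.

Lemma sin_ge_half b : 0 <= b <= pi / 2 -> b / 2 <= sin b.
Proof.
move=> /andP[b0 bp].
have -> : b = (b / 2) *+ 2 by field.
rewrite sin_mulr2n; set c := b / 2.
have c0 : 0 <= c by rewrite /c; lra.
have cp : c <= pi / 4 by rewrite /c; lra.
have p4 : cos (pi / 4) ^+ 2 = 1 / 2 :> R.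
  have : cos ((pi / 4) *+ 2) = 0 :> R by rewrite -[RHS]cos_pihalf; congr cos; field.
  rewrite cos_mulr2n => /eqP; rewrite subr_eq0 => /eqP; lra.
have pi0 := @pi_gt0 R.
have cge (d : R) : 0 <= d -> d <= pi / 4 -> cos (pi / 4) <= cos d.
  move=> d0 dp; have [->//|dn] := eqVneq d (pi / 4).
  by apply/ltW; rewrite ltr_cos ?in_itv /=; lra.
have p40 : 0 < cos (pi / 4) :> R by apply: cos_gt0_pihalf; lra.
have sc : c * cos (pi / 4) <= sin c.
  have [->|cn0] := eqVneq c 0; first by rewrite mul0r sin0.
  have c_gt0 : 0 < c by rewrite lt_neqAle eq_sym cn0.
  have sc : {within `[0, c], continuous (@sin R)}.
    by apply: derivable_within_continuous => z _; exact: derivable_sin.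
  have [d] := MVT c_gt0 (fun z _ => is_derive_sin z) sc.
  rewrite in_itv /= => /andP[d0 dc].
  rewrite sin0 !subr0 => ->; rewrite mulrC ler_wpM2r // cge //; lra.
have cc := cge c c0 cp.
rewrite (_ : c *+ 2 / 2 = c); last by field.
have : (c * cos (pi / 4)) * cos (pi / 4) <= sin c * cos c.
  by apply: ler_pM => //; [rewrite mulr_ge0 // ltW|exact: ltW].
by rewrite -mulrA -expr2 p4; lra.
Qed.

(** the real part of 1 / sinh^2 (a + i b), as a function of [sinh a ^+ 2] and [sin b ^+ 2] *)
Definition recsch2 h g : R := (h - g - 2 * h * g) / (h + g) ^+ 2.

(** The real part of [F z + F (z + i pi / 2) = 4 F (2 z)] for [F = 1 / sinh ^ 2], with
    [h = sinh a ^ 2] and [g = sin b ^ 2]; the translation by [i pi / 2] replaces [g] by [1 - g]. *)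
Lemma recsch2_double h g : 0 < h -> 0 <= g <= 1 ->
  recsch2 h g + recsch2 h (1 - g) = 4 * recsch2 (4 * h * (1 + h)) (4 * g * (1 - g)).
Proof.
move=> h0 /andP[g0 g1]; rewrite /recsch2.
have -> : 4 * h * (1 + h) + 4 * g * (1 - g) = 4 * (h + g) * (h + (1 - g)) by ring.
field; apply/andP; split; lra.
Qed.

Lemma recsch2_bound h g : 0 < h -> 0 <= g <= 1 -> `|recsch2 h g| <= (h + g)^-1.
Proof.
move=> h0 /andP[g0 g1]; have hg : 0 < h + g by lra.
rewrite /recsch2 normrM normfV [X in _ / X]gtr0_norm ?exprn_gt0 //.
rewrite ler_pdivrMr ?exprn_gt0 // expr2 mulKf ?gt_eqF //.
rewrite ler_norml; apply/andP; split; nra.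
Qed.

Lemma sin2_le1 b : 0 <= sin b ^+ 2 <= 1.
Proof. by rewrite sqr_ge0 /= -(cos2Dsin2 b) lerDr sqr_ge0. Qed.

(** The duplication formula, iterated. As [n] grows, the [j]-th term tends to the partial
    fraction of [1 / sinh ^ 2] at one of its poles, so that the expansion into partial fractions
    follows by dominated convergence. *)
Lemma recsch2_dyadic n a b : a != 0 ->
  recsch2 (sinh a ^+ 2) (sin b ^+ 2) =
  4 ^- n * \sum_(0 <= j < 2 ^ n)
     recsch2 (sinh (a / 2 ^+ n) ^+ 2) (sin ((b + pi * j%:R) / 2 ^+ n) ^+ 2).
Proof.
move=> a0; elim: n => [|n IHn].
  by rewrite expn0 big_nat1 !expr0 invr1 mul1r mulr0 addr0 !mulr1.
rewrite IHn (exprSr 4) invfM -mulrA; congr (_ * _).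
rewrite expnS mul2n -addnn [in RHS](@big_cat_nat _ _ _ (2 ^ n)) ?leq_addr //=.
rewrite -[X in _ + \sum_(X <= _ < _) _]add0n big_addn addnK -big_split /= mulr_sumr.
apply: eq_bigr => j _.
have p2 : 2 ^+ n != 0 :> R by rewrite expf_neq0.
have a2 : a / 2 ^+ n.+1 != 0 by rewrite mulf_neq0 // invr_eq0 expf_neq0.
set c := (b + pi * j%:R) / 2 ^+ n.+1.
have -> : (b + pi * (j + 2 ^ n)%:R) / 2 ^+ n.+1 = c + pi / 2.
  by rewrite /c natrD natrX exprS; field.
rewrite sinDpihalf cos2sin2 recsch2_double ?sinh2_gt0 ?sin2_le1 //.
rewrite -sinh_double -sin_double mulrA mulVf // mul1r.
by congr (recsch2 (sinh _ ^+ 2) (sin _ ^+ 2)); rewrite /c exprS; field.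
Qed.

(** Dominated convergence for sums of growing length; [e J] bounds the tails of the
    dominating series. *)
Lemma tannery (u : nat -> nat -> R) (v b e : nat -> R) (M : nat -> nat) (l : R) :
  (forall j, u n j @[n --> \oo] --> v j) ->
  (forall n j, (j < M n)%N -> `|u n j| <= b j) ->
  (forall j, \forall n \near \oo, (j <= M n)%N) ->
  (forall J K, \sum_(J <= j < K) b j <= e J) -> e @ \oo --> 0 ->
  (\sum_(0 <= j < M n) u n j) @[n --> \oo] --> l ->
  series v @ \oo --> l.
Proof.
move=> uv ub Mn be e0 sl.
have key J : `|series v J - l| <= e J.
  have cv : (\sum_(0 <= j < J) u n j - \sum_(0 <= j < M n) u n j) @[n --> \oo]
     --> series v J - l.
    apply: cvgB => //; rewrite /series /=.
    by apply: cvg_big => [|j _]; [exact: add_continuous|exact: uv].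
  apply: (ler_cvg_to (cvg_norm cv) (cvg_cst (e J))).
  near=> n.
  have JM : (J <= M n)%N by near: n; exact: Mn.
  rewrite (@big_cat_nat _ _ _ J 0 (M n)) //= opprD addNKr normrN.
  apply: le_trans (be J (M n)); apply: le_trans (ler_norm_sum _ _ _) _.
  rewrite !big_nat; apply: ler_sum => j /andP[_ jM]; exact: ub.
apply/cvgrPdist_le => eps eps0.
near=> J; rewrite distrC; apply: le_trans (key J) _.
apply: le_trans (ler_norm _) _; rewrite -normrN -sub0r.
by near: J; move/cvgrPdist_le : e0; exact.
Unshelve. all: by end_near. Qed.

Lemma sum_invsqr J K : \sum_(J <= j < K) (j.+1%:R ^+ 2)^-1 <= 2 / J.+1%:R :> R.
Proof.
have [KJ|/ltnW JK] := leqP K J.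
  by rewrite big_geq // divr_ge0.
suff : \sum_(J <= j < K) (j.+1%:R ^+ 2)^-1 <= 2 * (J.+1%:R^-1 - K.+1%:R^-1) :> R.
  move/le_trans; apply; rewrite ler_pM2l ?ltr0n // gerBl invr_ge0 ler0n.
  by [].
rewrite -(subnKC JK); elim: (K - J)%N => [|k IH].
  by rewrite addn0 big_geq // subrr mulr0.
rewrite addnS big_nat_recr ?leq_addr //=.
apply: le_trans (lerD IH (lexx _)) _.
set m := (J + k)%N.
have m0 : 0 < m.+1%:R :> R by rewrite ltr0n.
rewrite -[m.+2]addn1 natrD; set x := m.+1%:R in m0 *.
rewrite -subr_ge0.
have x1 : 1 <= x by rewrite /x ler1n.
move: (J.+1%:R^-1) => y.
rewrite [X in _ <= X](_ : _ = (x - 1) / (x ^+ 2 * (x + 1))); last first.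
  by field; apply/andP; split; apply/eqP; lra.
by apply: divr_ge0; [lra|rewrite mulr_ge0 ?exprn_ge0; lra].
Qed.

Lemma derive_ratio_cvg (f : R -> R) (d : R) (t : nat -> R) :
  is_derive (0 : R) 1 f d -> f 0 = 0 -> (forall n, t n != 0) -> t @ \oo --> 0 ->
  (f (t n) / t n) @[n --> \oo] --> d.
Proof.
move=> [df fd] f0 tn0 t0.
have : h^-1 *: (f (h *: 1 + 0) - f 0) @[h --> 0^'] --> d.
  by rewrite -fd; exact: df.
move=> /cvgr_dnbhsP /(_ t) H; have := H (conj tn0 t0).
under eq_cvg do rewrite f0 subr0 addr0 [_ *: 1]mulr1 /GRing.scale /= mulrC.
by [].
Qed.

Let dy (n : nat) : R := 2 ^- n.+1.

Let dy_gt0 n : 0 < dy n. Proof. by rewrite /dy invr_gt0 exprn_gt0. Qed.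

Let dy_cvg0 : dy @ \oo --> 0.
Proof.
have -> : dy = geometric 2^-1 2^-1.
  by apply/funext => n; rewrite /dy /geometric /= exprS invfM exprVn.
by apply: cvg_geometric; rewrite gtr0_norm; lra.
Qed.

Let csch_term a n j : R :=
  4 ^- n.+1 * recsch2 (sinh (a / 2 ^+ n.+1) ^+ 2) (sin (pi * j%:R / 2 ^+ n.+1) ^+ 2).

Let csch_term_cvg a j : a != 0 ->
  csch_term a n j @[n --> \oo] -->
  (a ^+ 2 - (pi * j%:R) ^+ 2) / (a ^+ 2 + (pi * j%:R) ^+ 2) ^+ 2.
Proof.
move=> a0; set b := pi * j%:R.
pose A n := sinh (a * dy n) / dy n; pose B n := sin (b * dy n) / dy n.
have An : A @ \oo --> a.
  apply: (@derive_ratio_cvg (fun t => sinh (a * t)) a dy) => //.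
  - rewrite /sinh; apply: is_derive_eq.
    by rewrite /GRing.scale /= !mulr0 oppr0 expR0; field.
  - by rewrite mulr0 /sinh oppr0 subrr mul0r.
  - by move=> n; rewrite gt_eqF.
have Bn : B @ \oo --> b.
  apply: (@derive_ratio_cvg (fun t => sin (b * t)) b dy) => //.
  - by apply: is_derive_eq; rewrite /GRing.scale /= !mulr0 cos0; ring.
  - by rewrite mulr0 sin0.
  - by move=> n; rewrite gt_eqF.
have -> : csch_term a ^~ j = fun n =>
    (A n * A n - B n * B n - 2 * (dy n * dy n) * (A n * A n) * (B n * B n))
    * ((A n * A n + B n * B n) * (A n * A n + B n * B n))^-1.
  apply/funext => n; rewrite /csch_term /recsch2 -/b.
  have -> : sinh (a / 2 ^+ n.+1) = A n * dy n by rewrite /A divfK ?gt_eqF.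
  have -> : sin (b / 2 ^+ n.+1) = B n * dy n by rewrite /B divfK ?gt_eqF.
  have -> : 4 ^- n.+1 = dy n ^+ 2 :> R.
    by rewrite /dy exprVn -exprM mulnC exprM; congr (_ ^- _); rewrite expr2 -natrM.
  have dn0 : dy n != 0 by rewrite gt_eqF.
  have An0 : 0 < A n ^+ 2.
    rewrite /A exprMn mulr_gt0 //; first by rewrite sinh2_gt0 // mulf_neq0.
    by rewrite exprn_gt0 // invr_gt0.
  have ABn : A n ^+ 2 + B n ^+ 2 != 0 by rewrite gt_eqF // ltr_pwDl // sqr_ge0.
  move: dn0 ABn; move: (dy n) (A n) (B n) => d x y d0 xy.
  have -> : (x * d) ^+ 2 + (y * d) ^+ 2 = d ^+ 2 * (x ^+ 2 + y ^+ 2) by ring.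
  by field; rewrite d0 -!expr2 xy.
have ab : 0 < a ^+ 2 + b ^+ 2 by rewrite ltr_pwDl ?sqr_ge0 // exprn_even_gt0.
have -> : (a ^+ 2 - b ^+ 2) / (a ^+ 2 + b ^+ 2) ^+ 2 =
  (a * a - b * b - 2 * (0 * 0) * (a * a) * (b * b))
   * ((a * a + b * b) * (a * a + b * b))^-1 by congr (_ * _^-1); ring.
apply: cvgM; last first.
  apply: cvgV; first by rewrite -!expr2 expf_neq0 // gt_eqF.
  by apply: cvgM; apply: cvgD; apply: cvgM.
apply: cvgB; first by apply: cvgB; apply: cvgM.
apply: cvgM; last exact: cvgM.
apply: cvgM; last exact: cvgM.
by apply: cvgM; [exact: cvg_cst|exact: cvgM].
Qed.

Let csch_term_bound a n j : a != 0 -> (0 < j <= 2 ^ n)%N ->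
  `|csch_term a n j| <= (j%:R ^+ 2)^-1.
Proof.
move=> a0 /andP[j0 jn]; rewrite /csch_term normrM.
have p0 : 0 < 2 ^+ n.+1 :> R by rewrite exprn_gt0.
rewrite ger0_norm ?invr_ge0 ?exprn_ge0 //.
have h0 : 0 < sinh (a / 2 ^+ n.+1) ^+ 2.
  by rewrite sinh2_gt0 ?mulf_neq0 // invr_eq0 gt_eqF.
apply: le_trans (ler_wpM2l _ (recsch2_bound h0 (sin2_le1 _))) _.
  by rewrite invr_ge0 exprn_ge0.
rewrite -invfM; have j0' : 0 < j%:R :> R by rewrite ltr0n.
rewrite lef_pV2 ?posrE ?exprn_gt0 ?mulr_gt0 ?exprn_gt0 //; last first.
  by rewrite ltr_pwDl // sqr_ge0.
have : (pi : R) * j%:R / 2 ^+ n.+1 / 2 <= sin (pi * j%:R / 2 ^+ n.+1).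
  apply: sin_ge_half; rewrite divr_ge0 ?mulr_ge0 ?pi_ge0 ?(ltW p0) //=.
  rewrite -mulrA ler_pM2l ?pi_gt0 // ler_pdivrMr // exprS mulKf //.
  by rewrite -natrX ler_nat.
set s := sin _; set q := 2 ^+ n.+1 in p0 *; set x := _ / 2 => xs.
have x1 : j%:R / q <= x.
  rewrite /x -[pi * _ / _]mulrA -mulrA mulrCA -{1}(mulr1 (_ / q)) ler_pM2l.
    by have := @pi_ge2 R; lra.
  by rewrite divr_gt0.
have -> : 4 ^+ n.+1 = q ^+ 2.
  by rewrite /q -exprM mulnC exprM; congr (_ ^+ _); rewrite expr2 -natrM.
have jq : 0 < j%:R / q by rewrite divr_gt0.
rewrite mulrDr; apply: ler_wpDl; first by rewrite mulr_ge0 ?sqr_ge0.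
rewrite -exprMn ler_sqr ?nnegrE ?(ltW j0') //.
  by rewrite mulrC -ler_pdivrMr //; lra.
by rewrite mulr_ge0 ?(ltW p0) //; lra.
Qed.

(** The expansion of [1 / sinh ^ 2] into partial fractions: the poles [i pi k] and [- i pi k]
    are grouped, and the pole 0 is moved to the right-hand side. *)
Lemma csch2_series a : a != 0 ->
  series (fun k => (a ^+ 2 - (pi * k.+1%:R) ^+ 2) / (a ^+ 2 + (pi * k.+1%:R) ^+ 2) ^+ 2)
   @ \oo --> ((sinh a ^+ 2)^-1 - (a ^+ 2)^-1) / 2.
Proof.
move=> a0.
pose u n j := csch_term a n j.+1.
apply: (@tannery u _ (fun j => (j.+1%:R ^+ 2)^-1) (fun J => 2 / J.+1%:R)
  (fun n => (2 ^ n).-1)).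
- by move=> j; exact: csch_term_cvg.
- move=> n j jn; apply: csch_term_bound => //=.
  by apply: leq_trans jn _; rewrite leq_pred.
- move=> j; near=> n.
  have jn : (j <= n)%N by near: n; exists j.
  apply: leq_trans jn _; rewrite -ltnS prednK ?expn_gt0 //; exact: ltn_expl.
- by move=> J K; exact: sum_invsqr.
- rewrite -[X in _ --> X](mulr0 2); apply: cvgM; first exact: cvg_cst.
  exact: cvg_harmonic.
pose w n : R := 4 ^- n.+1 * (1 + sinh (a / 2 ^+ n.+1) ^+ 2)^-1.
have key n : \sum_(0 <= j < (2 ^ n).-1) u n j =
    ((sinh a ^+ 2)^-1 - csch_term a n 0 + w n) / 2.
  have -> : (sinh a ^+ 2)^-1 = \sum_(0 <= j < 2 ^ n.+1) csch_term a n j.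
    rewrite /csch_term -mulr_sumr.
    have := recsch2_dyadic n.+1 0 a0; under eq_bigr do rewrite add0r.
    move=> <-; rewrite /recsch2 sin0 expr0n /= !mulr0 !subr0 addr0.
    by have := sinh2_gt0 a0; move: (sinh a ^+ 2) => h h0; field; rewrite gt_eqF.
  have hN : (2 ^ n.+1 = 2 ^ n + 2 ^ n)%N by rewrite expnS mul2n addnn.
  have N0 : (0 < 2 ^ n)%N by rewrite expn_gt0.
  rewrite hN [in RHS](@big_cat_nat _ _ _ (2 ^ n)) ?leq_addr //=.
  rewrite [in RHS]big_ltn // (@big_ltn _ _ _ (2 ^ n) (2 ^ n + 2 ^ n)%N); last first.
    by rewrite -{1}(addn0 (2 ^ n)%N) ltn_add2l.
  have -> : csch_term a n (2 ^ n)%N = - w n.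
    rewrite /csch_term /w -mulrN; congr (_ * _).
    have -> : sin (pi * (2 ^ n)%:R / 2 ^+ n.+1) = 1 :> R.
      rewrite -[RHS]sin_pihalf; congr sin; rewrite natrX exprS.
      by field; rewrite expf_neq0.
    rewrite /recsch2 expr1n; have := sqr_ge0 (sinh (a / 2 ^+ n.+1)).
    by move: (sinh _ ^+ 2) => h h0; clear hN N0; field; lra.
  have -> : \sum_((2 ^ n).+1 <= i < 2 ^ n + 2 ^ n) csch_term a n i =
      \sum_(0 <= j < (2 ^ n).-1) u n j.
    rewrite -add1n big_addn addnK big_nat_rev /= big_add1.
    rewrite big_nat [RHS]big_nat; apply: eq_bigr => j /andP[_ jN].
    rewrite /u /csch_term; congr (_ * recsch2 _ _).
    have -> : (pi * (1 + 2 ^ n - j.+2 + 2 ^ n)%:R / 2 ^+ n.+1 : R) =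
       - (pi * j.+1%:R / 2 ^+ n.+1) + pi.
      have -> : (1 + 2 ^ n - j.+2 + 2 ^ n)%N = (2 ^ n.+1 - j.+1)%N.
        by rewrite hN; move: jN N0; move: (2 ^ n)%N => N; lia.
      rewrite natrB; last by rewrite hN; move: jN N0; move: (2 ^ n)%N => N; lia.
      by rewrite natrX; field; rewrite expf_neq0.
    by rewrite sinDpi sinN opprK.
  rewrite big_add1 -/(u n) (eq_bigr (u n)) //.
  by field.
under eq_cvg do rewrite key.
apply: cvgM; last exact: cvg_cst.
rewrite -[X in _ --> X]addr0; apply: cvgD.
  apply: cvgB; first exact: cvg_cst.
  have := @csch_term_cvg a 0%N a0; rewrite mulr0 expr0n /= subr0 addr0.
  by rewrite (_ : a ^+ 2 / _ = (a ^+ 2)^-1) //; field.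
apply: (@squeeze_cvgr _ _ _ _ (fun=> 0) dy) => //; last exact: cvg_cst.
near=> n; rewrite /w mulr_ge0 ?invr_ge0 ?exprn_ge0 ?addr_ge0 ?sqr_ge0 //=.
have h0 := sqr_ge0 (sinh (a / 2 ^+ n.+1)).
apply: (@le_trans _ _ (4 ^- n.+1 * 1)).
  rewrite ler_wpM2l ?invr_ge0 ?exprn_ge0 // invf_le1 ?lerDl //.
  by rewrite ltr_pwDl.
rewrite mulr1 /dy lef_pV2 ?posrE ?exprn_gt0 //.
by rewrite lerXn2r // ?nnegrE // ler_nat.
Unshelve. all: by end_near. Qed.
End CosecantSquared.

(** * Real values of the Weierstrass function *)

Local Open Scope complex_scope.
Section RectangularLattice.
Context {R : realType}.
Variables (tau L : R).
Hypotheses (tau_gt0 : 0 < tau) (L_gt0 : 0 < L).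
Implicit Types (s t : R).

Definition sum_sym (V : zmodType) (N : nat) (G : int -> V) : V :=
  \sum_(k < N.*2.+1) G (k%:Z - N%:Z).

Lemma sum_symE (V : zmodType) (N : nat) (G : int -> V) :
  sum_sym N G = G 0 + \sum_(0 <= j < N) (G j.+1%:Z + G (- j.+1%:Z)).
Proof.
rewrite /sum_sym; elim: N => [|N IHN].
  by rewrite big_ord1 big_geq // !addr0.
rewrite [in RHS]big_nat_recr //= [in RHS]addrA -IHN.
rewrite doubleS big_ord_recl big_ord_recr /= addrCA [G (0%:Z - _) + _]addrC; congr (_ + _).
  by apply: eq_bigr => k _; congr G; rewrite /bump /=; lia.
by congr (_ + _); congr G; rewrite /bump /=; lia.
Qed.

(** The real part of [1 / (s + i k tau) ^ 2]. *)
Definition term (k : nat) s : R :=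
  (s ^+ 2 - (k%:R * tau) ^+ 2) / (s ^+ 2 + (k%:R * tau) ^+ 2) ^+ 2.

(** The sum of [1 / (s - i k tau) ^ 2] over [|k| <= N]; it is real, since conjugate terms
    are grouped. *)
Definition column (N : nat) s : R := term 0 s + \sum_(0 <= j < N) term j.+1 s *+ 2.

Lemma invsqr_conj (s c : R) : c != 0 ->
  ((s%:C - c%:C * 'i) ^+ 2)^-1 + ((s%:C + c%:C * 'i) ^+ 2)^-1 =
  ((s ^+ 2 - c ^+ 2) / (s ^+ 2 + c ^+ 2) ^+ 2 *+ 2)%:C.
Proof.
move=> c0; have ii : 'i ^+ 2 = - 1 :> R[i] by exact: sqr_i.
have pos : 0 < s ^+ 2 + c ^+ 2 by rewrite ltr_wpDl ?sqr_ge0 // exprn_even_gt0.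
have prodE : (s%:C - c%:C * 'i) * (s%:C + c%:C * 'i) = (s ^+ 2 + c ^+ 2)%:C.
  transitivity (s%:C ^+ 2 - c%:C ^+ 2 * 'i ^+ 2); first by ring.
  by rewrite ii mulrN1 opprK rmorphD !rmorphXn.
have pC : (s ^+ 2 + c ^+ 2)%:C != 0 :> R[i].
  by rewrite -[0]/(0%:C) (inj_eq (@complexI R)) gt_eqF.
have : (s%:C - c%:C * 'i) * (s%:C + c%:C * 'i) != 0 by rewrite prodE.
rewrite mulf_eq0 negb_or => /andP[u0 v0].
transitivity (((s ^+ 2 - c ^+ 2) *+ 2)%:C / (s ^+ 2 + c ^+ 2)%:C ^+ 2); last first.
  by rewrite -mulrnAl -rmorphXn -fmorphV -rmorphM.
rewrite -prodE; have -> : ((s ^+ 2 - c ^+ 2) *+ 2)%:C =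
    (s%:C - c%:C * 'i) ^+ 2 + (s%:C + c%:C * 'i) ^+ 2 :> R[i].
  transitivity ((s%:C ^+ 2 + c%:C ^+ 2 * 'i ^+ 2) *+ 2); last by ring.
  by rewrite ii mulrN1 rmorphMn rmorphB !rmorphXn.
by field; rewrite u0 v0.
Qed.

Lemma column_complex N s :
  sum_sym N (fun k => ((s%:C - (k%:~R * tau)%:C * 'i) ^+ 2)^-1) = (column N s)%:C.
Proof.
rewrite sum_symE /column rmorphD rmorph_sum /=; congr (_ + _).
  rewrite mulr0z /term !mul0r expr0n /= !subr0 addr0.
  have [->|s0] := eqVneq s 0; first by rewrite !expr0n /= !mul0r invr0.
  by rewrite -rmorphXn -fmorphV; congr (_%:C); field.
apply: eq_bigr => j _; rewrite /term -invsqr_conj.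
  by rewrite mulrNz mulNr rmorphN mulNr opprK.
by rewrite mulf_neq0 ?pnatr_eq0 ?gt_eqF.
Qed.

(** The partial sums of the Weierstrass function at a real point, by columns of the lattice.
    Its leading term [1 / t ^ 2] is the one of the lattice point 0, because [1 / 0 = 0]. *)
Definition rectangular_partial N t : R :=
  sum_sym N (fun l => column N (t - l%:~R * L) - column N (- (l%:~R * L))).

Lemma lattice_pointE (k l : int) :
  lattice_point (tau*i) L%:C k l = (l%:~R * L)%:C + (k%:~R * tau)%:C * 'i.
Proof.
rewrite /lattice_point addrC !rmorphM /= !rmorph_int -mulrA; congr (_ + _ * _).
by rewrite -[RHS]/(_ * _)%R; simpc.
Qed.

Lemma lattice_point_eq0 (k l : int) :
  (lattice_point (tau*i) L%:C k l == 0) = (k == 0) && (l == 0).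
Proof.
rewrite lattice_pointE; simpc; rewrite eq_complex /= !mulf_eq0 !intr_eq0 andbC.
by rewrite (gt_eqF tau_gt0) (gt_eqF L_gt0) !orbF.
Qed.

Lemma wp_partialE t N : wp_partial (tau*i) L%:C t%:C N = (rectangular_partial N t)%:C.
Proof.
pose a k l := ((t%:C - lattice_point (tau*i) L%:C k l) ^+ 2)^-1.
pose b k l := ((lattice_point (tau*i) L%:C k l) ^+ 2)^-1.
have -> : (rectangular_partial N t)%:C =
    sum_sym N (fun k => sum_sym N (fun l => a k l - b k l)).
  rewrite /rectangular_partial /sum_sym exchange_big rmorph_sum /=.
  apply: eq_bigr => l _; rewrite rmorphB /= -!column_complex -sumrB.
  apply: eq_bigr => k _; congr (_ - _).
    by rewrite /a lattice_pointE rmorphB /= opprD addrA.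
  by rewrite /b lattice_pointE rmorphN /= -opprD sqrrN.
rewrite /wp_partial /sum_sym.
have -> : (t%:C ^+ 2)^-1 = \sum_(k < N.*2.+1) \sum_(l < N.*2.+1)
    if (k == N :> nat) && (l == N :> nat) then (t%:C ^+ 2)^-1 else 0.
  have NN : (N < N.*2.+1)%N by rewrite ltnS -addnn leq_addr.
  rewrite (bigD1 (Ordinal NN)) //= (bigD1 (Ordinal NN)) //= eqxx /=.
  rewrite big1 ?addr0 => [|l /negPf lN]; last by rewrite -val_eqE /= in lN; rewrite lN.
  rewrite big1 ?addr0 // => k /negPf kN; rewrite -val_eqE /= in kN.
  by rewrite big1 // => l _; rewrite kN.
rewrite -big_split; apply: eq_bigr => k _; rewrite -big_split; apply: eq_bigr => l _ /=.
rewrite lattice_point_eq0 !subr_eq0 !eqz_nat.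
case: ifP => [/andP[/eqP -> /eqP ->]|_]; last by rewrite add0r.
have lp0 : lattice_point (tau*i) L%:C (N%:Z - N%:Z) (N%:Z - N%:Z) = 0.
  by rewrite subrr; apply/eqP; rewrite lattice_point_eq0.
by rewrite /a /b lp0 addr0 expr0n /= invr0 !subr0.
Qed.

(** The double poles on a vertical line add up to a multiple of [1 / sinh ^ 2]. *)
Definition full_column s : R := (pi / tau) ^+ 2 / sinh (pi * s / tau) ^+ 2.

Lemma column_cvg s : s != 0 -> column N s @[N --> \oo] --> full_column s.
Proof.
move=> s0; have p0 := @pi_gt0 R.
have a0 : pi * s / tau != 0 by rewrite mulf_neq0 ?invr_eq0 ?(gt_eqF tau_gt0) // mulf_neq0 ?(gt_eqF p0).
have H := csch2_series a0.
have -> : column ^~ s = fun N => term 0 s + (pi / tau) ^+ 2 * 2 *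
   series (fun k => ((pi * s / tau) ^+ 2 - (pi * k.+1%:R) ^+ 2) /
                    ((pi * s / tau) ^+ 2 + (pi * k.+1%:R) ^+ 2) ^+ 2) N.
  apply/funext => N; rewrite /column /series /=; congr (_ + _).
  rewrite mulr_sumr; apply: eq_bigr => k _; rewrite /term.
  have k0 : k.+1%:R != 0 :> R by rewrite pnatr_eq0.
  move: (k.+1%:R : R) k0 => c c0.
  have c1 : s ^+ 2 + (c * tau) ^+ 2 != 0.
    by rewrite gt_eqF // ltr_pwDl ?sqr_ge0 // exprn_even_gt0.
  move: (@pi R) {H a0} p0 => P p0.
  have -> : (P * s / tau) ^+ 2 + (P * c) ^+ 2 =
     (P / tau) ^+ 2 * (s ^+ 2 + (c * tau) ^+ 2).
    by field; rewrite (gt_eqF tau_gt0).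
  by field; rewrite c1 (gt_eqF tau_gt0) (gt_eqF p0).
have -> : full_column s = term 0 s +
   (pi / tau) ^+ 2 * 2 * (((sinh (pi * s / tau) ^+ 2)^-1 - ((pi * s / tau) ^+ 2)^-1) / 2).
  rewrite /full_column /term mul0r expr0n /= subr0 addr0.
  have := sinh2_gt0 a0; move: (sinh _ ^+ 2) => h h0.
  move: (@pi R) {H a0} p0 => P p0.
  by field; rewrite s0 (gt_eqF tau_gt0) (gt_eqF h0) (gt_eqF p0).
apply: cvgD; first exact: cvg_cst.
by apply: cvgM => //; exact: cvg_cst.
Qed.

Lemma term_diff k s s' : (0 < k)%N ->
  `|term k s - term k s'| <= 5 * `|s - s'| / (k%:R * tau) ^+ 3.
Proof.
move=> k0; rewrite /term; set c := k%:R * tau.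
have c0 : 0 < c by rewrite mulr_gt0 // ltr0n.
have half u : `|u| / (u ^+ 2 + c ^+ 2) <= (2 * c)^-1 /\
     0 < u ^+ 2 + c ^+ 2 /\ (u ^+ 2 + c ^+ 2)^-1 <= (c ^+ 2)^-1.
  have pos : 0 < u ^+ 2 + c ^+ 2 by rewrite ltr_wpDl ?sqr_ge0 ?exprn_gt0.
  split; last split => //.
    rewrite ler_pdivrMr // mulrC ler_pdivlMr; last by rewrite mulr_gt0.
    have := sqr_ge0 (`|u| - c); rewrite -(real_normK (num_real u)).
    move: `|u| => v; nra.
  by rewrite lef_pV2 ?posrE ?exprn_gt0 // lerDr sqr_ge0.
have [hs [ps ips]] := half s; have [hs' [ps' ips']] := half s'.
move: ps ps' hs hs' ips ips'; set p := s ^+ 2 + c ^+ 2; set q := s' ^+ 2 + c ^+ 2.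
move=> p0 q0 hs hs' ip iq.
have -> : (s ^+ 2 - c ^+ 2) / p ^+ 2 - (s' ^+ 2 - c ^+ 2) / q ^+ 2 =
   (s' - s) * ((s + s') / (p * q)) * (1 - 2 * c ^+ 2 * (p^-1 + q^-1)).
  have -> : s ^+ 2 - c ^+ 2 = p - 2 * c ^+ 2 by rewrite /p; ring.
  have -> : s' ^+ 2 - c ^+ 2 = q - 2 * c ^+ 2 by rewrite /q; ring.
  have -> : (s' - s) * ((s + s') / (p * q)) = (q - p) / (p * q).
    by rewrite mulrA; congr (_ / _); rewrite /p /q; ring.
  by field; rewrite !gt_eqF.
rewrite 2!normrM distrC.
have -> : 5 * `|s - s'| / c ^+ 3 = `|s - s'| * ((c ^+ 3)^-1 * 5) by ring.
rewrite -mulrA ler_wpM2l //; apply: ler_pM => //.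
  rewrite normrM normfV [`|p * q|]gtr0_norm ?mulr_gt0 //.
  have -> : (c ^+ 3)^-1 = (2 * c)^-1 * (c ^+ 2)^-1 + (2 * c)^-1 * (c ^+ 2)^-1.
    by field; rewrite gt_eqF.
  apply: (@le_trans _ _ (`|s| / p * q^-1 + `|s'| / q * p^-1)).
    have -> : `|s| / p * q^-1 + `|s'| / q * p^-1 = (`|s| + `|s'|) / (p * q).
      by field; rewrite !gt_eqF.
    by rewrite ler_wpM2r ?invr_ge0 ?mulr_ge0 ?ler_normD // ltW.
  apply: lerD; apply: ler_pM => //; rewrite ?invr_ge0 ?mulr_ge0 ?invr_ge0 // ltW //.
have e1 : 0 <= 2 * c ^+ 2 * (p^-1 + q^-1).
  by rewrite !mulr_ge0 ?addr_ge0 ?invr_ge0 ?exprn_ge0 // ltW.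
have : 2 * c ^+ 2 * (p^-1 + q^-1) <= 2 * c ^+ 2 * ((c ^+ 2)^-1 + (c ^+ 2)^-1).
  by rewrite ler_wpM2l ?lerD // mulr_ge0 // exprn_ge0 // ltW.
have -> : 2 * c ^+ 2 * ((c ^+ 2)^-1 + (c ^+ 2)^-1) = 4 by field; rewrite gt_eqF.
by rewrite ler_norml; lra.
Qed.

Lemma column_tail N s s' : s != 0 -> s' != 0 ->
  `|(column N s - column N s') - (full_column s - full_column s')| <=
  20 * `|s - s'| / tau ^+ 3 / N.+1%:R ^+ 2.
Proof.
move=> s0 s'0.
have cv : `|(column N s - column N s') - (column M s - column M s')| @[M --> \oo] -->
    `|(column N s - column N s') - (full_column s - full_column s')|.
  apply: cvg_norm; apply: cvgB; first exact: cvg_cst.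
  by apply: cvgB; exact: column_cvg.
apply: (ler_cvg_to cv (cvg_cst _)).
near=> M; have NM : (N <= M)%N by near: M; exists N.
rewrite distrC /column.
rewrite !(@big_cat_nat _ _ _ N 0 M) //=.
set A := \sum_(0 <= _ < N) _; set B := \sum_(0 <= _ < N) _.
set A' := \sum_(N <= _ < M) _; set B' := \sum_(N <= _ < M) _.
have -> : term 0 s + (A + A') - (term 0 s' + (B + B')) -
   (term 0 s + A - (term 0 s' + B)) = A' - B' by ring.
rewrite -sumrB; apply: le_trans (ler_norm_sum _ _ _) _.
have n0 : 0 < N.+1%:R :> R by rewrite ltr0n.
apply: (@le_trans _ _ (10 * `|s - s'| / tau ^+ 3 / N.+1%:R *
    \sum_(N <= j < M) (j.+1%:R ^+ 2)^-1)).
  rewrite mulr_sumr !big_nat; apply: ler_sum => j /andP[Nj _].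
  rewrite -mulrnBl normrMn.
  have j0 : 0 < j.+1%:R :> R by rewrite ltr0n.
  apply: (@le_trans _ _ (2 * (5 * `|s - s'| / (j.+1%:R * tau) ^+ 3))).
    by rewrite mulr_natl lerMn2r term_diff.
  have -> : 2 * (5 * `|s - s'| / (j.+1%:R * tau) ^+ 3) =
     10 * `|s - s'| / tau ^+ 3 / j.+1%:R * (j.+1%:R ^+ 2)^-1.
    by field; rewrite !gt_eqF.
  rewrite ler_wpM2r ?invr_ge0 ?exprn_ge0 ?(ltW j0) //.
  rewrite ler_wpM2l ?mulr_ge0 ?invr_ge0 ?exprn_ge0 ?(ltW tau_gt0) //.
  by rewrite lef_pV2 ?posrE // ler_nat.
apply: (@le_trans _ _ (10 * `|s - s'| / tau ^+ 3 / N.+1%:R * (2 / N.+1%:R))).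
  rewrite ler_wpM2l ?sum_invsqr // ?mulr_ge0 ?invr_ge0 ?exprn_ge0 //; exact: ltW.
by rewrite le_eqVlt; apply/orP; left; apply/eqP; field; rewrite (gt_eqF tau_gt0) addrC natr1 (gt_eqF n0).
Unshelve. all: by end_near. Qed.

Lemma sinhB (m d : R) : sinh (m + d) * sinh (m - d) = sinh m ^+ 2 - sinh d ^+ 2.
Proof.
rewrite /sinh !(opprD, opprB, expRD) opprK.
have := expRxMexpNx_1 m; have := expRxMexpNx_1 d.
move: (expR m) (expR (- m)) (expR d) (expR (- d)) => a b c e ce ab.
transitivity ((a ^+ 2 * (c * e) + b ^+ 2 * (c * e) - (a * b) * (c ^+ 2 + e ^+ 2)) / 4).
  by field.
rewrite ce ab; transitivity ((a ^+ 2 + b ^+ 2 - 2 * (a * b)) / 4 -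
  (c ^+ 2 + e ^+ 2 - 2 * (c * e)) / 4); last by field.
by rewrite ce ab; field.
Qed.

Let om : R := pi / tau.
Let om_gt0 : 0 < om. Proof. by rewrite /om divr_gt0 // pi_gt0. Qed.

Let full_columnE s : full_column s = om ^+ 2 / sinh (om * s) ^+ 2.
Proof. by rewrite /full_column /om [pi / tau * s]mulrAC. Qed.

Lemma full_columnN s : full_column (- s) = full_column s.
Proof. by rewrite !full_columnE mulrN sinhN sqrrN. Qed.

Lemma full_column_ge0 s : 0 <= full_column s.
Proof. by rewrite full_columnE divr_ge0 ?sqr_ge0. Qed.

Lemma full_column_bound s : s != 0 -> full_column s <= (s ^+ 2)^-1.
Proof.
move=> s0; rewrite full_columnE.
have h : 0 < sinh (om * s) ^+ 2 by rewrite sinh2_gt0 // mulf_neq0 // gt_eqF.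
rewrite ler_pdivrMr // mulrC ler_pdivlMr; last by rewrite exprn_even_gt0.
by rewrite -exprMn sinh2_ge.
Qed.

(** Strict midpoint convexity: by the inequality between the means, it is enough to bound the
    product of the two values, and [sinhB] computes it. *)
Lemma full_column_midpoint (m d : R) : `|d| < m ->
  full_column m *+ 2 <= full_column (m + d) + full_column (m - d) ?= iff (d == 0).
Proof.
move=> dm; have [d1 d2] : - m < d /\ d < m by move: dm; rewrite ltr_norml => /andP.
rewrite !full_columnE -mulrnAr -mulrDr.
set X := sinh (om * (m + d)); set Y := sinh (om * (m - d)); set M := sinh (om * m).
have X0 : 0 < X by rewrite sinh_gt0 // mulr_gt0 //; lra.
have Y0 : 0 < Y by rewrite sinh_gt0 // mulr_gt0 //; lra.
have M0 : 0 < M by rewrite sinh_gt0 // mulr_gt0 //; lra.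
have XY : X * Y = M ^+ 2 - sinh (om * d) ^+ 2.
  by rewrite /X /Y mulrDr mulrBr sinhB.
have [d0|d0] := eqVneq d 0.
  split; first by rewrite /X /Y d0 !addr0 subr0 -/M mulr2n.
  by rewrite /X /Y d0 !addr0 subr0 -/M mulr2n eqxx.
have lt : (M ^+ 2)^-1 *+ 2 < (X ^+ 2)^-1 + (Y ^+ 2)^-1.
  apply: (@lt_le_trans _ _ ((X * Y)^-1 *+ 2)).
    have XY0 : 0 < X * Y by rewrite mulr_gt0.
    have XYM : X * Y < M ^+ 2.
      by rewrite XY gtrBl sinh2_gt0 // mulf_neq0 // gt_eqF.
    by rewrite ltrMn2r /= ltf_pV2 ?posrE // exprn_gt0.
  have := sqr_ge0 (X^-1 - Y^-1); rewrite -!exprVn (invfM X Y).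
  by move: (X^-1) (Y^-1) => a b; rewrite mulr2n; lra.
have om2 : 0 < om ^+ 2 by rewrite exprn_gt0.
by split; [rewrite ler_pM2l // ltW|rewrite (inj_eq (mulfI (lt0r_neq0 om2))) lt_eqF].
Qed.

Lemma term_bound k s : s != 0 -> `|term k s| <= (s ^+ 2)^-1.
Proof.
move=> s0; rewrite /term; set c := k%:R * tau.
have h : 0 < s ^+ 2 by rewrite exprn_even_gt0.
have h2 := sqr_ge0 c.
rewrite normrM normfV [X in _ / X]gtr0_norm; last by rewrite exprn_gt0 // ltr_pwDl.
apply: (@le_trans _ _ ((s ^+ 2 + c ^+ 2) / (s ^+ 2 + c ^+ 2) ^+ 2)).
  by rewrite ler_wpM2r ?invr_ge0 ?sqr_ge0 // ler_norml; lra.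
have -> : (s ^+ 2 + c ^+ 2) / (s ^+ 2 + c ^+ 2) ^+ 2 = (s ^+ 2 + c ^+ 2)^-1.
  by rewrite expr2 invfM mulVKf // gt_eqF // ltr_pwDl.
by rewrite lef_pV2 ?posrE ?lerDl // ltr_pwDl.
Qed.

Lemma column_bound N s : s != 0 -> `|column N s| <= N.*2.+1%:R / s ^+ 2.
Proof.
move=> s0; have h : 0 < s ^+ 2 by rewrite exprn_even_gt0.
apply: le_trans (ler_normD _ _) _.
rewrite -[N.*2.+1]addn1 natrD addrC mulrDl mul1r; apply: lerD; last exact: term_bound.
apply: le_trans (ler_norm_sum _ _ _) _.
apply: (@le_trans _ _ (\sum_(0 <= j < N) (s ^+ 2)^-1 *+ 2)).
  by apply: ler_sum => j _; rewrite normrMn lerMn2r term_bound.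
by rewrite sumr_const_nat subn0 -mulrnA -mul2n mulr_natl.
Qed.

Lemma column_far (s : nat -> R) (d : R) : 0 < d ->
  (\forall N \near \oo, d * N.+1%:R <= `|s N|) -> column N (s N) @[N --> \oo] --> 0.
Proof.
move=> d0 sd.
apply: norm_cvg0.
apply: (@squeeze_cvgr _ _ _ _ (fun=> 0) (fun N => 2 / d ^+ 2 * N.+1%:R^-1)).
- near=> N; rewrite normr_ge0 /=.
  have n0 : 0 < N.+1%:R :> R by rewrite ltr0n.
  have dN : d * N.+1%:R <= `|s N| by near: N.
  have sN0 : 0 < `|s N| by apply: lt_le_trans dN; rewrite mulr_gt0.
  have sN : s N != 0 by rewrite -normr_gt0.
  apply: le_trans (column_bound N sN) _.
  apply: (@le_trans _ _ (2 * N.+1%:R / (d * N.+1%:R) ^+ 2)).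
    apply: ler_pM; rewrite ?invr_ge0 ?sqr_ge0 //.
      by rewrite -natrM ler_nat mul2n doubleS ltnW.
    have dn : 0 < (d * N.+1%:R) ^+ 2 by rewrite exprn_gt0 // mulr_gt0.
    have s2 : 0 < s N ^+ 2 by rewrite exprn_even_gt0.
    rewrite lef_pV2 ?posrE //.
    by rewrite -[s N ^+ 2]real_normK ?num_real // lerXn2r ?nnegrE // ?mulr_ge0 // ltW.
  by rewrite le_eqVlt; apply/orP; left; apply/eqP; field; rewrite (gt_eqF d0) addrC natr1 (gt_eqF n0).
- exact: cvg_cst.
- rewrite -[X in _ --> X](mulr0 (2 / d ^+ 2)); apply: cvgM; first exact: cvg_cst.
  exact: cvg_harmonic.
Unshelve. all: by end_near. Qed.

Lemma is_cvg_invsqr : cvgn (series (fun j => (j.+1%:R ^+ 2)^-1 : R)).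
Proof.
apply: nondecreasing_is_cvgn.
  by apply/nondecreasing_seqP => n; rewrite /series /= big_nat_recr //= lerDl invr_ge0 sqr_ge0.
by exists 2 => _ [n _ <-]; have := @sum_invsqr R 0 n; rewrite divr1.
Qed.

Lemma cvg_series_invsqr (u : nat -> R) (c : R) :
  (forall j, 0 <= u j <= c * (j.+1%:R ^+ 2)^-1) -> cvgn (series u).
Proof.
move=> uc; have c0 : 0 <= c.
  by have /andP[u0 u1] := uc 0%N; move: (le_trans u0 u1); rewrite expr1n invr1 mulr1.
apply: (@series_le_cvg _ u (fun j => c * (j.+1%:R ^+ 2)^-1)).
- by move=> n; have /andP[] := uc n.
- by move=> n; rewrite mulr_ge0 // invr_ge0 sqr_ge0.
- by move=> n; have /andP[] := uc n.
- have -> : series (fun j => c * (j.+1%:R ^+ 2)^-1) =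
      fun n => c * series (fun j => (j.+1%:R ^+ 2)^-1) n.
    by apply/funext => n; rewrite /series /= mulr_sumr.
  by apply: is_cvgM; [exact: is_cvg_cst|exact: is_cvg_invsqr].
Qed.

Lemma rectangular_partial_shift N t :
  rectangular_partial N (t + L) - rectangular_partial N t =
  column N (t + N.+1%:R * L) - column N (t - N%:R * L).
Proof.
rewrite /rectangular_partial /sum_sym -sumrB.
pose h (k : nat) := - column N (t + L - (k%:Z - N%:Z)%:~R * L).
rewrite (eq_bigr (fun k : 'I_N.*2.+1 => h k.+1 - h k)); last first.
  move=> k _; rewrite opprB addrA subrK /h opprK addrC; congr (- column N _ + _).
  by rewrite intS !rmorphB rmorphD /= -!pmulrn; ring.
rewrite -(big_mkord predT (fun k => h k.+1 - h k)) telescope_sumr //.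
rewrite /h opprK addrC; congr (column N _ - column N _).
  by rewrite sub0r rmorphN /= -!pmulrn -natr1; ring.
by rewrite rmorphB /= -!pmulrn -natr1 -addnn natrD; ring.
Qed.

(** The columns at [t + j L] and at [(j + 1) L - t] are exchanged by [t -> L - t]. *)
Definition paired (t : R) (j : nat) : R :=
  full_column (t + j%:R * L) + full_column (j.+1%:R * L - t).

Lemma is_cvg_paired t : 0 < t < L -> cvgn (series (paired t)).
Proof.
move=> /andP[t0 tL].
apply: (@cvg_series_invsqr _ ((t ^+ 2)^-1 + ((L - t) ^+ 2)^-1)) => j.
rewrite addr_ge0 ?full_column_ge0 //= mulrDl -!invfM -!exprMn.
have j0 : 0 <= j%:R :> R by rewrite ler0n.
rewrite /paired -natr1; apply: lerD.
  have h : t * (j%:R + 1) <= t + j%:R * L by nra.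
  have h1 : 0 < t * (j%:R + 1) by nra.
  apply: le_trans (full_column_bound _) _; first by rewrite gt_eqF //; lra.
  by rewrite lef_pV2 ?posrE ?exprn_gt0 ?lerXn2r ?nnegrE //; lra.
have h : (L - t) * (j%:R + 1) <= (j%:R + 1) * L - t by nra.
have h1 : 0 < (L - t) * (j%:R + 1) by nra.
apply: le_trans (full_column_bound _) _; first by rewrite gt_eqF //; lra.
by rewrite lef_pV2 ?posrE ?exprn_gt0 ?lerXn2r ?nnegrE //; lra.
Qed.

(** Each pair of columns is convex and symmetric with respect to [L / 2]. *)
Lemma paired_min t : 0 < t < L -> t != L / 2 ->
  limn (series (paired (L / 2))) < limn (series (paired t)).
Proof.
move=> tI tn; have /andP[t0 tL] := tI.
have hI : 0 < L / 2 < L by apply/andP; split; lra.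
have le j : paired (L / 2) j <= paired t j ?= iff (t == L / 2).
  have j0 : 0 <= j%:R :> R by rewrite ler0n.
  rewrite /paired.
  have -> : j.+1%:R * L - L / 2 = L / 2 + j%:R * L by rewrite -natr1; field.
  rewrite -mulr2n.
  have := @full_column_midpoint (L / 2 + j%:R * L) (t - L / 2).
  have -> : L / 2 + j%:R * L + (t - L / 2) = t + j%:R * L by ring.
  have -> : L / 2 + j%:R * L - (t - L / 2) = j.+1%:R * L - t by rewrite -natr1; field.
  by rewrite subr_eq0; apply; rewrite ltr_norml; apply/andP; split; nra.
rewrite -subr_gt0.
apply: (@lt_le_trans _ _ (paired t 0 - paired (L / 2) 0)).
  by rewrite subr_gt0 (lt_leif (le 0%N)).
have cv : (series (paired t) n - series (paired (L / 2)) n) @[n --> \oo] -->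
   limn (series (paired t)) - limn (series (paired (L / 2))).
  by apply: cvgB; apply: is_cvg_paired.
apply: (ler_cvg_to (cvg_cst _) cv).
near=> n; have n0 : (0 < n)%N by near: n; exists 1%N.
rewrite /series /= -sumrB big_ltn //= lerDl; apply: sumr_ge0 => j _.
by rewrite subr_ge0 (le j).
Unshelve. all: by end_near. Qed.

(** A translation by [L] telescopes: it leaves only two columns, whose distance to the origin
    grows with [N]. *)
Lemma rectangular_partial_shift_cvg t (n : int) (l : R) :
  rectangular_partial N t @[N --> \oo] --> l ->
  rectangular_partial N (t + n%:~R * L) @[N --> \oo] --> l.
Proof.
have L0 := L_gt0.
have far u : column N (u + N.+1%:R * L) - column N (u - N%:R * L) @[N --> \oo] --> 0.
  rewrite -[X in _ --> X]subr0; have L2 : 0 < L / 2 by lra.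
  have big : \forall N \near \oo, `|u| + L <= (L / 2) * N.+1%:R.
    near=> N; have : 2 * (`|u| + L) / L <= N%:R.
      by near: N; exact: (nbhs_infty_ger (2 * (`|u| + L) / L)).
    by rewrite ler_pdivrMr // -[N.+1%:R]natr1; lra.
  apply: cvgB; apply: (column_far L2); near=> N.
    have : `|u| + L <= (L / 2) * N.+1%:R by near: N.
    have := ler_norm u; have := lerNnormlW (lexx `|u|) => /= h1 h2 h3.
    by apply: le_trans (ler_norm _); lra.
  have : `|u| + L <= (L / 2) * N.+1%:R by near: N.
  have := ler_norm u => h2; rewrite -[N.+1%:R]natr1 => h3.
  by rewrite distrC; apply: le_trans (ler_norm _); lra.
have stepS u : rectangular_partial N u @[N --> \oo] --> l <->
    rectangular_partial N (u + L) @[N --> \oo] --> l.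
  split=> H.
    rewrite -[l]addr0; have -> : (fun N => rectangular_partial N (u + L)) =
        fun N => rectangular_partial N u + (column N (u + N.+1%:R * L) - column N (u - N%:R * L)).
      by apply/funext => N; rewrite -rectangular_partial_shift; ring.
    exact: cvgD.
  rewrite -[l]subr0; have -> : (fun N => rectangular_partial N u) = fun N =>
      rectangular_partial N (u + L) - (column N (u + N.+1%:R * L) - column N (u - N%:R * L)).
    by apply/funext => N; rewrite -rectangular_partial_shift; ring.
  exact: cvgB.
elim/int_ind: n => [|n IHn|n IHn] H.
- by rewrite mul0r addr0.
- have -> : t + n.+1%:~R * L = t + n%:~R * L + L by rewrite -!pmulrn -[n.+1%:R]natr1; ring.
  by apply: (stepS _).1; exact: IHn.
- apply: (stepS _).2; have -> : t + (- n.+1%:Z)%:~R * L + L = t + (- n%:Z)%:~R * L.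
    by rewrite !rmorphN /= -!pmulrn -[n.+1%:R]natr1; ring.
  exact: IHn.
Unshelve. all: by end_near. Qed.

Lemma rectangular_partial_cvg : exists kappa : R, forall t, 0 < t < L ->
  rectangular_partial N t @[N --> \oo] --> limn (series (paired t)) - kappa.
Proof.
have L0' := L_gt0.
pose K N : R := column N 0 +
  \sum_(0 <= j < N) (full_column (- (j.+1%:R * L)) + full_column (j.+1%:R * L)).
have K1 : cvgn (fun N => column N 0).
  have -> : (fun N => column N 0) = (fun N => - (2 / tau ^+ 2) *
       series (fun j => (j.+1%:R ^+ 2)^-1) N).
    apply/funext => N; rewrite /column /term !expr0n /= !mul0r expr0n /= subr0 mul0r add0r.
    rewrite /series /= mulr_sumr; apply: eq_bigr => j _.
    have j0 : j.+1%:R != 0 :> R by rewrite pnatr_eq0.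
    by field; rewrite (gt_eqF tau_gt0) addrC natr1 j0.
  by apply: is_cvgM; [exact: is_cvg_cst|exact: is_cvg_invsqr].
have K2 : cvgn (series (fun j => full_column (- (j.+1%:R * L)) + full_column (j.+1%:R * L))).
  apply: (@cvg_series_invsqr _ (2 / L ^+ 2)) => j.
  rewrite addr_ge0 ?full_column_ge0 //= full_columnN.
  have j0 : 0 < j.+1%:R :> R by rewrite ltr0n.
  have := @full_column_bound (j.+1%:R * L); rewrite gt_eqF ?mulr_gt0 // => /(_ isT).
  have -> : 2 / L ^+ 2 / j.+1%:R ^+ 2 = 2 * ((j.+1%:R * L) ^+ 2)^-1.
    by rewrite -mulrA -invfM -exprMn [L * _]mulrC.
  by move: (((_ * L) ^+ 2)^-1) => z; lra.
have Kc : cvgn K by exact: is_cvgD K1 K2.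
exists (limn K) => t tI; have /andP[t0 tL] := tI.
pose F N : R := series (paired t) N + full_column (t + N%:R * L).
have FE N : F N = full_column t + \sum_(0 <= j < N)
   (full_column (t - j.+1%:R * L) + full_column (t + j.+1%:R * L)).
  rewrite /F /series /= /paired !big_split /=.
  pose G j := full_column (t + j%:R * L).
  have sh : \sum_(0 <= j < N) G j + G N = full_column t + \sum_(0 <= j < N) G j.+1.
    have -> : full_column t = G 0%N by rewrite /G mul0r addr0.
    by rewrite -big_nat_recr // big_nat_recl.
  rewrite addrAC sh [in RHS]addrCA [in RHS]addrC; congr (_ + _).
  by apply: eq_bigr => j _; rewrite -full_columnN opprB.
have Fc : F @ \oo --> limn (series (paired t)).
  rewrite -[X in _ --> X]addr0; apply: cvgD; first exact: is_cvg_paired.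
  have L0 := L_gt0.
  apply: (@squeeze_cvgr _ _ _ _ (fun=> 0) (fun N => (t ^+ 2)^-1 * N.+1%:R^-1)).
  - near=> N; rewrite full_column_ge0 /=.
    have N0 : 0 <= N%:R :> R by rewrite ler0n.
    have h : t * (N%:R + 1) <= t + N%:R * L by nra.
    have h1 : 0 < t * (N%:R + 1) by nra.
    apply: le_trans (full_column_bound _) _; first by rewrite gt_eqF //; lra.
    apply: (@le_trans _ _ ((t * (N%:R + 1)) ^+ 2)^-1).
      by rewrite lef_pV2 ?posrE ?exprn_gt0 ?lerXn2r ?nnegrE //; lra.
    rewrite -natr1 exprMn invfM ler_wpM2l ?invr_ge0 ?sqr_ge0 //.
    by rewrite lef_pV2 ?posrE ?exprn_gt0 // ?expr2; nra.
  - exact: cvg_cst.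
  - rewrite -[X in _ --> X](mulr0 (t ^+ 2)^-1); apply: cvgM; first exact: cvg_cst.
    exact: cvg_harmonic.
have diff : (rectangular_partial N t - (F N - K N)) @[N --> \oo] --> 0.
  have -> : (fun N => rectangular_partial N t - (F N - K N)) = fun N =>
     (column N t - full_column t) +
     \sum_(0 <= j < N) (
      ((column N (t - j.+1%:R * L) - column N (- (j.+1%:R * L))) -
         (full_column (t - j.+1%:R * L) - full_column (- (j.+1%:R * L)))) +
      ((column N (t + j.+1%:R * L) - column N (j.+1%:R * L)) -
         (full_column (t + j.+1%:R * L) - full_column (j.+1%:R * L)))).
    apply/funext => N; rewrite FE /K /rectangular_partial sum_symE mul0r subr0 oppr0.
    rewrite (eq_bigr (fun j : nat =>
      (column N (t - j.+1%:R * L) - column N (- (j.+1%:R * L))) +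
      (column N (t + j.+1%:R * L) - column N (j.+1%:R * L)))); last first.
      by move=> j _; rewrite rmorphN /= -!pmulrn !mulNr !opprK.
    rewrite [X in _ = _ + X](_ : _ =
      \sum_(0 <= j < N) ((column N (t - j.+1%:R * L) - column N (- (j.+1%:R * L))) +
         (column N (t + j.+1%:R * L) - column N (j.+1%:R * L))) -
      \sum_(0 <= j < N) (full_column (t - j.+1%:R * L) + full_column (t + j.+1%:R * L)) +
      \sum_(0 <= j < N) (full_column (- (j.+1%:R * L)) + full_column (j.+1%:R * L))).
      by ring.
    by rewrite -sumrB -big_split /=; apply: eq_bigr => j _; ring.
  rewrite -[X in _ --> X]addr0; apply: cvgD.
    rewrite -[X in _ --> X](subrr (full_column t)); apply: cvgB; last exact: cvg_cst.
    by apply: column_cvg; rewrite gt_eqF.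
  apply: norm_cvg0.
  apply: (@squeeze_cvgr _ _ _ _ (fun=> 0) (fun N => (40 * t / tau ^+ 3) * N.+1%:R^-1)).
  - near=> N; rewrite normr_ge0 /=.
    have n0 : 0 < N.+1%:R :> R by rewrite ltr0n.
    set B := 20 * t / tau ^+ 3 / N.+1%:R ^+ 2.
    have B0 : 0 <= B.
      by rewrite /B !mulr_ge0 ?invr_ge0 ?exprn_ge0 // ltW.
    apply: le_trans (ler_norm_sum _ _ _) _.
    apply: (@le_trans _ _ (\sum_(0 <= j < N) (B *+ 2))).
      apply: ler_sum => j _; apply: le_trans (ler_normD _ _) _.
      have j0 : 0 <= j%:R :> R by rewrite ler0n.
      have jL : L <= j.+1%:R * L by rewrite -natr1; nra.
      have L0 := L_gt0.
      rewrite mulr2n; apply: lerD.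
        apply: le_trans (column_tail _ _ _) _.
        + by rewrite lt_eqF //; lra.
        + by rewrite lt_eqF //; lra.
        by rewrite opprK subrK gtr0_norm.
      apply: le_trans (column_tail _ _ _) _.
      + by rewrite gt_eqF //; lra.
      + by rewrite gt_eqF //; lra.
      by rewrite addrK gtr0_norm.
    rewrite sumr_const_nat subn0 -mulrnA.
    apply: (@le_trans _ _ (B *+ (2 * N.+1))); first by rewrite ler_wpMn2l // leq_mul2l leqW.
    rewrite -mulr_natr natrM le_eqVlt /B; apply/orP; left; apply/eqP.
    by field; rewrite (gt_eqF tau_gt0) addrC natr1 (gt_eqF n0).
  - exact: cvg_cst.
  - rewrite -[X in _ --> X](mulr0 (40 * t / tau ^+ 3)); apply: cvgM; first exact: cvg_cst.
    exact: cvg_harmonic.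
rewrite -[X in _ --> X]add0r; have -> : (fun N => rectangular_partial N t) =
    fun N => (rectangular_partial N t - (F N - K N)) + (F N - K N).
  by apply/funext => N; rewrite subrK.
by apply: cvgD => //; exact: cvgB.
Unshelve. all: by end_near. Qed.

Lemma cvg_real_complex (u : nat -> R) (l : R) :
  u @ \oo --> l -> lim ((u N)%:C @[N --> \oo] : set_system R[i]^o) = l%:C.
Proof.
move=> ul; apply: (@cvg_lim R[i]^o); first exact: norm_hausdorff.
apply/(@cvgrPdist_lt _ R[i]^o) => eps eps0.
have [e0 eR] : 0 < complex.Re eps /\ eps = (complex.Re eps)%:C.
  move: eps0; case: eps => a b; rewrite ltcE /= => /andP[/eqP b0 a0].
  by rewrite b0.
near=> N; rewrite -rmorphB /= normc_def /= expr0n addr0 sqrtr_sqr eR ltcR.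
by near: N; move/cvgrPdist_lt : ul; exact.
Unshelve. all: by end_near. Qed.

Lemma real_lattice t : (t%:C \in lattice (tau*i) L%:C) = `[< exists n : int, t = n%:~R * L >].
Proof.
apply/idP/asboolP => [/set_mem[k [l]]|[n ->]].
  by rewrite lattice_pointE; simpc => -[-> _]; exists l.
by apply/mem_set; exists 0, n; rewrite lattice_pointE mulr0z mul0r; simpc.
Qed.

Lemma half_not_multiple (n m : int) : L / 2 + n%:~R * L <> m%:~R * L.
Proof.
move=> h; have : (1 + n *+ 2 = m *+ 2)%R.
  apply: (@intr_inj R); rewrite rmorphD !rmorphMn /=.
  by apply: (mulIf (lt0r_neq0 L_gt0)); rewrite mulrDl mul1r; move: h; lra.
by lia.
Qed.

(** Over a period, the values on the real axis have their strict minimum at the half period;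
    hence the value there determines [t] modulo [L]. *)
Lemma wp_half_period t :
  wp (tau*i) L%:C t%:C = wp (tau*i) L%:C (L%:C / 2) <->
  exists n : int, t = L / 2 + n%:~R * L.
Proof.
have L0 := L_gt0.
have [kappa H] := rectangular_partial_cvg.
have hI : 0 < L / 2 < L by apply/andP; split; lra.
have value t0 n : 0 < t0 < L -> (forall m : int, t0 + n%:~R * L <> m%:~R * L) ->
    wp (tau*i) L%:C (t0 + n%:~R * L)%:C = Some (limn (series (paired t0)) - kappa)%:C.
  move=> t0I nm; rewrite /wp real_lattice; case: asboolP => [[m /nm]//|_].
  congr Some; under eq_fun do rewrite wp_partialE.
  by apply: cvg_real_complex; apply: rectangular_partial_shift_cvg; exact: H.
have -> : L%:C / 2 = (L / 2 + 0%:~R * L)%:C.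
  by rewrite mulr0z mul0r addr0 rmorphM fmorphV rmorph_nat.
rewrite (value _ 0) //; last exact: half_not_multiple.
split=> [|[n ->]]; last by rewrite value //; exact: half_not_multiple.
have [[m ->]|tm] := pselect (exists m : int, t = m%:~R * L).
  by rewrite /wp real_lattice; case: asboolP => // [[]]; exists m.
pose n := Num.floor (t / L); pose t0 := t - n%:~R * L.
have tE : t = t0 + n%:~R * L by rewrite /t0 subrK.
have t0n : t0 != 0.
  by apply/eqP => t00; apply: tm; exists n; rewrite tE t00 add0r.
have t0I : 0 < t0 < L.
  have /andP[n1 n2] := floor_itv (t / L).
  move: n1 n2; rewrite -/n ler_pdivlMr // ltr_pdivrMr // rmorphD /= => n1 n2.
  rewrite lt_neqAle eq_sym t0n /= /t0 subr_ge0 n1 /=.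
  by move: n2; rewrite mulrDl mul1r; lra.
rewrite {1}tE value //; last by move=> m; rewrite -tE => tL; apply: tm; exists m.
move=> -[] /addIr e; exists n; rewrite {1}tE; congr (_ + _).
apply/eqP/negP => /negP t0h; have := paired_min t0I t0h.
by rewrite e ltxx.
Qed.
End RectangularLattice.

(** * One-variable calculus *)

Section RealDerivatives.
Context {R : realType}.
Implicit Types (f g F : R -> R) (a b x : R).

Lemma derive_mvt f f' a b : (forall x : R, is_derive x 1 f (f' x)) -> a < b ->
  exists c, [/\ a < c, c < b & f b - f a = f' c * (b - a)].
Proof.
move=> df ab; have [|c] := MVT ab (fun x _ => df x).
  by apply: derivable_within_continuous => x _; have [] := df x.
by rewrite in_itv /= => /andP[ac cb] ->; exists c.
Qed.

Lemma derive_continuous f f' : (forall x : R, is_derive x 1 f (f' x)) -> continuous f.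
Proof.
by move=> df x; apply/differentiable_continuous/derivable1_diffP; have [] := df x.
Qed.

Lemma continuous_within f (A : set R) : continuous f -> {within A, continuous f}.
Proof. by move=> cf; apply: continuous_subspaceT => x; exact: cf. Qed.

Lemma derive_eq f g f' : (forall x : R, is_derive x 1 f (f' x)) ->
  (forall x : R, is_derive x 1 g (f' x)) -> f 0 = g 0 -> f =1 g.
Proof.
move=> df dg f0 x; apply/eqP; rewrite -subr_eq0; apply/eqP.
have -> : 0 = f 0 - g 0 by rewrite f0 subrr.
apply: (@is_derive_0_is_cst _ (fun x => f x - g x)) => y.
by rewrite -(subrr (f' y)); apply: is_deriveB.
Qed.

Lemma antiderivative f : continuous f ->
  exists F : R -> R, F 0 = 0 /\ forall x : R, is_derive x 1 F (f x).
Proof.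
move=> cf.
pose G (n : nat) (x : R) : R := (\int[lebesgue_measure]_(t in [set` `[- n%:R, x]]) (f t))%R.
have dG n x : - n%:R < x -> is_derive x 1 (G n) (f x).
  move=> nx; have [||d e] := @continuous_FTC1_closed R f (- n%:R) x (x + 1) _ _ nx (cf x).
  - by rewrite ltrDl.
  - apply: continuous_compact_integrable; first exact: segment_compact.
    exact: continuous_within.
  by apply: (DeriveDef d); rewrite -derive1E; exact: e.
pose H n x := G n x - G n 0.
have dH n x : - n%:R < x -> is_derive x 1 (H n) (f x).
  move=> nx; rewrite -[f x]subr0; apply: is_deriveB; first exact: dG.
have H0 n : H n 0 = 0 by exact: subrr.
clearbody H.
have HH n m x : (0 < n)%N -> (0 < m)%N -> - n%:R < x -> - m%:R < x -> H n x = H m x.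
  move=> n0 m0 nx mx.
  pose D y := H n y - H m y.
  suff : D x = D 0 by rewrite /D !H0 subrr => /subr0_eq.
  have dD y : Num.min x 0 <= y -> is_derive y 1 D 0.
    move=> xy; have [ny my] : - n%:R < y /\ - m%:R < y.
      by split; apply: lt_le_trans xy; rewrite lt_min ?nx ?mx /= oppr_lt0 ltr0n.
    by rewrite -(subrr (f y)); apply: is_deriveB; exact: dH.
  have cst a b : a < b -> Num.min x 0 <= a -> D a = D b.
    move=> ab xa; have [||c _] := @MVT _ D (fun=> 0) a b ab.
    - by move=> y; rewrite in_itv /= => /andP[/ltW ay _]; apply: dD; exact: le_trans ay.
    - apply: derivable_within_continuous => y; rewrite in_itv /= => /andP[ay _].
      by have [] := dD y (le_trans xa ay).
    by rewrite mul0r => /eqP; rewrite subr_eq0 => /eqP.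
  have [x0|x0|->//] := ltgtP x 0; first by apply: cst => //; rewrite ge_min lexx.
  by apply/esym/cst => //; rewrite ge_min lexx orbT.
pose N x := (Num.truncn `|x|).+1.
have Nx x : - (N x)%:R < x.
  by rewrite ltrNl; apply: le_lt_trans (truncnS_gt _); rewrite -normrN ler_norm.
exists (fun x => H (N x) x); split=> [|x]; first exact: H0.
pose M := (N x).+1.
have Mx : - M%:R < x.
  by apply: lt_trans (Nx x); rewrite ltrN2 ltr_nat.
apply: (@near_eq_is_derive _ _ _ (H M)) => //; last exact: dH.
near=> y; apply: HH => //; near: y.
by apply: lt_nbhsr.
Unshelve. all: by end_near. Qed.

Lemma derive_incr F f : (forall x : R, is_derive x 1 F (f x)) -> (forall x, 0 < f x) ->
  {mono F : x y / x < y}.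
Proof.
move=> dF f0; apply: leW_mono; apply: le_mono => x y xy.
have [c [_ _ e]] := derive_mvt dF xy.
by rewrite -subr_gt0 e mulr_gt0 // subr_gt0.
Qed.

Lemma derive_inverse F f (c : R) : (forall x : R, is_derive x 1 F (f x)) -> 0 < c ->
  (forall x, c <= f x) ->
  exists T, [/\ cancel F T, cancel T F & forall y : R, is_derive y 1 T (f (T y))^-1].
Proof.
move=> dF c0 fc; have f0 x : 0 < f x by exact: lt_le_trans c0 (fc x).
have Finc := derive_incr dF f0.
have cF := derive_continuous dF.
have Fsurj y : exists x, F x = y.
  pose M := `|y - F 0| / c + 1.
  have M0 : 0 < M by rewrite ltr_wpDl // divr_ge0 // ltW.
  have cM : `|y - F 0| <= c * M by rewrite mulrDr mulr1 mulrC divfK ?gt_eqF // lerDl ltW.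
  have FM : F 0 + c * M <= F M.
    have [x [_ _]] := derive_mvt dF M0; rewrite subr0 => e.
    have : f x * M >= c * M by rewrite ler_wpM2r // ltW.
    by lra.
  have FNM : F (- M) <= F 0 - c * M.
    have NM0 : - M < 0 by rewrite oppr_lt0.
    have [x [_ _]] := derive_mvt dF NM0; rewrite sub0r opprK => e.
    have : f x * M >= c * M by rewrite ler_wpM2r // ltW.
    by lra.
  have [|||x _ <-] := @IVT _ F (- M) M y; last by exists x.
  - by rewrite ltW // (lt_trans _ M0) // oppr_lt0.
  - exact: continuous_within.
  - have := ler_norm (y - F 0); have := lerNnormlW (lexx `|y - F 0|).
    by rewrite ge_min le_max => h1 h2; apply/andP; split; apply/orP; [left|right]; lra.
have [T TK] := choice Fsurj.
have FK : cancel F T.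
  by move=> x; case: (ltgtP (T (F x)) x) => //; rewrite -Finc TK ltxx.
exists T; split=> // y; rewrite -{1}(TK y).
apply: is_derive_inverse => //; last by rewrite gt_eqF.
- by near=> x; exact: FK.
- by near=> x; exact: cF.
Unshelve. all: by end_near. Qed.

Lemma poly_lipschitz (P : {poly R}) (K : R) : exists2 G : R, 0 <= G &
  forall a b, `|a| <= K -> `|b| <= K -> `|P.[a] - P.[b]| <= G * `|a - b|.
Proof.
have [K0|K0] := leP 0 K; last first.
  by exists 0 => // a b /le_lt_trans /(_ K0); rewrite ltNge normr_ge0.
have KK : - K <= K by lra.
have cd : {within `[- K, K], continuous (fun x => `|P^`().[x]|)}.
  apply: continuous_within => x; apply: cvg_norm; exact: continuous_horner.
have [c _ hc] := EVT_max KK cd.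
exists `|P^`().[c]| => // a b.
wlog ab : a b / a < b => [W aK bK|].
  have [/W ->//|ba|->] := ltgtP a b; last by rewrite !subrr !normr0 mulr0.
  by rewrite distrC [`|a - b|]distrC W.
move=> /[!ler_norml] /andP[a1 a2] /andP[b1 b2]; rewrite -ler_norml.
have [x [ax xb e]] := derive_mvt (fun x => is_derive_poly P x) ab.
rewrite distrC e normrM [`|a - b|]distrC ler_wpM2r // hc // in_itv /=; lra.
Qed.

Lemma derive_le0_noninc f f' : (forall x : R, is_derive x 1 f (f' x)) ->
  (forall x, f' x <= 0) -> forall a b, a <= b -> f b <= f a.
Proof.
move=> df f0 a b; rewrite le_eqVlt => /predU1P[->//|ab].
have [c [_ _ e]] := derive_mvt df ab.
by rewrite -subr_le0 e mulr_le0_ge0 // subr_ge0 ltW.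
Qed.

(** Gronwall's argument applied to the energy of the difference of two solutions. *)
Lemma ode2_unique (P : {poly R}) (Y1 Y2 Z1 Z2 : R -> R) (K : R) :
  (forall x : R, is_derive x 1 Y1 (Z1 x)) -> (forall x : R, is_derive x 1 Y2 (Z2 x)) ->
  (forall x : R, is_derive x 1 Z1 P.[Y1 x]) -> (forall x : R, is_derive x 1 Z2 P.[Y2 x]) ->
  (forall x, `|Y1 x| <= K) -> (forall x, `|Y2 x| <= K) ->
  Y1 0 = Y2 0 -> Z1 0 = Z2 0 -> Y1 =1 Y2.
Proof.
move=> dY1 dY2 dZ1 dZ2 bY1 bY2 Y0 Z0.
have [G G0 lip] := poly_lipschitz P K.
pose z x := Y1 x - Y2 x; pose z' x := Z1 x - Z2 x.
pose g x := P.[Y1 x] - P.[Y2 x].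
have dz (x : R) : is_derive x 1 z (z' x) by exact: is_deriveB.
have dz' (x : R) : is_derive x 1 z' (g x) by exact: is_deriveB.
pose w x := z x * z x + z' x * z' x.
pose w' x := 2 * (z x * z' x) + 2 * (z' x * g x).
have dw (x : R) : is_derive x 1 w (w' x).
  by apply: is_derive_eq; rewrite /w' /GRing.scale /=; ring.
have w0 x : 0 <= w x by rewrite addr_ge0 // -expr2 sqr_ge0.
have w'le x : `|w' x| <= (1 + G) * w x.
  have gz : `|g x| <= G * `|z x| by exact: lip.
  apply: le_trans (ler_normD _ _) _; rewrite !normrM normr_nat.
  have -> : w x = `|z x| * `|z x| + `|z' x| * `|z' x|.
    by rewrite -!expr2 !real_normK ?num_real.
  have := normr_ge0 (z x); have := normr_ge0 (z' x).
  move: `|z x| `|z' x| `|g x| gz => a b c gz b0 a0.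
  have := sqr_ge0 (a - b); have h : b * c <= b * (G * a) by rewrite ler_wpM2l.
  have : 0 <= G * (a - b) ^+ 2 by rewrite mulr_ge0 ?sqr_ge0.
  by nra.
pose L := 1 + G.
suff w00 x : w x = 0.
  move=> x; apply/eqP; rewrite -subr_eq0 -/(z x) -sqrf_eq0 expr2.
  have := w00 x; rewrite /w; have := sqr_ge0 (z x); have := sqr_ge0 (z' x).
  rewrite !expr2 => h1 h2 h3; rewrite eq_le h2 andbT; lra.
have w_0 : w 0 = 0 by rewrite /w /z /z' Y0 Z0 !subrr !mul0r addr0.
apply/eqP; rewrite eq_le w0 andbT.
have bnd (e : R) : e = 1 \/ e = -1 -> forall a b, a <= b ->
    e * (expR (- (e * L) * b) * w b) <= e * (expR (- (e * L) * a) * w a).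
  move=> ee a b ab.
  apply: (@derive_le0_noninc (fun x => e * (expR (- (e * L) * x) * w x))
     (fun x => e * (expR (- (e * L) * x) * (w' x - e * L * w x)))) => //.
    move=> y; apply: is_derive_eq; rewrite /GRing.scale /=; ring.
  move=> y; have E0 := expR_gt0 (- (e * L) * y); move: (expR _) E0 => E E0.
  have := w'le y; rewrite ler_norml -/L => /andP[h1 h2].
  rewrite mulrCA pmulr_rle0 //.
  by case: ee => ->; lra.
have [x0|/ltW x0] := leP 0 x.
  have := bnd 1 (or_introl erefl) 0 x x0; rewrite !mul1r w_0 mulr0.
  by rewrite pmulr_rle0 ?expR_gt0.
have := bnd (-1) (or_intror erefl) x 0 x0; rewrite w_0 mulr0 mulr0.
by rewrite mulN1r oppr_ge0 pmulr_rle0 ?expR_gt0.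
Qed.

(** Improper integrals: the fundamental theorem of calculus on each compact interval, then
    monotone convergence. *)
Lemma Rintegral_exhaustion (a_ b_ : nat -> R) (S : set R) F f (la lb : R) :
  (forall n, a_ n < b_ n) -> nonincreasing_seq a_ -> nondecreasing_seq b_ ->
  S = \bigcup_n `[a_ n, b_ n]%classic ->
  (forall x : R, S x -> is_derive x 1 F (f x)) ->
  (forall x : R, S x -> {for x, continuous f}) ->
  (forall x, S x -> 0 <= f x) ->
  F (a_ n) @[n --> \oo] --> la -> F (b_ n) @[n --> \oo] --> lb ->
  lebesgue_measure.-integrable S (EFin \o f) /\
  (\int[lebesgue_measure]_(x in S) f x)%R = lb - la.
Proof.
move=> ab an bn SE dF cf f0 Fa Fb.
have IS n : `[a_ n, b_ n]%classic `<=` S by rewrite SE => x xI; exists n.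
have cw n : {within `[a_ n, b_ n], continuous f}.
  apply: continuous_in_subspaceT => x; rewrite inE => xI; apply: cf; exact: (IS n).
have mS : measurable S by rewrite SE; apply: bigcup_measurable.
have mf n : measurable_fun `[a_ n, b_ n]%classic f.
  by apply: subspace_continuous_measurable_fun.
have FTC n : (\int[lebesgue_measure]_(x in `[a_ n, b_ n]) (f x)%:E)%E =
    (F (b_ n) - F (a_ n))%:E.
  rewrite (@continuous_FTC2 _ f F) ?EFinB //.
  - have dI (x : R) : x \in `[a_ n, b_ n] -> derivable F x 1.
      by move=> xI; have [] := dF x (IS n x xI).
    split.
    + by move=> x xI; apply: dI; exact: subset_itv_oo_cc.
    + apply: cvg_at_right_filter; apply/differentiable_continuous/derivable1_diffP.
      by apply: dI; rewrite in_itv /= lexx ltW.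
    + apply: cvg_at_left_filter; apply/differentiable_continuous/derivable1_diffP.
      by apply: dI; rewrite in_itv /= lexx ltW.
  - move=> x xI; rewrite derive1E; have [] // := dF x _.
    by apply: (IS n); exact: subset_itv_oo_cc.
have lim : (\int[lebesgue_measure]_(x in S) (f x)%:E)%E = (lb - la)%:E.
  have : (\int[lebesgue_measure]_(x in `[a_ n, b_ n]) (f x)%:E)%E @[n --> \oo] -->
      (\int[lebesgue_measure]_(x in S) (f x)%:E)%E.
    rewrite SE; apply: ge0_nondecreasing_set_cvg_integral => //; last 2 first.
    - by move=> n; apply/measurable_EFinP; exact: mf.
    - by move=> n x xI; rewrite lee_fin f0 //; exact: (IS n).
    - move=> n m nm; apply/subsetPset => x /=; rewrite !in_itv /= => /andP[ax xb].
      by rewrite (le_trans (an _ _ nm)) //= (le_trans xb) // bn.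
  under eq_cvg do rewrite FTC.
  move=> h; have h2 : (F (b_ n) - F (a_ n))%:E @[n --> \oo] --> (lb - la)%:E.
    by apply: cvg_EFin; [exact: nearW|exact: cvgB].
  exact: (cvg_unique _ h h2).
split; last by rewrite /Rintegral lim.
apply/integrableP; split.
  by rewrite SE; apply/measurable_fun_bigcup => // n; apply/measurable_EFinP; exact: mf.
have -> : (\int[lebesgue_measure]_(x in S) `|(EFin \o f) x| =
    \int[lebesgue_measure]_(x in S) (f x)%:E)%E.
  by apply: eq_integral => x /set_mem xS; rewrite /= ger0_norm // f0.
by rewrite lim ltry.
Qed.

Let small (n : nat) : R := n.+2%:R^-1.

Let small_itv n : 0 < small n < 1.
Proof. by rewrite /small invr_gt0 ltr0n /= invf_lt1 ?ltr0n // ltr1n. Qed.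

Let small_cvg : small @ \oo --> 0.
Proof.
have -> : small = fun n => harmonic n.+1 by [].
by rewrite cvg_shiftS; exact: cvg_harmonic.
Qed.

Let small_mono n m : (n <= m)%N -> small m <= small n.
Proof. by move=> nm; rewrite /small lef_pV2 ?posrE ?ltr0n // ler_nat. Qed.

Let small_ex (e : R) : 0 < e -> exists n, small n < e.
Proof.
move=> e0; move/cvgrPdist_lt : small_cvg => /(_ _ e0)[n _ /(_ n (leqnn n))].
rewrite /= sub0r normrN gtr0_norm; first by exists n.
by have /andP[] := small_itv n.
Qed.

Lemma Rintegral_oo (a b : R) F f (la lb : R) : a < b ->
  (forall x : R, a < x < b -> is_derive x 1 F (f x)) ->
  (forall x : R, a < x < b -> {for x, continuous f}) ->
  (forall x, a < x < b -> 0 <= f x) ->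
  F x @[x --> a^'+] --> la -> F x @[x --> b^'-] --> lb ->
  (\int[lebesgue_measure]_(x in `[a, b]) f x)%R = lb - la.
Proof.
move=> ab dF cf f0 Fa Fb.
pose h : R := (b - a) / 2; have h0 : 0 < h by rewrite /h; lra.
have hs n : 0 < h * small n < h.
  by have /andP[s0 s1] := small_itv n; rewrite mulr_gt0 //= gtr_pMr.
have SE : `]a, b[%classic = \bigcup_n `[a + h * small n, b - h * small n]%classic.
  apply/seteqP; split=> [x|x [n _]] /=; rewrite !in_itv /= => /andP[ax xb].
    have [n sn] : exists n, small n < Num.min (x - a) (b - x) / h.
      by apply: small_ex; rewrite divr_gt0 // lt_min !subr_gt0 ax xb.
    exists n => //=; rewrite in_itv /=; move: sn.
    by rewrite ltr_pdivlMr // lt_min mulrC => /andP[s1 s2]; apply/andP; split; lra.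
  by have /andP[s0 s1] := hs n; apply/andP; split; lra.
suff [int <-] : lebesgue_measure.-integrable `]a, b[%classic (EFin \o f) /\
    (\int[lebesgue_measure]_(x in `]a, b[) f x)%R = lb - la.
  rewrite /Rintegral; congr fine; apply: integral_itv_bndoo.
  exact: measurable_int int.
apply: (@Rintegral_exhaustion _ _ _ F f la lb _ _ _ SE).
- by move=> n; have := hs n; rewrite /h => /andP[]; lra.
- by move=> n m nm; rewrite lerD2l ler_pM2l // small_mono.
- by move=> n m nm; rewrite lerD2l lerN2 ler_pM2l // small_mono.
- by move=> x; rewrite /= in_itv /=; exact: cf.
- by move=> x; rewrite /= in_itv /=; exact: f0.
- move/cvg_at_rightP : Fa; apply; split=> [n|].
    by rewrite ltrDl; have /andP[] := hs n.
  rewrite -[X in _ --> X]addr0 -[X in _ --> _ + X](mulr0 h).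
  by apply: cvgD; [exact: cvg_cst|apply: cvgM => //; exact: cvg_cst].
- move/cvg_at_leftP : Fb; apply; split=> [n|].
    by rewrite ltrBlDr ltrDl; have /andP[] := hs n.
  rewrite -[X in _ --> X]subr0 -[X in _ --> _ - X](mulr0 h).
  by apply: cvgB; [exact: cvg_cst|apply: cvgM => //; exact: cvg_cst].
Qed.

Lemma Rintegral_oy (a : R) F f (la lb : R) :
  (forall x : R, a < x -> is_derive x 1 F (f x)) ->
  (forall x : R, a < x -> {for x, continuous f}) ->
  (forall x, a < x -> 0 <= f x) ->
  F x @[x --> a^'+] --> la -> F x @[x --> +oo] --> lb ->
  lebesgue_measure.-integrable `]a, +oo[%classic (EFin \o f) /\
  (\int[lebesgue_measure]_(x in `[a, +oo[) f x)%R = lb - la.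
Proof.
move=> dF cf f0 Fa Fb.
have hs n : 0 < small n by have /andP[] := small_itv n.
have SE : `]a, +oo[%classic = \bigcup_n `[a + small n, a + 1 + n%:R]%classic.
  apply/seteqP; split=> [x|x [n _]] /=; rewrite !in_itv /= ?andbT.
    move=> ax; have [n sn] : exists n, small n < x - a by apply: small_ex; rewrite subr_gt0.
    pose M := Num.truncn `|x - a|.
    exists (maxn n M.+1) => //=; rewrite in_itv /=; apply/andP; split.
      by have := small_mono (leq_maxl n M.+1); lra.
    have : M.+1%:R <= (maxn n M.+1)%:R :> R by rewrite ler_nat leq_maxr.
    have := truncnS_gt `|x - a|; rewrite -/M => h1 h2.
    by have := ler_norm (x - a); lra.
  by move=> /andP[h _]; have := hs n; lra.
suff [int <-] : lebesgue_measure.-integrable `]a, +oo[%classic (EFin \o f) /\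
    (\int[lebesgue_measure]_(x in `]a, +oo[) f x)%R = lb - la.
  split=> //; rewrite /Rintegral; congr fine; apply/esym/integral_itv_obnd_cbnd.
  exact: measurable_int int.
apply: (@Rintegral_exhaustion _ _ _ F f la lb _ _ _ SE).
- by move=> n; have /andP[s0 s1] := small_itv n; have := ler0n R n; lra.
- by move=> n m nm; rewrite lerD2l small_mono.
- by move=> n m nm; rewrite lerD2l ler_nat.
- by move=> x; rewrite /= in_itv /= andbT; exact: dF.
- by move=> x; rewrite /= in_itv /= andbT; exact: cf.
- by move=> x; rewrite /= in_itv /= andbT; exact: f0.
- move/cvg_at_rightP : Fa; apply; split=> [n|]; first by rewrite ltrDl hs.
  by rewrite -[X in _ --> X]addr0; apply: cvgD => //; exact: cvg_cst.
- move/cvg_pinftyP : Fb; apply.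
  apply/cvgryPge => A; near=> n.
  rewrite addrC -lerBlDr; near: n; exact: nbhs_infty_ger.
Unshelve. all: by end_near. Qed.

Lemma Rintegral_Nyo (b : R) F f (la lb : R) :
  (forall x : R, x < b -> is_derive x 1 F (f x)) ->
  (forall x : R, x < b -> {for x, continuous f}) ->
  (forall x, x < b -> 0 <= f x) ->
  F x @[x --> -oo] --> la -> F x @[x --> b^'-] --> lb ->
  lebesgue_measure.-integrable `]-oo, b[%classic (EFin \o f) /\
  (\int[lebesgue_measure]_(x in `]-oo, b]) f x)%R = lb - la.
Proof.
move=> dF cf f0 Fa Fb.
have hs n : 0 < small n by have /andP[] := small_itv n.
have SE : `]-oo, b[%classic = \bigcup_n `[b - 1 - n%:R, b - small n]%classic.
  apply/seteqP; split=> [x|x [n _]] /=; rewrite !in_itv /=.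
    move=> ax; have [n sn] : exists n, small n < b - x by apply: small_ex; rewrite subr_gt0.
    pose M := Num.truncn `|b - x|.
    exists (maxn n M.+1) => //=; rewrite in_itv /=; apply/andP; split; last first.
      by have := small_mono (leq_maxl n M.+1); lra.
    have : M.+1%:R <= (maxn n M.+1)%:R :> R by rewrite ler_nat leq_maxr.
    have := truncnS_gt `|b - x|; rewrite -/M => h1 h2.
    by have := ler_norm (b - x); lra.
  by move=> /andP[_ h]; have := hs n; lra.
suff [int <-] : lebesgue_measure.-integrable `]-oo, b[%classic (EFin \o f) /\
    (\int[lebesgue_measure]_(x in `]-oo, b[) f x)%R = lb - la.
  split=> //; rewrite /Rintegral; congr fine; apply/esym/integral_itv_bndo_bndc.
  exact: measurable_int int.
apply: (@Rintegral_exhaustion _ _ _ F f la lb _ _ _ SE).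
- by move=> n; have /andP[s0 s1] := small_itv n; have := ler0n R n; lra.
- by move=> n m nm; rewrite lerD2l lerN2 ler_nat.
- by move=> n m nm; rewrite lerD2l lerN2 small_mono.
- by move=> x; rewrite /= in_itv /=; exact: cf.
- by move=> x; rewrite /= in_itv /=; exact: f0.
- move/cvg_ninftyP : Fa; apply.
  apply/cvgrNyPle => A; near=> n.
  rewrite lerBlDr -lerBlDl; near: n; exact: nbhs_infty_ger.
- move/cvg_at_leftP : Fb; apply; split=> [n|]; first by rewrite ltrBlDr ltrDl hs.
  by rewrite -[X in _ --> X]subr0; apply: cvgB => //; exact: cvg_cst.
Unshelve. all: by end_near. Qed.
End RealDerivatives.

(** * The time on an elliptic oval *)

Section Clock.
Context {R : realType}.
Variables (m r : R) (E : {poly R}).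
Hypothesis r_gt0 : 0 < r.
Hypothesis E_gt0 : forall u, m - r <= u <= m + r -> 0 < E.[u].

Let speed (tau : R) := Num.sqrt E.[m - r * cos tau].

Lemma phase_bounds (tau : R) : m - r <= m - r * cos tau <= m + r.
Proof.
have := cos_le1 tau; have := cos_geN1 tau; have := r_gt0.
by move: (cos tau) => c r0 c1 c2; apply/andP; split; nra.
Qed.

Let rad_gt0 tau : 0 < E.[m - r * cos tau].
Proof. exact/E_gt0/phase_bounds. Qed.

Let speed_gt0 tau : 0 < speed tau.
Proof. by rewrite sqrtr_gt0. Qed.

Let speed_derive (tau : R) :
  is_derive tau 1 speed (E^`().[m - r * cos tau] * (r * sin tau) / (2 * speed tau)).
Proof.
have d1 : is_derive tau 1 (fun t : R => m - r * cos t) (r * sin tau).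
  by apply: is_derive_eq; rewrite /GRing.scale /=; ring.
have d2 : is_derive tau 1 (horner E \o (fun t : R => m - r * cos t))
    (E^`().[m - r * cos tau] * (r * sin tau)).
  exact: is_derive1_comp.
have d3 := @is_derive1_comp R (@Num.sqrt R) (horner E \o (fun t : R => m - r * cos t))
  tau _ _ (is_derive1_sqrt (rad_gt0 tau)) d2.
apply: is_derive_eq d3 _; rewrite /speed mulrC; congr (_ * _).
Qed.

(** The angle [tau], with [u = m - r cos tau], removes the singularities at both ends of the
    segment from the differential [du / sqrt ((u - m + r) (m + r - u) E(u))], which becomes
    [d tau / sqrt E]. So the time [Th] is a diffeomorphism of the line. *)
Lemma clock_exists : exists Th T : R -> R, [/\ Th 0 = 0, cancel Th T, cancel T Th,
  forall tau : R, is_derive tau 1 Th (speed tau)^-1 &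
  forall t : R, is_derive t 1 T (speed (T t))].
Proof.
have cs : continuous (fun tau => (speed tau)^-1).
  move=> tau; apply: cvgV; first by rewrite gt_eqF.
  exact: (derive_continuous speed_derive).
have [Th [Th0 dTh]] := antiderivative cs.
have le : m - r <= m + r by have := r_gt0; lra.
have cE : {within `[m - r, m + r], continuous (horner E)}.
  by apply: continuous_within => x; exact: continuous_horner.
have [c cI hc] := EVT_max le cE.
have c0 : 0 < E.[c] by apply: E_gt0; move: cI; rewrite in_itv.
have [||T [ThK TK dT]] := @derive_inverse R Th _ (Num.sqrt E.[c])^-1 dTh.
- by rewrite invr_gt0 sqrtr_gt0.
- move=> x; rewrite lef_pV2 ?posrE ?sqrtr_gt0 // ler_sqrt ?(ltW c0) //.
  by apply: hc; rewrite in_itv /= phase_bounds.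
exists Th, T; split=> // t; rewrite -[speed _]invrK; exact: dT.
Qed.

Variables (Th T : R -> R).
Hypotheses (Th0 : Th 0 = 0) (ThK : cancel Th T) (TK : cancel T Th).
Hypothesis dTh : forall tau : R, is_derive tau 1 Th (speed tau)^-1.
Hypothesis dT : forall t : R, is_derive t 1 T (speed (T t)).

Lemma clockN tau : Th (- tau) = - Th tau.
Proof.
have d (x : R) : is_derive x 1 (fun x : R => - Th (- x)) (speed x)^-1.
  have d := @is_derive1_comp R Th (fun x => - x) x _ _ (dTh (- x)) (is_deriveNid x 1).
  have dN := @is_deriveN _ _ _ _ _ _ _ d.
  by apply: is_derive_eq dN _; rewrite /speed cosN mulrN1 opprK.
have h := derive_eq d dTh; rewrite -h ?opprK //.
by rewrite oppr0 Th0 oppr0.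
Qed.

Definition clock_period : R := Th pi *+ 2.

Lemma clockDperiod tau : Th (tau + pi *+ 2) = Th tau + clock_period.
Proof.
pose f x := Th (x + pi *+ 2) - Th x.
have df (x : R) : is_derive x 1 f 0.
  have d1 : is_derive x 1 (fun x : R => x + pi *+ 2) 1.
    by apply: is_derive_eq; rewrite addr0.
  have d2 := @is_derive1_comp R Th _ x _ _ (dTh (x + pi *+ 2)) d1.
  rewrite -(subrr (speed x)^-1); apply: is_deriveB.
  by apply: is_derive_eq d2 _; rewrite mulr1 /speed cosD2pi.
have := is_derive_0_is_cst tau (- pi) df; rewrite /f.
have -> : - pi + pi *+ 2 = pi :> R by rewrite mulr2n addKr.
by rewrite clockN opprK -mulr2n => /eqP; rewrite subr_eq => /eqP ->; rewrite [RHS]addrC.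
Qed.

Lemma clock_incr : {mono Th : x y / x < y}.
Proof. by apply: (derive_incr dTh) => x; rewrite invr_gt0. Qed.

Lemma clock_period_gt0 : 0 < clock_period.
Proof. by rewrite pmulrn_lgt0 // -Th0 clock_incr pi_gt0. Qed.

Lemma clock_invN t : T (- t) = - T t.
Proof. by rewrite -{1}(TK t) -clockN ThK. Qed.

Lemma clock_invDperiod t : T (t + clock_period) = T t + pi *+ 2.
Proof. by rewrite -{1}(TK t) -clockDperiod ThK. Qed.

Lemma clock_invDperiodn t (k : int) : T (t + k%:~R * clock_period) = T t + k%:~R * (pi *+ 2).
Proof.
have DP := clock_invDperiod; move: (pi *+ 2) clock_period DP => P Q DP.
have nat_case u (n : nat) : T (u + n%:R * Q) = T u + n%:R * P.
  elim: n => [|n IHn]; first by rewrite !mul0r !addr0.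
  by rewrite -[n.+1%:R]natr1 !mulrDl !mul1r addrA DP IHn addrA.
case: k => n; first by rewrite -!pmulrn nat_case.
rewrite NegzE !rmorphN /= -!pmulrn !mulNr.
by rewrite -[in RHS](subrK (n.+1%:R * Q) t) nat_case addrK.
Qed.

(** The antiderivative of [1 / sqrt ((u - m + r) (m + r - u) E(u))] on the segment. *)
Definition clock_integral u := Th (acos ((m - u) / r)).

Let ratio_itv u : m - r <= u <= m + r -> -1 <= (m - u) / r <= 1.
Proof.
move=> /andP[u1 u2]; rewrite ler_pdivlMr // ler_pdivrMr //.
by move: r_gt0 => r0; apply/andP; split; lra.
Qed.

Lemma clock_integral_cos tau : 0 <= tau <= pi -> clock_integral (m - r * cos tau) = Th tau.
Proof.
move=> tI; rewrite /clock_integral subKr mulrAC divff ?gt_eqF // mul1r cosK //.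
Qed.

Lemma clock_integral_left : clock_integral (m - r) = 0.
Proof.
by rewrite -[X in m - X]mulr1 -cos0 clock_integral_cos ?Th0 // lexx pi_ge0.
Qed.

Lemma clock_integral_right : clock_integral (m + r) = Th pi.
Proof.
rewrite -[X in m + X]mulr1 -{1}[1]opprK mulrN -cospi clock_integral_cos //.
by rewrite pi_ge0 lexx.
Qed.

Lemma clock_integral_derive (u : R) : m - r < u < m + r ->
  is_derive u 1 clock_integral (Num.sqrt ((u - (m - r)) * (m + r - u) * E.[u]))^-1.
Proof.
move=> /andP[u1 u2].
have r0 := r_gt0; have rn : r != 0 by rewrite gt_eqF.
pose c := (m - u) / r.
have cI : -1 < c < 1 by rewrite /c ltr_pdivlMr // ltr_pdivrMr //; apply/andP; split; lra.
have dc : is_derive u 1 (fun u => (m - u) / r) (- r^-1).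
  by apply: is_derive_eq; rewrite /GRing.scale /=; ring.
have da := @is_derive1_comp R acos (fun u => (m - u) / r) u _ _ (is_derive1_acos cI) dc.
have dd := @is_derive1_comp R Th _ u _ _ (dTh _) da.
apply: is_derive_eq dd _; rewrite /speed /= acosK; last first.
  by case/andP: cI => c1 c2; rewrite in_itv /= !ltW.
have -> : m - r * ((m - u) / r) = u by field.
have uI : m - r <= u <= m + r by apply/andP; split; lra.
have E0 := E_gt0 uI; rewrite -/c.
have c2 : 0 < 1 - c ^+ 2 by case/andP: cI => c1 c2; nra.
have -> : (u - (m - r)) * (m + r - u) * E.[u] = r ^+ 2 * (E.[u] * (1 - c ^+ 2)).
  by rewrite /c; field.
rewrite mulrNN -!invfM; congr (_^-1).
rewrite sqrtrM ?sqr_ge0 // sqrtr_sqr gtr0_norm // sqrtrM ?(ltW E0) //; ring.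
Qed.

Lemma clock_integral_continuous : {within `[m - r, m + r], continuous clock_integral}.
Proof.
have p0 : 0 <= Th pi by rewrite -Th0 leNgt clock_incr -leNgt pi_ge0.
have := @segment_can_le_continuous R 0 (Th pi) (fun t => m - r * cos (T t)) clock_integral p0.
rewrite ThK -Th0 ThK cos0 cospi mulr1 mulrN1 opprK; apply.
  apply: continuous_within => t.
  apply: cvgB; first exact: cvg_cst.
  apply: cvgM; first exact: cvg_cst.
  apply: (@continuous_comp _ _ _ T cos); first exact: (derive_continuous dT).
  exact: continuous_cos.
move=> t; rewrite in_itv /= => /andP[t0 tp]; rewrite clock_integral_cos ?TK //.
by apply/andP; split; rewrite leNgt -clock_incr TK -leNgt.
Qed.

(** Clamping the argument makes the antiderivative continuous on the whole line. *)
Definition clamped_integral u := clock_integral (Num.max (m - r) (Num.min (m + r) u)).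

Lemma clamped_integral_continuous : continuous clamped_integral.
Proof.
move=> u; pose c (u : R) := Num.max (m - r) (Num.min (m + r) u).
have le : m - r <= m + r by have := r_gt0; lra.
have cI v : `[m - r, m + r]%classic (c v).
  by rewrite /= in_itv /= /c le_max lexx /= ge_max le ge_min lexx.
have cc : {for u, continuous c}.
  apply: continuous_max; first exact: cvg_cst.
  by apply: continuous_min; [exact: cvg_cst|exact: cvg_id].
have h := (subspace_continuousP _ _).1 clock_integral_continuous (c u) (cI u).
move=> P /h hP; have cP := cc _ hP.
by apply: (@filterS _ (nbhs u) _ _ _ _ cP) => v /=; apply; exact: cI.
Qed.

Lemma clamped_integralE u : m - r <= u <= m + r -> clamped_integral u = clock_integral u.
Proof. by move=> /andP[u1 u2]; rewrite /clamped_integral min_r // max_r. Qed.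

Lemma clamped_integral_derive (u : R) : m - r < u < m + r ->
  is_derive u 1 clamped_integral (Num.sqrt ((u - (m - r)) * (m + r - u) * E.[u]))^-1.
Proof.
move=> uI; have d := clock_integral_derive uI; case/andP: uI => u1 u2.
apply: (@near_eq_is_derive _ _ _ clock_integral) => //.
near=> v; rewrite clamped_integralE //; apply/andP; split; apply/ltW; near: v.
  exact: lt_nbhsr.
exact: lt_nbhsl.
Unshelve. all: by end_near. Qed.
End Clock.

(** * Ovals of biquadratic curves *)

Section TrigCoincidence.
Context {R : realType}.

Lemma cos_eq1 (x : R) : cos x = 1 -> exists k : int, x = k%:~R * (pi *+ 2).
Proof.
move=> cx; have p0 := @pi_gt0 R.
pose P : R := pi *+ 2; have P0 : 0 < P by rewrite /P pmulrn_lgt0.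
have cosP (y : R) (n : nat) : cos (y + n%:R * P) = cos y.
  by rewrite mulr_natl; exact: (periodicn (@cosD2pi R)).
pose k := Num.floor (x / P); pose y := x - k%:~R * P.
have cosPz (n : int) : cos (x - n%:~R * P) = cos x.
  case: n => n; first by rewrite -pmulrn -(cosP (x - n%:R * P) n) subrK.
  by rewrite NegzE rmorphN /= -pmulrn mulNr opprK cosP.
have yE : cos y = cos x by exact: cosPz.
have /andP[k1 k2] := floor_itv (x / P).
have y0 : 0 <= y by rewrite subr_ge0 -ler_pdivlMr.
have yP : y < P.
  by move: k2; rewrite ltr_pdivrMr // rmorphD mulrDl mul1r /y -/k; lra.
exists k; apply/eqP; rewrite -subr_eq0 -/y.
have PE : P = pi + pi by rewrite /P mulr2n.
apply/negP => /negP yn; have y_gt0 : 0 < y by rewrite lt_neqAle eq_sym yn.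
have [yp|yp] := leP y pi.
  have := @ltr_cos R 0 y; rewrite !in_itv /= lexx ltW // ltW // yp => /(_ isT isT).
  by rewrite y_gt0 cos0 yE cx ltxx.
have := @ltr_cos R 0 (P - y); rewrite !in_itv /= lexx ltW //.
have -> : cos (P - y) = cos y by rewrite -cosN opprB -(cosP (y - P) 1%N) mul1r subrK.
rewrite yE cx cos0 ltxx => /(_ isT).
by rewrite !subr_ge0 !subr_gt0 ltW // yP PE lerBlDr lerD2l ltW // => /(_ isT).
Qed.

Lemma cos_sin_eq (x y : R) : cos x = cos y -> sin x = sin y ->
  exists k : int, x = y + k%:~R * (pi *+ 2).
Proof.
move=> c s; have [|k e] := @cos_eq1 (x - y).
  by rewrite cosB c s -!expr2 cos2Dsin2.
by exists k; rewrite -e addrC subrK.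
Qed.

Lemma cos_eq (x y : R) : cos x = cos y ->
  exists k : int, x = y + k%:~R * (pi *+ 2) \/ x = - y + k%:~R * (pi *+ 2).
Proof.
move=> c; have : (sin x - sin y) * (sin x + sin y) = 0.
  by have := cos2Dsin2 x; have := cos2Dsin2 y; rewrite c; lra.
move/eqP; rewrite mulf_eq0 => /orP[/eqP/subr0_eq s|].
  by have [k e] := cos_sin_eq c s; exists k; left.
rewrite addr_eq0 -sinN => /eqP s.
have [k e] : exists k : int, x = - y + k%:~R * (pi *+ 2).
  by apply: cos_sin_eq; rewrite // c cosN.
by exists k; right.
Qed.
End TrigCoincidence.

Section Flow.
Context {R : realType}.
Variables (a0 a1 a2 b0 b1 b2 c0 c1 c2 e1 e4 : R) (E : {poly R}).
Let A u := a2 * (u * u) + a1 * u + a0.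
Let B u := b2 * (u * u) + b1 * u + b0.
Let C u := c2 * (u * u) + c1 * u + c0.
Let At v := a2 * (v * v) + b2 * v + c2.
Let Bt v := a1 * (v * v) + b1 * v + c1.
Let Ct v := a0 * (v * v) + b0 * v + c0.
Hypothesis e14 : e1 < e4.
Hypothesis E_gt0 : forall u, e1 <= u <= e4 -> 0 < E.[u].
Hypothesis A_neq0 : forall u, e1 <= u <= e4 -> A u != 0.
Hypothesis discE : forall u, B u * B u - 4 * A u * C u = (u - e1) * (e4 - u) * E.[u].

Let m := (e1 + e4) / 2.
Let r := (e4 - e1) / 2.
Let r_gt0 : 0 < r. Proof. by rewrite /r; move: e14; lra. Qed.
Let mr : m - r = e1. Proof. by rewrite /m /r; lra. Qed.
Let mDr : m + r = e4. Proof. by rewrite /m /r; lra. Qed.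
Let E_gt0' u : m - r <= u <= m + r -> 0 < E.[u].
Proof. by rewrite mr mDr; exact: E_gt0. Qed.

Let A' u := 2 * a2 * u + a1.
Let B' u := 2 * b2 * u + b1.
Let C' u := 2 * c2 * u + c1.

Let dquad (x2 x1 x0 u : R) :
  is_derive u 1 (fun u => x2 * (u * u) + x1 * u + x0) (2 * x2 * u + x1).
Proof. by apply: is_derive_eq; rewrite /GRing.scale /=; ring. Qed.

Let discE' u : 2 * B u * B' u - 4 * A' u * C u - 4 * A u * C' u =
  (e1 + e4 - 2 * u) * E.[u] + (u - e1) * (e4 - u) * E^`().[u].
Proof.
have dA := dquad a2 a1 a0 u; have dB := dquad b2 b1 b0 u; have dC := dquad c2 c1 c0 u.
have d1 : is_derive u 1 (fun u => B u * B u - 4 * A u * C u)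
   (2 * B u * B' u - 4 * A' u * C u - 4 * A u * C' u).
  rewrite /A /B /C /A' /B' /C'.
  by apply: is_derive_eq; rewrite /GRing.scale /=; ring.
have dE := is_derive_poly E u.
have d2 : is_derive u 1 (fun u => (u - e1) * (e4 - u) * E.[u])
   ((e1 + e4 - 2 * u) * E.[u] + (u - e1) * (e4 - u) * E^`().[u]).
  by apply: is_derive_eq; rewrite /GRing.scale /=; ring.
have f : (fun u => B u * B u - 4 * A u * C u) = (fun u => (u - e1) * (e4 - u) * E.[u]).
  exact/funext.
by rewrite f in d1; rewrite -(@derive_val _ _ _ _ _ _ _ d1) -(@derive_val _ _ _ _ _ _ _ d2).
Qed.

Variables (Th T : R -> R).
Hypotheses (Th0 : Th 0 = 0) (ThK : cancel Th T) (TK : cancel T Th).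
Hypothesis dTh : forall tau : R, is_derive tau 1 Th (Num.sqrt E.[m - r * cos tau])^-1.
Hypothesis dT : forall t : R, is_derive t 1 T (Num.sqrt E.[m - r * cos (T t)]).

(** The point of the oval at time [t]. The square root [W] of the discriminant takes the sign
    of the sine of the angle, so that the two ordinates over [u] are visited in turn. *)
Definition flow_u t := m - r * cos (T t).
Definition flow_w t := r * sin (T t) * Num.sqrt E.[flow_u t].
Definition flow_v t := (flow_w t - B (flow_u t)) / (2 * A (flow_u t)).
Local Notation U := flow_u.
Local Notation W := flow_w.
Local Notation V := flow_v.

Lemma flow_uI t : e1 <= U t <= e4.
Proof. by have := phase_bounds m r_gt0 (T t); rewrite mr mDr. Qed.

Let EU t : 0 < E.[U t]. Proof. exact/E_gt0/flow_uI. Qed.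
Let AU t : A (U t) != 0. Proof. exact/A_neq0/flow_uI. Qed.

Lemma flow_wE t : 2 * A (U t) * V t + B (U t) = W t.
Proof. by rewrite /V; field; exact: AU. Qed.

Let trigU t : (U t - e1) * (e4 - U t) = (r * sin (T t)) * (r * sin (T t)).
Proof.
have := cos2Dsin2 (T t); rewrite /U -mr -mDr; move: (cos _) (sin _) => c s cs.
have -> : (m - r * c - (m - r)) * (m + r - (m - r * c)) = r * r * (1 - c ^+ 2) by ring.
by rewrite -cs; ring.
Qed.

Lemma flow_w2 t : W t * W t = B (U t) * B (U t) - 4 * A (U t) * C (U t).
Proof.
rewrite discE trigU /W.
have := sqr_sqrtr (ltW (EU t)); rewrite expr2; move: (Num.sqrt _) => s <-; ring.
Qed.

Lemma flow_curve t : A (U t) * (V t * V t) + B (U t) * V t + C (U t) = 0.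
Proof.
have := flow_w2 t; rewrite -flow_wE; have := AU t.
move: (A _) (B _) (C _) (V t) => a b c v an h.
apply: (mulfI (_ : 4 * a != 0)); first by rewrite mulf_neq0.
rewrite mulr0; move: h; lra.
Qed.

Lemma flow_du (t : R) : is_derive t 1 U (W t).
Proof.
have d := @is_derive1_comp R cos T t _ _ (is_derive_cos _) (dT t).
have d' : is_derive t 1 (fun t => cos (T t)) (- sin (T t) * Num.sqrt E.[U t]) := d.
by rewrite /U; apply: is_derive_eq; rewrite /W /U /GRing.scale /=; ring.
Qed.

Lemma flow_dw (t : R) : is_derive t 1 W
  (B (U t) * B' (U t) - 2 * A' (U t) * C (U t) - 2 * A (U t) * C' (U t)).
Proof.
have d1 : is_derive t 1 (fun t => sin (T t)) (cos (T t) * Num.sqrt E.[U t]).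
  exact: (@is_derive1_comp R sin T t _ _ (is_derive_sin _) (dT t)).
have d2 : is_derive t 1 (fun t => E.[U t]) (E^`().[U t] * W t).
  exact: (@is_derive1_comp R (horner E) U t _ _ (is_derive_poly _ _) (flow_du t)).
have d3 : is_derive t 1 (fun t => Num.sqrt E.[U t])
    ((2 * Num.sqrt E.[U t])^-1 * (E^`().[U t] * W t)).
  exact: (@is_derive1_comp R (@Num.sqrt R) (fun t => E.[U t]) t _ _
    (is_derive1_sqrt (EU t)) d2).
rewrite /W; apply: is_derive_eq.
apply: (@mulfI _ 2) => //.
transitivity ((e1 + e4 - 2 * U t) * E.[U t] + (U t - e1) * (e4 - U t) * E^`().[U t]).
  rewrite trigU -mr -mDr /GRing.scale /= /W.
  have -> : m - r + (m + r) - 2 * U t = 2 * r * cos (T t) by rewrite /U; ring.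
  have S0 : Num.sqrt E.[U t] != 0 by rewrite sqrtr_eq0 -ltNge.
  have : E.[U t] = Num.sqrt E.[U t] * Num.sqrt E.[U t].
    by rewrite -expr2 sqr_sqrtr // ltW.
  by move: S0; move: (E.[U t]) (Num.sqrt E.[U t]) => e S S0 ->; field.
by rewrite -discE'; ring.
Qed.

(** With [flow_du], these are Hamilton's equations for the biquadratic. *)
Lemma flow_dv (t : R) : is_derive t 1 V (- (2 * At (V t) * U t + Bt (V t))).
Proof.
have du := flow_du t; have dw := flow_dw t.
have dq x2 x1 x0 : is_derive t 1 (fun t => x2 * (U t * U t) + x1 * U t + x0)
    ((2 * x2 * U t + x1) * W t).
  by apply: is_derive_eq; rewrite /GRing.scale /=; ring.
have dA : is_derive t 1 (fun t => 2 * A (U t)) (2 * (A' (U t) * W t)).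
  exact: (is_deriveZ 2 (dq a2 a1 a0)).
have A0 : 2 * A (U t) != 0 by rewrite mulf_neq0.
have dAi := @is_deriveV _ (fun t => 2 * A (U t)) t _ 1 A0 dA.
have dB : is_derive t 1 (fun t => B (U t)) (B' (U t) * W t) := dq b2 b1 b0.
have dWB := is_deriveB dw dB; have dVV := is_deriveM dWB dAi.
apply: is_derive_eq dVV _; rewrite /GRing.scale /=.
have cur := flow_curve t; have wE := flow_wE t; have An := AU t.
have -> : 2 * At (V t) * U t + Bt (V t) = A' (U t) * (V t * V t) + B' (U t) * V t + C' (U t).
  by rewrite /At /Bt /A' /B' /C'; ring.
have -> : (W - (fun t0 : R => B (U t0))) t = 2 * A (U t) * V t.
  by rewrite -[LHS]/(W t - B (U t)) -wE addrK.
rewrite -wE; move: cur An.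
move: (V t) (A _) (A' _) (B _) (B' _) (C _) (C' _) => v a a' b b' c c' cur an.
have cE : c = - (a * (v * v) + b * v) by lra.
by rewrite cE; field.
Qed.

Let quadP (x2 x1 x0 : R) : {poly R} := x2%:P * ('X * 'X) + x1%:P * 'X + x0%:P.

Let linP (x2 x1 : R) : {poly R} := (2 * x2)%:P * 'X + x1%:P.

(** Half the derivative of the discriminant [Bt ^ 2 - 4 At Ct] in the other variable. *)
Let force : {poly R} := quadP a1 b1 c1 * linP a1 b1
  - 2%:P * linP a2 b2 * quadP a0 b0 c0 - 2%:P * quadP a2 b2 c2 * linP a0 b0.

Lemma flow_ddv (t : R) :
  is_derive t 1 (fun t => - (2 * At (V t) * U t + Bt (V t))) force.[V t].
Proof.
have du := flow_du t; have dv := flow_dv t.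
have -> : (fun t => - (2 * At (V t) * U t + Bt (V t))) =
  (fun t => - (2 * (a2 * (V t * V t) + b2 * V t + c2) * U t +
      (a1 * (V t * V t) + b1 * V t + c1))) by [].
apply: is_derive_eq; rewrite /GRing.scale /= /force.
rewrite !(hornerD, hornerN, hornerM, hornerC, hornerX).
have cur := flow_curve t; have <- := flow_wE t.
rewrite /A /B /C in cur; rewrite /A /B /At /Bt.
move: (U t) (V t) cur => u v cur.
apply/eqP; rewrite -subr_eq0; apply/eqP.
transitivity (2 * (2 * a2 * v + b2) *
   ((a2 * (u * u) + a1 * u + a0) * (v * v) + (b2 * (u * u) + b1 * u + b0) * v +
   (c2 * (u * u) + c1 * u + c0))); last by rewrite cur mulr0.
by ring.
Qed.

Lemma flow_v_bounded : exists K : R, forall t, `|V t| <= K.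
Proof.
have cq (x2 x1 x0 : R) : continuous ((fun u => x2 * (u * u) + x1 * u + x0) : R -> R).
  exact: (derive_continuous (dquad x2 x1 x0)).
pose g u := (Num.sqrt (B u * B u - 4 * A u * C u) + `|B u|) * `|2 * A u|^-1.
have cg : {within `[e1, e4], continuous g}.
  apply: continuous_in_subspaceT => u /set_mem; rewrite /= in_itv /= => uI.
  apply: cvgM.
    apply: cvgD; last by apply: cvg_norm; exact: cq.
    apply: continuous_comp; last exact: sqrt_continuous.
    apply: cvgB; first by apply: cvgM; exact: cq.
    by apply: cvgM; [apply: cvgM; [exact: cvg_cst|exact: cq]|exact: cq].
  apply: cvgV; first by rewrite normr_eq0 mulf_neq0 // A_neq0.
  by apply: cvg_norm; apply: cvgM; [exact: cvg_cst|exact: cq].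
have [c _ hc] := EVT_max (ltW e14) cg.
exists (g c) => t; apply: le_trans (hc (U t) _); last by rewrite in_itv /= flow_uI.
rewrite /V normrM normfV ler_wpM2r ?invr_ge0 //.
apply: le_trans (ler_normB _ _) _; rewrite lerD2r.
by rewrite -flow_w2 -expr2 sqrtr_sqr.
Qed.

Lemma flow_uN t : U (- t) = U t.
Proof. by rewrite /U (clock_invN Th0 ThK TK dTh) cosN. Qed.

Lemma flow_wN t : W (- t) = - W t.
Proof.
by rewrite /W flow_uN (clock_invN Th0 ThK TK dTh) sinN mulrN mulNr.
Qed.

Lemma flow_vieta t : A (U t) * (V t + V (- t)) = - B (U t).
Proof.
by rewrite /V flow_uN flow_wN; field; exact: AU.
Qed.

Local Notation per := (clock_period Th).

Lemma flow_periodic t (k : int) : U (t + k%:~R * per) = U t /\ V (t + k%:~R * per) = V t.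
Proof.
have e := clock_invDperiodn Th0 ThK TK dTh t k.
have P (f : R -> R) : (forall x, f (x + pi *+ 2) = f x) ->
    forall x, f (x + k%:~R * (pi *+ 2)) = f x.
  move=> fP; have fPn n x : f (x + n%:R * (pi *+ 2)) = f x.
    by rewrite mulr_natl; exact: periodicn.
  case: k {e} => n x; first by rewrite -pmulrn fPn.
  rewrite NegzE rmorphN /= -pmulrn mulNr.
  by rewrite -(fPn n.+1 (x - _)) subrK.
have uE : U (t + k%:~R * per) = U t by rewrite /U e (P cos) //; exact: cosD2pi.
split=> //; rewrite /V /W uE e (P sin) //; exact: sinD2pi.
Qed.

Lemma flow_period t c : U (t + c) = U t -> V (t + c) = V t ->
  exists k : int, c = k%:~R * per.
Proof.
move=> uE vE.
have cE : cos (T (t + c)) = cos (T t).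
  move: uE; rewrite /U => /addrI/oppr_inj/mulfI; apply; exact: lt0r_neq0.
have wE : W (t + c) = W t by rewrite -!flow_wE uE vE.
have sE : sin (T (t + c)) = sin (T t).
  move: wE; rewrite /W uE => /mulIf h; have /mulfI : r != 0 by exact: lt0r_neq0.
  by apply; apply: h; rewrite sqrtr_eq0 -ltNge.
have [k e] := cos_sin_eq cE sE; exists k.
have /(can_inj TK) : T (t + c) = T (t + k%:~R * per).
  by rewrite (clock_invDperiodn Th0 ThK TK dTh).
by move/addrI.
Qed.

Lemma flow_u_countable u0 : countable [set t | U t = u0].
Proof.
have [[t0 tE]|none] := pselect (exists t, U t = u0); last first.
  rewrite (_ : [set t | U t = u0] = set0) //.
  by apply/seteqP; split=> // t tE; apply: none; exists t.
pose f (x : int * bool) : R := Th ((if x.2 then T t0 else - T t0) + x.1%:~R * (pi *+ 2)).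
apply: (@sub_countable _ _ _ (range f)); last first.
  apply: (@sub_countable _ _ _ [set: int * bool]); first exact: card_image_le.
  exact: countableP.
apply: subset_card_le => t /= e.
have : cos (T t) = cos (T t0).
  move: e; rewrite -tE /U => /addrI/oppr_inj/mulfI; apply; exact: lt0r_neq0.
case/cos_eq => k [kE|kE]; [exists (k, true) => //|exists (k, false) => //].
  by rewrite /f /= -kE TK.
by rewrite /f /= -kE TK.
Qed.

(** At the parameter [t0] of a point where the derivative in [u] vanishes, [V' = 0]. Then
    [V (t0 + t)] and [V (t0 - t)] solve the same second order equation with the same initial
    data, so they agree. Differentiating [V (s - t) = V t] gives Vieta's formula for the two
    abscissas over the same ordinate. *)
Lemma flow_reflection u0 v0 : e1 <= u0 <= e4 ->
  A u0 * (v0 * v0) + B u0 * v0 + C u0 = 0 -> 2 * At v0 * u0 + Bt v0 = 0 ->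
  exists s, [/\ s = clock_integral m r Th u0 *+ 2 \/ s = - (clock_integral m r Th u0 *+ 2),
    forall t, V (s - t) = V t &
    forall t, At (V t) * (U t + U (s - t)) = - Bt (V t)].
Proof.
move=> uI cur crit; pose tau := acos ((m - u0) / r).
have rn := lt0r_neq0 r_gt0.
have cosE : cos tau = (m - u0) / r.
  rewrite /tau acosK // in_itv /= ler_pdivlMr // ler_pdivrMr //.
  by move: uI r_gt0; rewrite -mr -mDr => /andP[h1 h2] h3; apply/andP; split; lra.
have uE : U (Th tau) = u0 by rewrite /U ThK cosE; field.
have : (W (Th tau) - (2 * A u0 * v0 + B u0)) * (W (Th tau) + (2 * A u0 * v0 + B u0)) = 0.
  have := flow_w2 (Th tau); rewrite uE; move: (W _) (A _) (B _) (C _) cur => w a b c cur h.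
  have -> : (w - (2 * a * v0 + b)) * (w + (2 * a * v0 + b)) =
     w * w - (b * b - 4 * a * c) - 4 * a * (a * (v0 * v0) + b * v0 + c) by ring.
  by rewrite cur h; ring.
have an : A u0 != 0 by exact: A_neq0.
have vE t : U t = u0 -> W t = 2 * A u0 * v0 + B u0 -> V t = v0.
  by move=> ut wt; rewrite /V ut wt; field.
move=> /eqP; rewrite mulf_eq0 => sgn.
have [t0 [t0E ut0 vt0]] : exists t0, [/\ t0 = Th tau \/ t0 = - Th tau, U t0 = u0 & V t0 = v0].
  case/orP: sgn => /eqP h.
    by exists (Th tau); split; [left| |apply: vE => //; lra].
  exists (- Th tau); split; [by right|by rewrite flow_uN|apply: vE; rewrite ?flow_uN //].
  by rewrite flow_wN; lra.
exists (t0 *+ 2).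
have symV t : V (t0 + t) = V (t0 - t).
  have [K hK] := flow_v_bounded.
  pose Z t := - (2 * At (V t) * U t + Bt (V t)).
  have shift (f f' : R -> R) (e : R) (x : R) : (forall t : R, is_derive t 1 f (f' t)) ->
      is_derive x 1 (fun x => f (t0 + e * x)) (f' (t0 + e * x) * e).
    move=> df; have d : is_derive x 1 (fun x => t0 + e * x) e.
      by apply: is_derive_eq; rewrite /GRing.scale /=; ring.
    exact: (@is_derive1_comp R f (fun x => t0 + e * x) x _ _ (df _) d).
  have dZ (t : R) : is_derive t 1 Z force.[V t] := flow_ddv t.
  suff key : (fun t => V (t0 + 1 * t)) =1 (fun t => V (t0 + (-1) * t)).
    by have := key t; rewrite /= mul1r mulN1r.
  have D1 (x : R) : is_derive x 1 (fun t => V (t0 + 1 * t)) (Z (t0 + 1 * x) * 1).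
    by apply: shift; exact: flow_dv.
  have D2 (x : R) : is_derive x 1 (fun t => V (t0 + -1 * t)) (Z (t0 + -1 * x) * -1).
    by apply: shift; exact: flow_dv.
  have D3 (x : R) : is_derive x 1 (fun t => Z (t0 + 1 * t) * 1) force.[V (t0 + 1 * x)].
    have := shift Z _ 1 x dZ; rewrite mulr1.
    by have -> : (fun t => Z (t0 + 1 * t) * 1) = (fun t => Z (t0 + 1 * t))
      by apply/funext => y; rewrite mulr1.
  have D4 (x : R) : is_derive x 1 (fun t => Z (t0 + -1 * t) * -1) force.[V (t0 + -1 * x)].
    have d := is_deriveZ (-1) (shift Z _ (-1) x dZ).
    have -> : (fun t => Z (t0 + -1 * t) * -1) = -1 \*: (fun x => Z (t0 + -1 * x)).
      by apply/funext => y; rewrite /= mulrC.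
    by apply: is_derive_eq d _; rewrite /GRing.scale /=; ring.
  apply: (ode2_unique D1 D2 D3 D4 (K := K)).
  - by move=> x; exact: hK.
  - by move=> x; exact: hK.
  - by rewrite !mulr0.
  - by rewrite !mulr0 !addr0 /Z ut0 vt0 crit oppr0 !mul0r.
have symV2 t : V (t0 *+ 2 - t) = V t.
  have := symV (t0 - t); have -> : t0 + (t0 - t) = t0 *+ 2 - t by rewrite mulr2n addrA.
  by rewrite subKr.
split=> //.
  by rewrite /clock_integral -/tau; case: t0E => ->; [left|right; rewrite mulNrn].
move=> t.
have d1 := flow_dv t.
have d2 : is_derive t 1 (fun t => V (t0 *+ 2 - t))
    ((2 * At (V (t0 *+ 2 - t)) * U (t0 *+ 2 - t) + Bt (V (t0 *+ 2 - t)))).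
  have d : is_derive t 1 (fun x => t0 *+ 2 - x) (-1).
    by move: (t0 *+ 2) => c; apply: is_derive_eq; rewrite /GRing.scale /=; ring.
  have := @is_derive1_comp R V (fun x => t0 *+ 2 - x) t _ _ (flow_dv _) d.
  by rewrite mulrN1 opprK.
have fE : (fun t => V (t0 *+ 2 - t)) = V by apply/funext => x; exact: symV2.
have := @derive_val _ _ _ _ _ _ _ d2; rewrite fE (@derive_val _ _ _ _ _ _ _ d1) symV2.
by move: (At _) (Bt _) (U t) (U _) => x y z w; lra.
Qed.
End Flow.

Section OvalFlow.
Context {R : realType}.
Implicit Types (q : nat -> nat -> R) (u v : R).

(** A biquadratic [\sum_(i, j <= 2) q i j * u ^ i * v ^ j], as a quadratic in one variable. *)
Definition quad_v q u (j : nat) := q 2 j * (u * u) + q 1 j * u + q 0 j.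
Definition quad_u q v (i : nat) := q i 2 * (v * v) + q i 1 * v + q i 0.

Definition biquad q u v := quad_v q u 2 * (v * v) + quad_v q u 1 * v + quad_v q u 0.

Definition disc_v q u := quad_v q u 1 * quad_v q u 1 - 4 * quad_v q u 2 * quad_v q u 0.

(** A parametrization of an oval of the real curve [biquad q = 0], lying over the
    segment [[e1, e4]], by the invariant differential [du / sqrt (disc_v q u)]; [G] is
    the corresponding elliptic integral, so the period is twice its total value. *)
Record oval_flow q (e1 e4 : R) (U V G : R -> R) : Prop := OvalFlow {
  oval_G_continuous : continuous G;
  oval_G_left : G e1 = 0;
  oval_G_right : 0 < G e4;
  oval_G_derive : forall u, e1 < u < e4 -> is_derive u 1 G (Num.sqrt (disc_v q u))^-1;
  oval_range : forall t, e1 <= U t <= e4;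
  oval_curve : forall t, biquad q (U t) (V t) = 0;
  oval_even : forall t, U (- t) = U t;
  oval_vieta : forall t,
    quad_v q (U t) 2 * (V t + V (- t)) = - quad_v q (U t) 1;
  oval_countable : forall u, countable [set t | U t = u];
  oval_periodic : forall t (k : int), U (t + k%:~R * (G e4 *+ 2)) = U t /\
    V (t + k%:~R * (G e4 *+ 2)) = V t;
  oval_period : forall t c, U (t + c) = U t -> V (t + c) = V t ->
    exists k : int, c = k%:~R * (G e4 *+ 2);
  oval_reflection : forall u v, e1 <= u <= e4 -> biquad q u v = 0 ->
    2 * quad_u q v 2 * u + quad_u q v 1 = 0 ->
    exists s, [/\ s = G u *+ 2 \/ s = - (G u *+ 2),
      forall t, V (s - t) = V t &
      forall t, quad_u q (V t) 2 * (U t + U (s - t)) = - quad_u q (V t) 1] }.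

Theorem oval_flow_exists q (e1 e4 : R) (E : {poly R}) : e1 < e4 ->
  (forall u, e1 <= u <= e4 -> 0 < E.[u]) ->
  (forall u, e1 <= u <= e4 -> quad_v q u 2 != 0) ->
  (forall u, disc_v q u = (u - e1) * (e4 - u) * E.[u]) ->
  exists U V G : R -> R, oval_flow q e1 e4 U V G.
Proof.
move=> e14 E0 A0 dE.
pose m := (e1 + e4) / 2; pose r := (e4 - e1) / 2.
have r0 : 0 < r by rewrite /r; lra.
have mr : m - r = e1 by rewrite /m /r; lra.
have mDr : m + r = e4 by rewrite /m /r; lra.
have E0' u : m - r <= u <= m + r -> 0 < E.[u] by rewrite mr mDr; exact: E0.
have [Th [T [Th0 ThK TK dTh dT]]] := clock_exists r0 E0'.
pose G := clamped_integral m r Th.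
have GE u : e1 <= u <= e4 -> G u = clock_integral m r Th u.
  by move=> uI; rewrite /G clamped_integralE // mr mDr.
have G4 : G e4 = Th pi.
  by rewrite GE ?lexx ?ltW // -mDr (clock_integral_right m r0).
have per : G e4 *+ 2 = clock_period Th by rewrite G4.
exists (flow_u e1 e4 T), (flow_v (q 0 2) (q 1 2) (q 2 2) (q 0 1) (q 1 1) (q 2 1) e1 e4 E T), G.
split.
- exact: (clamped_integral_continuous r0 E0' Th0 ThK TK dTh dT).
- by rewrite GE ?lexx ?ltW // -{1}mr (clock_integral_left m r0 Th0).
- by rewrite G4 -(pmulrn_lgt0 _ (ltn0Sn 1)); exact: (clock_period_gt0 r0 E0' Th0 dTh).
- move=> u uI; rewrite dE -{1}mr -mDr.
  by apply: (clamped_integral_derive r0 E0' dTh); rewrite mr mDr.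
- exact: flow_uI.
- by move=> t; apply: (flow_curve e14 E0 A0 dE).
- by move=> t; apply: (flow_uN Th0 ThK TK dTh).
- by move=> t; apply: (flow_vieta _ _ _ e14 A0 Th0 ThK TK dTh).
- by move=> u; apply: (flow_u_countable e14 TK).
- by move=> t k; rewrite per; apply: (flow_periodic _ _ _ _ _ _ Th0 ThK TK dTh).
- by move=> t c; rewrite per; apply: (flow_period e14 E0 A0 Th0 ThK TK dTh).
- move=> u v uI cur crit; rewrite GE //.
  exact: (flow_reflection e14 E0 A0 dE Th0 ThK TK dTh dT uI cur crit).
Qed.
End OvalFlow.

(** * Signs of the discriminant *)

(** Decides the sign of a product from the signs of its factors. *)
Ltac factor_sign A := match A with
  | ?B * ?C =>
      factor_sign B; factor_sign C;
      match goal with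
      | [h : is_true (0 < B), k : is_true (0 < C) |- _] => have : 0 < B * C by rewrite (pmulr_rgt0 C h)
      | [h : is_true (0 < B), k : is_true (C < 0) |- _] => have : B * C < 0 by rewrite (pmulr_rlt0 C h)
      | [h : is_true (B < 0), k : is_true (0 < C) |- _] => have : B * C < 0 by rewrite (nmulr_rlt0 C h)
      | [h : is_true (B < 0), k : is_true (C < 0) |- _] => have : 0 < B * C by rewrite (nmulr_rgt0 C h)
      end; intro
  | _ => let h := fresh "sg" in first [have h : 0 < A by lra | have h : A < 0 by lra]
  end.
Ltac prod_sign := match goal with
  | |- is_true (0 < ?A) => factor_sign A; match goal with h : is_true (0 < A) |- _ => exact h end
  | |- is_true (?A < 0) => factor_sign A; match goal with h : is_true (A < 0) |- _ => exact h end
  end.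

Section QuarticSigns.
Context {R : realType}.
Variables (x1 x2 x3 : R) (x4 : option R) (lc : R).

Definition quartic_factor x : R :=
  (x - x1) * (x - x2) * (x - x3) * (if x4 is Some r then x - r else 1).

(** The sign of the leading coefficient, seen from the point [1]. *)
Definition lead1 : R := lc * (if x4 is Some r then r - 1 else -1).

(** On the real projective line the sign of the polynomial changes at each of the four roots.
    It is nonnegative at 1 and -1, and nonpositive at points of [[0, 1)] and of [(1, oo]]:
    whatever the position of the fourth root, only one distribution of the signs is left. *)
Lemma quartic_signs (f : R -> R) r :
  (forall x, f x = lc * quartic_factor x) -> lc != 0 ->
  x1 < x2 -> x2 < x3 -> - x2 <= x1 -> -1 <= x1 -> x2 <= 1 ->
  (if x4 is Some q then x3 < q \/ q <= - x3 else True) ->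
  0 <= f 1 -> 0 <= f (-1) -> 0 <= r < 1 -> f r <= 0 ->
  lc * (if x4 is Some _ then 1 else 0) <= 0 \/ (exists s, 1 < s /\ f s <= 0) ->
  1 <= x3 /\ 0 < lead1.
Proof.
move=> F lc0 e12 e23 e1N e1 e2 far f1 fN1 /andP[r0 r1] fr root2.
have /lt_total/orP lcs := lc0.
have x1E : -1 < x1 \/ x1 = -1 /\ x2 = 1.
  have [h|h] := ltP (-1) x1; [by left|right]; lra.
have pos x : 0 <= f x -> ~ lc * quartic_factor x < 0 by rewrite F leNgt => /negP.
have neg x : f x <= 0 -> ~ 0 < lc * quartic_factor x by rewrite F leNgt => /negP.
have {}root2 : lc * (if x4 is Some _ then 1 else 0) <= 0 \/
    exists s, 1 < s /\ ~ 0 < lc * quartic_factor s.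
  by case: root2 => [|[s [s1 /neg fs]]]; [left|right; exists s].
have {f1} f1 := pos _ f1; have {fN1} fN1 := pos _ fN1; have {fr} fr := neg _ fr.
rewrite /quartic_factor in f1 fN1 fr root2; rewrite /lead1.
clear f F lc0 pos neg.
case: x4 far root2 f1 fN1 fr => [q|] far root2 f1 fN1 fr; last first.
  rewrite !mulr1 in f1 fN1 fr.
  case: lcs => lcs.
    split; last by lra.
    by rewrite leNgt; apply/negP => x31; apply: f1; clear fN1 fr root2; prod_sign.
  exfalso; case: x1E => [x1n|[x1e x2e]].
    by apply: fN1; clear f1 fr root2; prod_sign.
  by apply: fr; clear f1 fN1 root2; prod_sign.
case: far => far; case: lcs => lcs.
- exfalso; case: x1E => [x1n|[x1e x2e]].
    by apply: fN1; clear f1 fr root2; prod_sign.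
  by apply: fr; clear f1 fN1 root2; prod_sign.
- have x31 : 1 <= x3; last first.
    by split=> //; clear f1 fN1 fr root2; prod_sign.
  rewrite leNgt; apply/negP => x31.
  have [q1|q1] := ltP 1 q; first by apply: f1; clear fN1 fr root2; prod_sign.
  case: root2 => [|[s [s1 fs]]]; first by rewrite mulr1; lra.
  by apply: fs; clear f1 fN1 fr; prod_sign.
- split; last by clear f1 fN1 fr root2; prod_sign.
  by rewrite leNgt; apply/negP => x31; apply: f1; clear fN1 fr root2; prod_sign.
- exfalso; case: x1E => [x1n|[x1e x2e]]; last first.
    by apply: fr; clear f1 fN1 root2; prod_sign.
  have [q1|q1] := ltP q (-1); first by apply: fN1; clear f1 fr root2; prod_sign.
  case: root2 => [|[s [s1 fs]]]; first by rewrite mulr1; lra.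
  by apply: fs; clear f1 fN1 fr; prod_sign.
Qed.
End QuarticSigns.

Section Transitions.
Context {R : realType}.
Variable p : int -> int -> R.
Hypothesis p_prob : transition_probabilities p.
Hypotheses (a_neq0 : coef_a p != 0) (c_neq0 : coef_c p != 0).

Local Notation a x := ((coef_a p).[x]).
Local Notation b x := ((coef_b p).[x]).
Local Notation c x := ((coef_c p).[x]).
Local Notation D x := ((disc p).[x]).

Lemma coef_aE x : a x = p 1 1 * x ^+ 2 + p 0 1 * x + p (-1) 1.
Proof. by rewrite /coef_a !hornerE. Qed.
Lemma coef_bE x : b x = p 1 0 * x ^+ 2 + (p 0 0 - 1) * x + p (-1) 0.
Proof. by rewrite /coef_b !hornerE. Qed.
Lemma coef_cE x : c x = p 1 (-1) * x ^+ 2 + p 0 (-1) * x + p (-1) (-1).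
Proof. by rewrite /coef_c !hornerE. Qed.
Lemma discE x : D x = b x ^+ 2 - 4 * a x * c x.
Proof.
have e : 4%:R = (4%:R : R)%:P by rewrite polyC_natr.
by rewrite /disc e !(hornerD, hornerN, hornerM, horner_exp, hornerC).
Qed.

Lemma prob_ge0 : [/\ [/\ 0 <= p 1 1, 0 <= p 1 0 & 0 <= p 1 (-1)],
  [/\ 0 <= p 0 1, 0 <= p 0 0 & 0 <= p 0 (-1)] &
  [/\ 0 <= p (-1) 1, 0 <= p (-1) 0 & 0 <= p (-1) (-1)]].
Proof. by case: p_prob => h _; do ! split; apply: h. Qed.

Lemma prob_sum : p 1 1 + p 1 0 + p 1 (-1) + (p 0 1 + p 0 0 + p 0 (-1)) +
  (p (-1) 1 + p (-1) 0 + p (-1) (-1)) = 1.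
Proof.
case: p_prob => _ <-; rewrite /steps !big_cons !big_nil; ring.
Qed.

Lemma coef_a_gt0 x : 0 < x -> 0 < a x.
Proof.
move=> x0; have [[h11 _ _] [h01 _ _] [hm1 _ _]] := prob_ge0.
have x20 : 0 <= p 1 1 * x ^+ 2 by rewrite mulr_ge0 // sqr_ge0.
have x10 : 0 <= p 0 1 * x by rewrite mulr_ge0 // ltW.
rewrite coef_aE lt_neqAle; apply/andP; split; last by rewrite !addr_ge0.
apply: contraNneq a_neq0 => /esym/eqP.
rewrite paddr_eq0 ?addr_ge0 // paddr_eq0 // !mulf_eq0 (gt_eqF x0) !orbF.
by move=> /andP[/andP[/eqP e1 /eqP e2] /eqP e3]; rewrite /coef_a e1 e2 e3 !mul0r !addr0.
Qed.

Lemma coef_c_gt0 x : 0 < x -> 0 < c x.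
Proof.
move=> x0; have [[_ _ h11] [_ _ h01] [_ _ hm1]] := prob_ge0.
have x20 : 0 <= p 1 (-1) * x ^+ 2 by rewrite mulr_ge0 // sqr_ge0.
have x10 : 0 <= p 0 (-1) * x by rewrite mulr_ge0 // ltW.
rewrite coef_cE lt_neqAle; apply/andP; split; last by rewrite !addr_ge0.
apply: contraNneq c_neq0 => /esym/eqP.
rewrite paddr_eq0 ?addr_ge0 // paddr_eq0 // !mulf_eq0 (gt_eqF x0) !orbF.
by move=> /andP[/andP[/eqP e1 /eqP e2] /eqP e3]; rewrite /coef_c e1 e2 e3 !mul0r !addr0.
Qed.

Lemma coef_b1 : b 1 = - (a 1 + c 1).
Proof. by have := prob_sum; rewrite coef_aE coef_bE coef_cE; lra. Qed.

Lemma coef_b1_lt0 : b 1 < 0.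
Proof. by have := coef_a_gt0 ltr01; have := coef_c_gt0 ltr01; rewrite coef_b1; lra. Qed.

Lemma disc1_ge0 : 0 <= D 1.
Proof.
rewrite discE coef_b1; have -> : (- (a 1 + c 1)) ^+ 2 - 4 * a 1 * c 1 = (a 1 - c 1) ^+ 2.
  by ring.
exact: sqr_ge0.
Qed.

Lemma discN1_ge0 : 0 <= D (-1).
Proof.
have [[h1 h2 h3] [h4 h5 h6] [h7 h8 h9]] := prob_ge0; have := prob_sum.
rewrite discE coef_aE coef_bE coef_cE sqrrN expr1n !mulr1 !mulrN1.
set B := _ - _ + _; set A := _ - _ + _; set C := _ - _ + _ => s.
have BA : `|A| + `|C| <= B.
  have hA : `|A| <= p 1 1 + p 0 1 + p (-1) 1 by rewrite ler_norml /A; apply/andP; split; lra.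
  have hC : `|C| <= p 1 (-1) + p 0 (-1) + p (-1) (-1).
    by rewrite ler_norml /C; apply/andP; split; lra.
  by apply: le_trans (lerD hA hC) _; rewrite /B; lra.
have hAC : A * C <= `|A| * `|C| by rewrite -normrM ler_norm.
have := normr_ge0 A; have := normr_ge0 C; have := sqr_ge0 (`|A| - `|C|).
move: `|A| `|C| BA hAC => x y BA hAC h cc aa.
have : (x + y) ^+ 2 <= B ^+ 2 by rewrite lerXn2r // nnegrE; lra.
by move: h; rewrite !expr2; nra.
Qed.

Lemma coef_b_convex r x y : b r * (y - x) = b x * (y - r) + b y * (r - x)
  - p 1 0 * ((y - r) * (r - x) * (y - x)).
Proof. by rewrite !coef_bE; ring. Qed.

(** A zero of [b] in [[0, 1)], where the discriminant [- 4 a c] cannot be positive. *)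
Lemma coef_b_root_left : exists r, [/\ 0 <= r < 1, D r <= 0 &
  forall x, 0 < x < 1 -> b x < 0 -> r < x].
Proof.
have [[h1 h2 h3] [h4 h5 h6] [h7 h8 h9]] := prob_ge0.
have b0 : b 0 = p (-1) 0 by rewrite coef_bE expr0n /= !mulr0 !add0r.
have b1 := coef_b1_lt0.
have [p0|p0] := eqVneq (p (-1) 0) 0.
  exists 0; split=> [||x /andP[]//]; first by rewrite lexx ltr01.
  rewrite discE b0 p0 coef_aE coef_cE expr0n /= !mulr0 !add0r.
  by rewrite oppr_le0 !mulr_ge0.
have pos : 0 < p (-1) 0 by rewrite lt_neqAle eq_sym p0.
have [|r] := @poly_ivt R (- coef_b p) 0 1 ler01; first by rewrite !hornerN b0; lra.
move=> /andP[r0 r1] /rootP; rewrite hornerN => /eqP; rewrite oppr_eq0 => /eqP br.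
have rn1 : r < 1.
  by rewrite lt_neqAle r1 andbT; apply: contraTneq b1 => <-; rewrite br ltxx.
have r_gt0 : 0 < r.
  by rewrite lt0r r0 andbT; apply: contraTneq pos => e; move: br; rewrite e b0 => ->; rewrite ltxx.
exists r; split; first by rewrite r0.
  rewrite discE br expr0n /= sub0r oppr_le0 !mulr_ge0 ?ltW //.
    exact: coef_a_gt0.
  exact: coef_c_gt0.
move=> x /andP[x0 x1] bx; rewrite ltNge; apply/negP => xr.
have := coef_b_convex r x 1; rewrite br mul0r.
have : 0 <= p 1 0 * ((1 - r) * (r - x) * (1 - x)) by rewrite !mulr_ge0; lra.
have : b x * (1 - r) < 0 by rewrite nmulr_rlt0 //; lra.
have : b 1 * (r - x) <= 0 by rewrite nmulr_rle0 //; lra.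
lra.
Qed.

(** The mirror image of the previous lemma under [x -> 1 / x]; when [p 1 0 = 0] the zero
    of [b] is at infinity. *)
Lemma coef_b_root_right :
  p 1 0 = 0 \/ exists r, [/\ 1 < r, D r <= 0 & forall x, 1 < x -> b x < 0 -> x < r].
Proof.
have [[h1 h2 h3] [h4 h5 h6] [h7 h8 h9]] := prob_ge0.
have b1 := coef_b1_lt0.
have [p0|p0] := eqVneq (p 1 0) 0; first by left.
(* [p 1 0 * M = p 1 0 + 1], hence [b M >= 0]. *)
right; have pos : 0 < p 1 0 by rewrite lt_neqAle eq_sym p0.
pose M := 1 + (p 1 0)^-1.
have M1 : 1 <= M by rewrite lerDl invr_ge0.
have bM : 0 <= b M.
  rewrite coef_bE; have -> : p 1 0 * M ^+ 2 + (p 0 0 - 1) * M + p (-1) 0 =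
     (p 1 0 * M - (1 - p 0 0)) * M + p (-1) 0 by ring.
  have pM : p 1 0 * M = p 1 0 + 1 by rewrite /M mulrDr mulr1 divff.
  have M0 : 0 <= M by lra.
  by rewrite addr_ge0 // mulr_ge0 // pM; lra.
have [|r] := @poly_ivt R (coef_b p) 1 M M1; first by rewrite bM ltW.
move=> /andP[r1 rM] /rootP br.
have rn1 : 1 < r.
  by rewrite lt_neqAle r1 andbT; apply: contraTneq b1 => ->; rewrite br ltxx.
exists r; split=> //.
  rewrite discE br expr0n /= sub0r oppr_le0 !mulr_ge0 ?ltW //.
    by apply: coef_a_gt0; lra.
  by apply: coef_c_gt0; lra.
move=> x x1 bx; rewrite ltNge; apply/negP => xr.
have := coef_b_convex r x 1; rewrite br mul0r.
have : p 1 0 * ((1 - r) * (r - x) * (1 - x)) <= 0.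
  apply: mulr_ge0_le0 => //; apply: mulr_ge0_le0; last lra.
  by apply: mulr_le0; lra.
have : 0 < b x * (1 - r) by rewrite nmulr_rgt0 //; lra.
have : 0 <= b 1 * (r - x) by rewrite nmulr_rge0 //; lra.
lra.
Qed.

Variables (x1 x2 x3 : R) (x4 : option R) (lc : R).
Hypothesis discF : forall x, D x = lc * quartic_factor x1 x2 x3 x4 x.
Hypothesis lc_neq0 : lc != 0.
Hypotheses (x12 : x1 < x2) (x23 : x2 < x3) (x1N : - x2 <= x1) (x1_ge : -1 <= x1) (x2_le : x2 <= 1).
Hypothesis x4_far : if x4 is Some r then x3 < r \/ r <= - x3 else True.

Lemma x2_gt0 : 0 < x2. Proof. by have := x12; have := x1N; lra. Qed.

Local Notation lead1 := (lead1 x4 lc).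

(** The fourth finite difference extracts the coefficient of [x ^+ 4]. *)
Lemma disc_lead_coef : lc * (if x4 is Some _ then 1 else 0) = p 1 0 ^+ 2 - 4 * p 1 1 * p 1 (-1).
Proof.
have h2 := discF 2; have h1 := discF 1; have h0 := discF 0.
have hn1 := discF (-1); have hn2 := discF (-2).
transitivity ((D 2 - 4 * D 1 + 6 * D 0 - 4 * D (-1) + D (-2)) / 24).
  rewrite h2 h1 h0 hn1 hn2 /quartic_factor; case: (x4) => [r|]; by field.
by rewrite !discE !coef_aE !coef_bE !coef_cE; field.
Qed.

Lemma disc_signs : 1 <= x3 /\ 0 < lead1.
Proof.
have [r [r01 Dr _]] := coef_b_root_left.
apply: (quartic_signs discF lc_neq0 x12 x23 x1N x1_ge x2_le x4_far disc1_ge0 discN1_ge0 r01 Dr).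
have [p0|[s [s1 Ds _]]] := coef_b_root_right; last by right; exists s.
left; rewrite disc_lead_coef p0 expr0n /= sub0r oppr_le0.
by have [[h1 h2 h3] _ _] := prob_ge0; rewrite !mulr_ge0.
Qed.

(** The factor of the discriminant that vanishes at [x4], normalized by its value -1 at
    the point 1. *)
Definition far_factor x : R := if x4 is Some r then (x - r) / (r - 1) else -1.

Lemma discE_far x : D x = lead1 * ((x - x1) * (x - x2) * (x - x3) * far_factor x).
Proof.
have [x31 _] := disc_signs; have far := x4_far.
rewrite discF /quartic_factor /lead1 /far_factor; case: (x4) far => [r|] far; last by ring.
by field; case: far; lra.
Qed.

Lemma far_factor_lt0 x : - x3 < x <= x3 -> far_factor x < 0.
Proof.
move=> /andP[h1 h2]; have [x31 _] := disc_signs; have far := x4_far.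
rewrite /far_factor; case: (x4) far => [r|] far; last by rewrite oppr_lt0.
case: far => far; first by rewrite pmulr_llt0 ?invr_gt0; lra.
by rewrite nmulr_llt0 ?invr_lt0; lra.
Qed.

Lemma disc_gt0 x : x2 < x < x3 -> 0 < D x.
Proof.
move=> /andP[h2 h3]; have [x31 ld] := disc_signs; rewrite discE_far mulr_gt0 //.
have x20 := x2_gt0; have h : far_factor x < 0 by apply: far_factor_lt0; lra.
have k1 : 0 < x - x1 by have := x12; lra.
have k2 : 0 < x - x2 by lra.
have k3 : x - x3 < 0 by lra.
by rewrite nmulr_lgt0 // nmulr_llt0 // mulr_gt0.
Qed.

Lemma disc_lt0 x : x1 < x < x2 -> D x < 0.
Proof.
move=> /andP[h2 h3]; have [x31 ld] := disc_signs; rewrite discE_far pmulr_rlt0 //.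
have h : far_factor x < 0.
  by apply: far_factor_lt0; have := x1N; have := x23; lra.
have k1 : 0 < x - x1 by lra.
have k2 : x - x2 < 0 by lra.
have k3 : x - x3 < 0 by have := x23; lra.
by rewrite nmulr_llt0 // nmulr_lgt0 // pmulr_rlt0.
Qed.

(** The points of the real curve in the positive quadrant form the oval through [(1, 1)]. *)
Lemma positive_branch x : 0 < x -> b x < 0 -> 0 <= D x -> x2 <= x <= x3.
Proof.
move=> x0 bx Dx; have [x31 ld] := disc_signs; have x20 := x2_gt0.
apply/andP; split; rewrite leNgt; apply/negP => xlt.
  have [r [/andP[r0 r1] Dr rx]] := coef_b_root_left.
  have rx' : r < x by apply: rx => //; rewrite x0; have := x2_le; lra.
  have x1x : x <= x1.
    rewrite leNgt; apply/negP => h; have : D x < 0 by apply: disc_lt0; rewrite h xlt.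
    by lra.
  have h : far_factor r < 0.
    by apply: far_factor_lt0; have := x2_le; lra.
  have : 0 < D r.
    have k1 : r - x1 < 0 by lra.
    have k2 : r - x2 < 0 by lra.
    have k3 : r - x3 < 0 by lra.
    by rewrite discE_far mulr_gt0 // nmulr_lgt0 // nmulr_llt0 // nmulr_lgt0.
  by lra.
have k12 : 0 < (x - x1) * (x - x2) * (x - x3).
  by have := x12; have := x23 => e1 e2; rewrite !mulr_gt0 //; lra.
have lE := disc_lead_coef; have root2 := coef_b_root_right.
move: Dx; rewrite discE_far pmulr_rge0 // pmulr_rge0 // /far_factor.
have far := x4_far; rewrite /lead1 in ld.
case: (x4) far ld lE discF => [q|] far ld lE DF; last by lra.
case: far => far Dx.
  have q1 : 0 < q - 1 by lra.
  have qx : q <= x by move: Dx; rewrite pmulr_lge0 ?invr_gt0 // subr_ge0.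
  have lc0 : 0 < lc by move: ld; rewrite pmulr_lgt0.
  case: root2 => [p0|[s [s1 Ds sx]]].
    have [[h1 h2 h3] _ _] := prob_ge0.
    have : 0 <= 4 * p 1 1 * p 1 (-1) by rewrite !mulr_ge0.
    by move: lE; rewrite mulr1 p0 expr0n /= sub0r; lra.
  have xs : x < s by apply: sx => //; lra.
  have : 0 < D s.
    rewrite DF /quartic_factor mulr_gt0 // mulr_gt0 ?subr_gt0 ?(le_lt_trans qx) //.
    by have := x12; have := x23 => e1 e2; rewrite !mulr_gt0 //; lra.
  by lra.
by move: Dx; rewrite nmulr_lge0 ?invr_lt0; lra.
Qed.

Lemma positive_branchP x : x2 <= x <= x3 -> b x < 0.
Proof.
move=> /andP[h2 h3]; have x20 := x2_gt0; have e2 := x2_le; have [x31 _] := disc_signs.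
have noroot y : x2 <= y <= x3 -> b y != 0.
  move=> /andP[y2 y3]; have y0 : 0 < y by lra.
  apply/eqP => by0.
  have : 0 <= D y.
    have [e|n2] := eqVneq y x2; first by rewrite discF /quartic_factor e subrr !(mulr0, mul0r).
    have [e|n3] := eqVneq y x3; first by rewrite discF /quartic_factor e subrr !(mulr0, mul0r).
    by apply/ltW/disc_gt0; rewrite !lt_neqAle y2 y3 eq_sym n2 n3.
  rewrite discE by0 expr0n /= sub0r oppr_ge0 leNgt => /negP; apply.
  by rewrite !mulr_gt0 // ?coef_a_gt0 ?coef_c_gt0.
have b1 := coef_b1_lt0.
rewrite ltNge; apply/negP => bx.
have [x1'|x1'] := leP x 1.
  have [|s] := @poly_ivt R (- coef_b p) x 1 x1'.
    by rewrite !hornerN; apply/andP; split; lra.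
  move=> /andP[s1 s2]; rewrite rootN => /rootP bs.
  have : b s != 0 by apply: noroot; apply/andP; split; lra.
  by rewrite bs eqxx.
have [|s] := @poly_ivt R (coef_b p) 1 x (ltW x1'); first by rewrite bx ltW.
move=> /andP[s1 s2] /rootP bs.
have : b s != 0 by apply: noroot; apply/andP; split; lra.
by rewrite bs eqxx.
Qed.

(** There [b] is negative, while [a] and [c] are positive. *)
Lemma positive_ordinate x y : x2 <= x <= x3 -> a x * y ^+ 2 + b x * y + c x = 0 -> 0 < y.
Proof.
move=> xI e; have bx := positive_branchP xI; have x0 : 0 < x.
  by have := x2_gt0; case/andP: xI; lra.
rewrite ltNge; apply/negP => y0.
have : 0 <= a x * y ^+ 2 by rewrite mulr_ge0 ?sqr_ge0 // ltW // coef_a_gt0.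
have : 0 <= b x * y by rewrite nmulr_rge0.
by have := coef_c_gt0 x0; lra.
Qed.
End Transitions.

(** * The oval through infinity in affine coordinates *)

Section Inversion.
Context {R : realType}.
Implicit Types (p : int -> int -> R) (D : {poly R}).

Record simple_branch_points D (x1 x2 x3 : R) (x4 : option R) (lc : R) : Prop :=
  SimpleBranchPoints {
    branch_factor : forall x, D.[x] = lc * quartic_factor x1 x2 x3 x4 x;
    branch_lc : lc != 0;
    branch12 : x1 < x2;
    branch23 : x2 < x3;
    branch1N : - x2 <= x1;
    branch1_ge : -1 <= x1;
    branch2_le : x2 <= 1;
    branch4_far : if x4 is Some r then x3 < r \/ r <= - x3 else True;
    branch14 : x4 <> Some x1 }.

(** The equation of the kernel in the coordinates [u = 1 / (x - 1)], [v = 1 / (y - 1)]: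
    they bring the oval that lies over the arc from [x4] to [x1], which may pass through
    infinity, to the affine plane, since the arc never meets the point [1]. *)
Definition inv_coef (f : nat -> R) (j : nat) : R :=
  match j with 0%N => f 2%N | 1%N => f 1%N + 2 * f 2%N | _ => f 0%N + f 1%N + f 2%N end.
Definition step_of (k : nat) : int := match k with 0%N => -1 | 1%N => 0 | _ => 1 end.
Definition kernel_coef p (k l : nat) : R :=
  p (step_of k) (step_of l) - (if (k == 1%N) && (l == 1%N) then 1 else 0).
Definition inv_kernel p (i j : nat) : R :=
  inv_coef (fun k => inv_coef (fun l => kernel_coef p k l) j) i.

Definition transpose p : int -> int -> R := fun i j => p j i.

Lemma transpose_prob p : transition_probabilities p -> transition_probabilities (transpose p).
Proof.
move=> pp; split=> [i j hi hj|]; first by case: pp => h _; exact: h.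
by rewrite -(prob_sum pp) /steps !big_cons !big_nil /transpose; ring.
Qed.

Lemma quad_v_inv p u : u != 0 -> let x := 1 + u^-1 in
  [/\ quad_v (inv_kernel p) u 0 = u ^+ 2 * (coef_a p).[x],
      quad_v (inv_kernel p) u 1 = u ^+ 2 * (2 * (coef_a p).[x] + (coef_b p).[x]) &
      quad_v (inv_kernel p) u 2 =
        u ^+ 2 * ((coef_a p).[x] + (coef_b p).[x] + (coef_c p).[x])].
Proof.
move=> u0; rewrite /= coef_aE coef_bE coef_cE.
by rewrite /quad_v /inv_kernel /inv_coef /kernel_coef /=; split; field.
Qed.

Lemma quad_u_inv p v : v != 0 -> let y := 1 + v^-1 in
  [/\ quad_u (inv_kernel p) v 0 = v ^+ 2 * (coef_at p).[y],
      quad_u (inv_kernel p) v 1 = v ^+ 2 * (2 * (coef_at p).[y] + (coef_bt p).[y]) &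
      quad_u (inv_kernel p) v 2 =
        v ^+ 2 * ((coef_at p).[y] + (coef_bt p).[y] + (coef_ct p).[y])].
Proof.
move=> v0; have := quad_v_inv (transpose p) v0; rewrite /=.
rewrite -[coef_a _]/(coef_at p) -[coef_b _]/(coef_bt p) -[coef_c _]/(coef_ct p).
move=> [<- <- <-].
by rewrite /quad_u /quad_v /inv_kernel /inv_coef /kernel_coef /transpose /=; split; ring.
Qed.

Lemma biquad_sym q (u v : R) :
  biquad q u v = quad_u q v 2 * (u * u) + quad_u q v 1 * u + quad_u q v 0.
Proof. by rewrite /biquad /quad_u /quad_v; ring. Qed.

Lemma biquad_inv p u v : u != 0 -> v != 0 -> let x := 1 + u^-1 in let y := 1 + v^-1 in
  biquad (inv_kernel p) u v = u ^+ 2 * v ^+ 2 *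
    ((coef_a p).[x] * y ^+ 2 + (coef_b p).[x] * y + (coef_c p).[x]).
Proof.
move=> u0 v0 /=; have [q0 q1 q2] := quad_v_inv p u0.
by rewrite /biquad q0 q1 q2; field.
Qed.

Lemma coef_swap p x y : (coef_a p).[x] * y ^+ 2 + (coef_b p).[x] * y + (coef_c p).[x] =
  (coef_at p).[y] * x ^+ 2 + (coef_bt p).[y] * x + (coef_ct p).[y].
Proof.
rewrite -[coef_at p]/(coef_a (transpose p)) -[coef_bt p]/(coef_b (transpose p)).
rewrite -[coef_ct p]/(coef_c (transpose p)).
by rewrite !coef_aE !coef_bE !coef_cE /transpose; ring.
Qed.

(** Vieta's formulas for [a y ^ 2 + b y + c], written in the coordinate [v = 1 / (y - 1)]. *)
Lemma vieta_inv (a b c v v' : R) : v != 0 -> v' != 0 -> a + b + c != 0 ->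
  (a + b + c) * (v * v) + (2 * a + b) * v + a = 0 ->
  (a + b + c) * (v + v') = - (2 * a + b) ->
  (1 + v^-1) * (1 + v'^-1) * a = c.
Proof.
move=> v0 v'0 S0 e1 e2.
have P : (a + b + c) * (v * v') = a.
  transitivity ((a + b + c) * (v + v') * v - (a + b + c) * (v * v)); first by ring.
  by rewrite e2; apply/eqP; rewrite subr_eq -subr_eq0 -oppr_eq0 -e1; apply/eqP; ring.
apply: (mulfI S0); apply: (mulfI (mulf_neq0 v0 v'0)).
transitivity (((a + b + c) * (v * v') + (a + b + c) * (v + v') + (a + b + c)) * a).
  by field; rewrite v0 v'0.
rewrite e2 {1}P; transitivity (c * ((a + b + c) * (v * v'))); last by ring.
by rewrite P; ring.
Qed.

Lemma disc_v_inv p u : u != 0 -> disc_v (inv_kernel p) u = u ^+ 4 * (disc p).[1 + u^-1].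
Proof.
move=> u0; have [q0 q1 q2] := quad_v_inv p u0.
by rewrite /disc_v q0 q1 q2 discE; ring.
Qed.

Lemma disc_v_inv0 p : disc_v (inv_kernel p) 0 = p 1 0 ^+ 2 - 4 * p 1 1 * p 1 (-1).
Proof.
by rewrite /disc_v /quad_v /inv_kernel /inv_coef /kernel_coef /=; ring.
Qed.

Section Branches.
Variables (p : int -> int -> R) (x1 x2 x3 : R) (x4 : option R) (lc : R).
Hypothesis p_prob : transition_probabilities p.
Hypotheses (a_neq0 : coef_a p != 0) (c_neq0 : coef_c p != 0).
Hypotheses (at_neq0 : coef_at p != 0) (ct_neq0 : coef_ct p != 0).
Hypothesis br : simple_branch_points (disc p) x1 x2 x3 x4 lc.

Definition arc_left : R := (x1 - 1)^-1.
Definition arc_right : R := if x4 is Some r then (r - 1)^-1 else 0.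

Lemma branch_signs : 1 <= x3 /\ 0 < lead1 x4 lc.
Proof.
case: br => f l e12 e23 e1N e1 e2 far _.
exact: (disc_signs p_prob a_neq0 c_neq0 f l e12 e23 e1N e1 e2 far).
Qed.

Lemma branch_positive x : 0 < x -> (coef_b p).[x] < 0 -> 0 <= (disc p).[x] -> x2 <= x <= x3.
Proof.
case: br => f l e12 e23 e1N e1 e2 far _.
exact: (positive_branch p_prob a_neq0 c_neq0 f l e12 e23 e1N e1 e2 far).
Qed.

Lemma branch_gt0 x : x2 < x < x3 -> 0 < (disc p).[x].
Proof.
case: br => f l e12 e23 e1N e1 e2 far _.
exact: (disc_gt0 p_prob a_neq0 c_neq0 f l e12 e23 e1N e1 e2 far).
Qed.

Lemma branch_lt0 x : x1 < x < x2 -> (disc p).[x] < 0.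
Proof.
case: br => f l e12 e23 e1N e1 e2 far _.
exact: (disc_lt0 p_prob a_neq0 c_neq0 f l e12 e23 e1N e1 e2 far).
Qed.

Lemma branch_ordinate x y : x2 <= x <= x3 ->
  (coef_a p).[x] * y ^+ 2 + (coef_b p).[x] * y + (coef_c p).[x] = 0 -> 0 < y.
Proof.
case: br => f l e12 e23 e1N e1 e2 far _.
exact: (positive_ordinate p_prob a_neq0 c_neq0 f l e12 e23 e1N e1 e2 far).
Qed.

Lemma x1_lt1 : x1 < 1. Proof. by case: br; lra. Qed.

Lemma arc_left_lt0 : arc_left < 0.
Proof. by rewrite invr_lt0 subr_lt0 x1_lt1. Qed.

Lemma arc_lt : arc_left < arc_right.
Proof.
have x1l := x1_lt1; have [x31 _] := branch_signs; have al := arc_left_lt0.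
case: br => _ _ _ _ _ x1g _; rewrite /arc_right; case: (x4) => // r [rx|rx] n.
  by apply: lt_trans al _; rewrite invr_gt0; lra.
have rx1 : r < x1.
  by rewrite lt_neqAle; apply/andP; split; [apply: contra_not_neq n => ->|lra].
by rewrite ltf_nV2 ?negrE; lra.
Qed.

Definition arc_disc : {poly R} :=
  (lead1 x4 lc * (1 - x1))%:P * (1 + (1 - x2)%:P * 'X) * (1 - (x3 - 1)%:P * 'X).

Lemma arc_discE u : arc_disc.[u] =
  lead1 x4 lc * (1 - x1) * (1 + (1 - x2) * u) * (1 - (x3 - 1) * u).
Proof. by rewrite /arc_disc !hornerE. Qed.

Lemma arc_factors u : arc_left <= u <= arc_right ->
  0 < 1 + (1 - x2) * u /\ 0 < 1 - (x3 - 1) * u.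
Proof.
move=> /andP[ul ur]; have x1l := x1_lt1; have [x31 _] := branch_signs.
case: br => _ _ e12 e23 _ _ e2 far _; split.
  have k : 1 + (1 - x1) * u >= 0.
    rewrite -(ler_pM2l (_ : 0 < (1 - x1)^-1)) ?invr_gt0 ?subr_gt0 // mulr0 mulrDr mulKf; last lra.
    by move: ul; rewrite /arc_left -[x1 - 1]opprB invrN mulr1; lra.
  have [u0|u0] := leP 0 u; first by apply: ltr_wpDr => //; rewrite mulr_ge0 //; lra.
  have : 0 < (x1 - x2) * u by rewrite nmulr_rgt0 //; lra.
  lra.
have [u0|u0] := leP u 0.
  have : (x3 - 1) * u <= 0 by rewrite mulr_ge0_le0 //; lra.
  lra.
move: ur far; rewrite /arc_right; case: (x4) => [r|]; last by lra.
move=> ur [far|far]; last first.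
  have : (r - 1)^-1 < 0 by rewrite invr_lt0; lra.
  lra.
have r1 : 0 < r - 1 by lra.
have : (r - 1) * u <= 1.
  by rewrite mulrC -ler_pdivlMr // mul1r.
have : 0 < (r - x3) * u by rewrite mulr_gt0 //; lra.
lra.
Qed.

Lemma arc_disc_gt0 u : arc_left <= u <= arc_right -> 0 < arc_disc.[u].
Proof.
move=> /arc_factors[h1 h2]; have [_ l1] := branch_signs; have x1l := x1_lt1.
have k1 : 0 < 1 - x1 by lra.
by rewrite arc_discE; apply: mulr_gt0 => //; apply: mulr_gt0 => //; apply: mulr_gt0.
Qed.

Lemma disc_v_arc u :
  disc_v (inv_kernel p) u = (u - arc_left) * (arc_right - u) * arc_disc.[u].
Proof.
have x1l := x1_lt1; have x1n : x1 - 1 != 0 by lra.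
have [x31 _] := branch_signs.
rewrite arc_discE /lead1 /arc_left /arc_right.
case: (br) => DF l0 e12 e23 _ _ e2 far _.
have [->|u0] := eqVneq u 0.
  rewrite disc_v_inv0 -(disc_lead_coef DF).
  case: (x4) far => [r|] far; last by rewrite mulr0; field.
  by field; rewrite x1n /=; case: far; lra.
rewrite disc_v_inv // DF /quartic_factor.
case: (x4) far => [r|] far; last by field; rewrite ?u0 ?x1n.
have rn : r - 1 != 0 by case: far; lra.
by field; rewrite ?u0 ?x1n ?rn.
Qed.

Lemma sum_coef1 : (coef_at p).[1] + (coef_bt p).[1] + (coef_ct p).[1] = 0.
Proof.
have := coef_b1 (transpose_prob p_prob); rewrite -[coef_b _]/(coef_bt p) => ->.
rewrite -[coef_at p]/(coef_a (transpose p)) -[coef_ct p]/(coef_c (transpose p)); lra.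
Qed.

Lemma quad_v2 u : quad_v (inv_kernel p) u 2 =
  (coef_at p).[1] + ((coef_at p).[1] - (coef_ct p).[1]) * u.
Proof.
have := sum_coef1.
rewrite -[coef_at p]/(coef_a (transpose p)) -[coef_bt p]/(coef_b (transpose p)).
rewrite -[coef_ct p]/(coef_c (transpose p)).
rewrite !coef_aE !coef_bE !coef_cE /transpose.
rewrite /quad_v /inv_kernel /inv_coef /kernel_coef /= !expr1n !mulr1 => s.
transitivity (((p 1 1 + p 1 0 + p 1 (-1)) + (p 0 1 + (p 0 0 - 1) + p 0 (-1)) +
  (p (-1) 1 + p (-1) 0 + p (-1) (-1))) * (u * u + u) +
 (p 1 1 + p 1 0 + p 1 (-1)) + ((p 1 1 + p 1 0 + p 1 (-1)) - (p (-1) 1 + p (-1) 0 + p (-1) (-1))) * u).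
  by ring.
by rewrite s; ring.
Qed.

(** The oval does not meet the line [y = 1]: the other point of the curve on that line has a
    positive abscissa, hence belongs to the other oval. *)
Lemma quad_v2_neq0 u : arc_left <= u <= arc_right -> quad_v (inv_kernel p) u 2 != 0.
Proof.
move=> uI; have [h2 h3] := arc_factors uI; apply/eqP => q2.
have a0 := coef_a_gt0 (transpose_prob p_prob) at_neq0 ltr01.
have c0 := coef_c_gt0 (transpose_prob p_prob) ct_neq0 ltr01.
rewrite -[coef_a _]/(coef_at p) in a0; rewrite -[coef_c _]/(coef_ct p) in c0.
have u0 : u != 0.
  by apply/eqP => u0; move: q2; rewrite quad_v2 u0 mulr0 addr0; lra.
have [_ _ Q2] := quad_v_inv p u0.
move: (q2); rewrite Q2 => /eqP; rewrite mulf_eq0 sqrf_eq0 (negPf u0) /= => /eqP s0.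
have x0 : 0 < 1 + u^-1.
  rewrite -(pmulr_rgt0 _ a0).
  suff -> : (coef_at p).[1] * (1 + u^-1) = (coef_ct p).[1] by [].
  apply: (mulfI u0); apply/eqP; rewrite -subr_eq0 -q2 quad_v2; apply/eqP; field.
  exact: u0.
have ax := coef_a_gt0 p_prob a_neq0 x0; have cx := coef_c_gt0 p_prob c_neq0 x0.
have /andP[] : x2 <= 1 + u^-1 <= x3.
  apply: branch_positive => //; first by lra.
  rewrite discE; have -> : (coef_b p).[1 + u^-1] = - ((coef_a p).[1 + u^-1] + (coef_c p).[1 + u^-1]).
    by lra.
  by have := sqr_ge0 ((coef_a p).[1 + u^-1] - (coef_c p).[1 + u^-1]); lra.
have k2 : 1 + (1 - x2) * u = u * (1 + u^-1 - x2) by field.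
have k3 : 1 - (x3 - 1) * u = u * (1 + u^-1 - x3) by field.
rewrite k2 in h2; rewrite k3 in h3 => i2 i3.
have [un|un] := ltP u 0.
  by move: h2; rewrite nmulr_rgt0 //; lra.
have up : 0 < u by rewrite lt0r u0.
by move: h3; rewrite pmulr_rgt0 //; lra.
Qed.

Theorem walk_oval : exists U V G, oval_flow (inv_kernel p) arc_left arc_right U V G.
Proof.
exact: (oval_flow_exists arc_lt arc_disc_gt0 quad_v2_neq0 disc_v_arc).
Qed.
End Branches.

Lemma walk_kernel_atE p y : walk_kernel_at p y =
  - ((coef_at p).[y]%:P * 'X^2 + (coef_bt p).[y]%:P * 'X + (coef_ct p).[y]%:P).
Proof.
rewrite /walk_kernel_at /walk_kernel /steps !big_cons !big_nil /=.
rewrite !(rmorphB, rmorphD, rmorphM, rmorphXn, rmorph0) /= !map_polyX !map_polyC /=.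
rewrite !horner_evalE !hornerC !hornerX.
rewrite -[coef_at p]/(coef_a (transpose p)) -[coef_bt p]/(coef_b (transpose p)).
rewrite -[coef_ct p]/(coef_c (transpose p)) coef_aE coef_bE coef_cE /transpose.
rewrite !(polyCD, polyCM, polyCN, polyC_exp, polyC1).
by ring.
Qed.

Lemma double_root (a b c : R) (s : option R) :
  roots_in_degree 2 (- (a%:P * 'X^2 + b%:P * 'X + c%:P)) [:: s; s] ->
  if s is Some r then [/\ a != 0, b = - (2 * a * r) & c = a * r ^+ 2]
  else [/\ a = 0, b = 0 & c != 0].
Proof.
case=> _ /eqpP[[k1 k2] /= /andP[k10 k20] e].
have co i : k1 * - (a * (i == 2)%:R + b * (i == 1)%:R + c * (i == 0)%:R) =
    k2 * (\prod_(r <- pmap id [:: s; s]) ('X - r%:P))`_i.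
  by rewrite -!coefZ -e !(coefZ, coefN, coefD, coefCM, coefXn, coefX, coefC);
     case: i => [|i]; rewrite /= ?(mulr1, mulr0).
have := co 2; have := co 1; have := co 0.
case: s e co => [r|] e _ /=; last first.
  rewrite big_nil !coefC /= !(mulr0, mulr1, add0r, addr0, mulrN).
  move=> c0 /eqP; rewrite oppr_eq0 mulf_eq0 (negPf k10) /= => /eqP ->.
  move=> /eqP; rewrite oppr_eq0 mulf_eq0 (negPf k10) /= => /eqP ->; split=> //.
  by apply: contra_eq_neq c0 => ->; rewrite mulr0 oppr0 eq_sym.
have -> : \prod_(i <- [:: r; r]) ('X - i%:P) = 'X^2 - (2 * r)%:P * 'X + (r ^+ 2)%:P :> {poly R}.
  by rewrite !big_cons big_nil mulr1 polyCM polyC_exp; ring.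
rewrite !(coefD, coefN, coefCM, coefXn, coefX, coefC) /=.
rewrite !(mulr0, mulr1, add0r, addr0, subr0, oppr0, mulrN).
move=> c0 b0 a0; have aE : a = - (k2 / k1).
  by apply: (mulfI k10); rewrite mulrN mulrCA divff // mulr1 -a0 opprK.
rewrite aE; split; first by rewrite oppr_eq0 mulf_neq0 // invr_neq0.
  by apply: (mulfI k10); rewrite -[LHS]opprK b0; field.
by apply: (mulfI k10); rewrite -[LHS]opprK c0; field.
Qed.

Section Critical.
Variables (p : int -> int -> R) (x1 x2 x3 : R) (x4 : option R) (lc : R).
Variables (y1 y2 y3 : R) (y4 : option R) (lc' : R).
Hypothesis p_prob : transition_probabilities p.
Hypotheses (a_neq0 : coef_a p != 0) (c_neq0 : coef_c p != 0).
Hypotheses (at_neq0 : coef_at p != 0) (ct_neq0 : coef_ct p != 0).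
Hypothesis brx : simple_branch_points (disc p) x1 x2 x3 x4 lc.
Hypothesis bry : simple_branch_points (disct p) y1 y2 y3 y4 lc'.
Variable s : option R.
Hypothesis sP : roots_in_degree 2 (walk_kernel_at p y1) [:: s; s].

(** The double point over the branch point [y1] does not belong to the positive oval, on
    which [y >= y2]; hence it belongs to the other one. *)
Lemma critical_outside : if s is Some r then ~ (x2 <= r <= x3) else True.
Proof.
have := double_root (eq_ind _ (fun q => roots_in_degree 2 q _) sP _ (walk_kernel_atE p y1)).
case: s => // r [a0 bE cE] rI.
have r0 : 0 < r.
  have := branch1N brx; have := branch12 brx; case/andP: rI; lra.
have y0 : 0 < y1.
  apply: (branch_ordinate p_prob a_neq0 c_neq0 brx rI); rewrite coef_swap bE cE; ring.
have pT := transpose_prob p_prob.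
have aT := coef_a_gt0 pT at_neq0 y0; rewrite -[coef_a _]/(coef_at p) in aT.
have /andP[] : y2 <= y1 <= y3.
  apply: (branch_positive pT at_neq0 ct_neq0 bry) => //.
    by rewrite -[coef_b _]/(coef_bt p) bE oppr_lt0 !mulr_gt0.
  by rewrite -[disc _]/(disct p) (branch_factor bry) /quartic_factor subrr !(mul0r, mulr0).
by have := branch12 bry; lra.
Qed.

Definition critical_u : R := if s is Some r then (r - 1)^-1 else 0.
Definition critical_v : R := (y1 - 1)^-1.

Lemma critical_neq1 : if s is Some r then r != 1 else true.
Proof.
have := critical_outside; case: s => // r; apply: contra_not_neq => ->.
by have [-> _] := branch_signs p_prob a_neq0 c_neq0 brx; rewrite (branch2_le brx).
Qed.

(** At a point of the curve the discriminant is a square, hence nonnegative. Outside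
    [[x2, x3]] its cofactor is positive, so [(u - e1) (e4 - u)] is nonnegative as well. *)
Lemma critical_point : [/\ arc_left x1 <= critical_u <= arc_right x4,
  biquad (inv_kernel p) critical_u critical_v = 0 &
  2 * quad_u (inv_kernel p) critical_v 2 * critical_u + quad_u (inv_kernel p) critical_v 1 = 0].
Proof.
have y1l := x1_lt1 (p := transpose p) bry; have y1n : y1 - 1 != 0 by lra.
have v0 : critical_v != 0 by rewrite invr_neq0.
have := double_root (eq_ind _ (fun q => roots_in_degree 2 q _) sP _ (walk_kernel_atE p y1)).
have [q0 q1 q2] := quad_u_inv p v0.
have yE : 1 + critical_v^-1 = y1 by rewrite /critical_v invrK; ring.
rewrite yE in q0 q1 q2.
have out := critical_outside; have neq1 := critical_neq1 => roots.
have cur : biquad (inv_kernel p) critical_u critical_v = 0.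
  rewrite biquad_sym q0 q1 q2 /critical_u; case: s roots neq1 => [r|] [h1 h2 h3] neq1.
    by rewrite h2 h3; field; rewrite subr_eq0.
  by rewrite h1 h2; ring.
have crit : 2 * quad_u (inv_kernel p) critical_v 2 * critical_u +
    quad_u (inv_kernel p) critical_v 1 = 0.
  rewrite q1 q2 /critical_u; case: s roots neq1 => [r|] [h1 h2 h3] neq1.
    by rewrite h2 h3; field; rewrite subr_eq0.
  by rewrite h1 h2; ring.
split=> //.
have D0 : 0 <= disc_v (inv_kernel p) critical_u.
  have -> : disc_v (inv_kernel p) critical_u =
    (2 * quad_v (inv_kernel p) critical_u 2 * critical_v + quad_v (inv_kernel p) critical_u 1) ^+ 2
    - 4 * quad_v (inv_kernel p) critical_u 2 * biquad (inv_kernel p) critical_u critical_v.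
    by rewrite /disc_v /biquad; ring.
  by rewrite cur mulr0 subr0 sqr_ge0.
have [x31 l1] := branch_signs p_prob a_neq0 c_neq0 brx.
have E0 : 0 < (arc_disc x1 x2 x3 x4 lc).[critical_u].
  have x1l := x1_lt1 brx; have e23 := branch23 brx.
  rewrite arc_discE /critical_u; case: s out neq1 => [r|] out neq1; last first.
    by rewrite !mulr0 addr0 subr0 !mulr1 mulr_gt0 // subr_gt0.
  have r1 : r - 1 != 0 by rewrite subr_eq0.
  have -> : lead1 x4 lc * (1 - x1) * (1 + (1 - x2) * (r - 1)^-1) * (1 - (x3 - 1) * (r - 1)^-1) =
     lead1 x4 lc * ((1 - x1) * ((r - 1)^-1 ^+ 2 * ((x2 - r) * (x3 - r)))) by field.
  have k1 : 0 < 1 - x1 by lra.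
  have k2 : 0 < (r - 1)^-1 ^+ 2 by rewrite exprn_even_gt0 //= invr_neq0.
  rewrite mulr_gt0 // mulr_gt0 // mulr_gt0 //.
  have [h|h] := ltP r x2; first by rewrite mulr_gt0; lra.
  have [h'|h'] := leP r x3; first by case: out; rewrite h.
  by rewrite nmulr_rgt0; lra.
move: D0; rewrite (disc_v_arc p_prob a_neq0 c_neq0 brx) pmulr_lge0 // => D0.
have e14 := arc_lt p_prob a_neq0 c_neq0 brx.
apply/andP; split; rewrite leNgt; apply/negP => h; move: D0.
  by rewrite nmulr_rge0; lra.
by rewrite pmulr_rge0; lra.
Qed.
End Critical.
End Inversion.

(** * Rational function fields have genus 0 *)

Section RationalFunctionField.
Context {C : closedFieldType} {K : fieldType}.
Variable iota : {rmorphism C -> K}.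
Implicit Types (P : {poly C}) (t f g : K) (v : K -> int).

Definition ev t P : K := (map_poly iota P).[t].

Lemma evM t P1 P2 : ev t (P1 * P2) = ev t P1 * ev t P2.
Proof. by rewrite /ev rmorphM hornerM. Qed.
Lemma evD t P1 P2 : ev t (P1 + P2) = ev t P1 + ev t P2.
Proof. by rewrite /ev rmorphD hornerD. Qed.
Lemma evN t P : ev t (- P) = - ev t P.
Proof. by rewrite /ev rmorphN hornerN. Qed.
Lemma evC t c : ev t c%:P = iota c.
Proof. by rewrite /ev map_polyC hornerC. Qed.
Lemma evX t : ev t 'X = t.
Proof. by rewrite /ev map_polyX hornerX. Qed.

(** Membership in the subfield [C(t)]. *)
Definition ratf t f : Prop := exists P1 P2, ev t P2 != 0 /\ f = ev t P1 / ev t P2.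

Lemma ratf_poly t P : ratf t (ev t P).
Proof. by exists P, 1; rewrite -[1]/(1%:P) evC rmorph1 oner_neq0 divr1. Qed.
Lemma ratf_const t c : ratf t (iota c).
Proof. by rewrite -(evC t); exact: ratf_poly. Qed.
Lemma ratf_id t : ratf t t.
Proof. by rewrite -{2}(evX t); exact: ratf_poly. Qed.
Lemma ratfD t f g : ratf t f -> ratf t g -> ratf t (f + g).
Proof.
move=> [P1 [P2 [h ->]]] [R1 [R2 [k ->]]]; exists (P1 * R2 + R1 * P2), (P2 * R2).
by rewrite !(evM, evD) mulf_neq0 //; split=> //; field; rewrite h k.
Qed.
Lemma ratfM t f g : ratf t f -> ratf t g -> ratf t (f * g).
Proof.
move=> [P1 [P2 [h ->]]] [R1 [R2 [k ->]]]; exists (P1 * R1), (P2 * R2).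
by rewrite !(evM, evD) mulf_neq0 //; split=> //; field; rewrite h k.
Qed.
Lemma ratfN t f : ratf t f -> ratf t (- f).
Proof. by move=> [P1 [P2 [h ->]]]; exists (- P1), P2; rewrite evN mulNr. Qed.
Lemma ratfV t f : ratf t f -> ratf t f^-1.
Proof.
move=> [P1 [P2 [h ->]]]; have [e|k] := eqVneq (ev t P1) 0.
  by rewrite e mul0r invr0 -(rmorph0 iota); exact: ratf_const.
by exists P2, P1; rewrite invf_div.
Qed.
Lemma ratfX t f n : ratf t f -> ratf t (f ^+ n).
Proof.
move=> h; elim: n => [|n IHn]; first by rewrite expr0 -(rmorph1 iota); exact: ratf_const.
by rewrite exprS; exact: ratfM.
Qed.
Lemma ratf_sum t (I : Type) (r : seq I) (F : I -> K) :
  (forall i, ratf t (F i)) -> ratf t (\sum_(i <- r) F i).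
Proof.
move=> h; apply: (big_ind (ratf t)) => [|f g|i _]; [|exact: ratfD|exact: h].
by rewrite -(rmorph0 iota); exact: ratf_const.
Qed.
Lemma ratf_ev t x P : ratf t x -> ratf t (ev x P).
Proof.
move=> h; rewrite /ev horner_coef; apply: ratf_sum => i; rewrite coef_map.
by apply: ratfM; [exact: ratf_const|exact: ratfX].
Qed.

Lemma ratf_eval2 t x y (P : {poly {poly C}}) :
  ratf t x -> ratf t y -> ratf t (eval2 iota P x y).
Proof.
move=> hx hy; rewrite /eval2 (horner_coef (map_poly _ P)) horner_sum.
apply: ratf_sum => i; rewrite hornerM -polyC_exp hornerC coef_map.
by apply: ratfM; [exact: (ratf_ev _ hy)|exact: ratfX].
Qed.

Definition transcendental t := forall P, ev t P = 0 -> P = 0.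

Lemma transcendental_const t : transcendental t -> forall c, t - iota c != 0.
Proof.
move=> h c; apply/eqP => e; have : ev t ('X - c%:P) = 0 by rewrite evD evN evX evC.
by move/h/eqP; rewrite polyXsubC_eq0.
Qed.

Lemma ev_factor t P (r : seq C) :
  P = lead_coef P *: \prod_(z <- r) ('X - z%:P) ->
  ev t P = iota (lead_coef P) * \prod_(z <- r) (t - iota z).
Proof.
move=> e; rewrite {1}e -mul_polyC evM evC; congr (_ * _).
elim: r {e} => [|z r IHr]; first by rewrite !big_nil -[1]/(1%:P) evC rmorph1.
by rewrite !big_cons evM IHr evD evN evX evC.
Qed.

Lemma not_const_transcendental t : (forall c, t <> iota c) -> transcendental t.
Proof.
move=> h P; have [r e] := closed_field_poly_normal P.
rewrite (ev_factor t e) => /eqP; rewrite mulf_eq0 fmorph_eq0 lead_coef_eq0.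
case/orP=> [/eqP //|]; elim: r {e} => [|z r IHr]; first by rewrite big_nil oner_eq0.
rewrite big_cons mulf_eq0 subr_eq0 => /orP[/eqP|//]; first by move/h.
Qed.

(** Valuations are determined by their values on the elements [t - c]. *)
Section Places.
Variable t : K.
Hypothesis t_trans : transcendental t.
Hypothesis t_gen : forall f, ratf t f.

Lemma place1 v : place iota v -> v 1 = 0.
Proof. by case=> _ _ _ h _; rewrite -(rmorph1 iota) h. Qed.

Lemma placeM v : place iota v -> {in predC1 0 &, {morph v : f g / f * g >-> f + g}}.
Proof. by case=> _ h _ _ _ f g f0 g0; apply: h. Qed.

Lemma placeV v f : place iota v -> f != 0 -> v f^-1 = - v f.
Proof.
move=> vP f0; have := placeM vP f0 (_ : f^-1 \in predC1 0).
rewrite divff // (place1 vP) => /(_ _)/esym/eqP; rewrite addr_eq0 => e.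
by apply/eqP; rewrite -eqr_oppLR eq_sym e // inE invr_neq0.
Qed.

Lemma placeX v f n : place iota v -> f != 0 -> v (f ^+ n) = v f *+ n.
Proof.
move=> vP f0; elim: n => [|n IHn]; first by rewrite expr0 mulr0n (place1 vP).
by rewrite exprS mulrS (placeM vP) ?IHn // inE expf_neq0.
Qed.

Lemma placeXz v f (n : int) : place iota v -> f != 0 -> v (f ^ n) = n * v f.
Proof.
move=> vP f0; case: n => n.
  by rewrite -exprnP (placeX _ vP f0) -mulr_natl natz.
by rewrite NegzE -exprnN (placeV vP) ?expf_neq0 // (placeX _ vP f0) mulNr -mulr_natl natz.
Qed.

Lemma place_prod v (I : eqType) (r : seq I) (F : I -> K) :
  place iota v -> (forall i, F i != 0) ->
  v (\prod_(i <- r) F i) = \sum_(i <- r) v (F i).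
Proof.
move=> vP F0; elim: r => [|i r IHr]; first by rewrite !big_nil (place1 vP).
rewrite !big_cons (placeM vP) ?IHr // ?inE ?F0 //.
by rewrite prodf_seq_neq0; apply/allP => j _; rewrite F0.
Qed.

Lemma place_ev v P (r : seq C) : place iota v -> P != 0 ->
  P = lead_coef P *: \prod_(z <- r) ('X - z%:P) ->
  v (ev t P) = \sum_(z <- r) v (t - iota z).
Proof.
move=> vP P0 e; have nz := transcendental_const t_trans.
rewrite (ev_factor t e) (placeM vP) ?place_prod //.
- by case: vP => _ _ _ -> _; rewrite add0r.
- by rewrite inE fmorph_eq0 lead_coef_eq0.
- by rewrite inE prodf_seq_neq0; apply/allP => j _; rewrite nz.
Qed.

Lemma ev_neq0 P : P != 0 -> ev t P != 0.
Proof. by apply: contraNneq => /t_trans ->. Qed.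

Lemma place_eq v v' : place iota v -> place iota v' ->
  (forall c, v (t - iota c) = v' (t - iota c)) -> v = v'.
Proof.
move=> vP v'P e; apply/funext => f; have [->|f0] := eqVneq f 0.
  by case: vP => -> *; case: v'P => ->.
have [P1 [P2 [h fE]]] := t_gen f.
have P20 : P2 != 0 by apply: contraNneq h => ->; rewrite -[0]/(0%:P) evC rmorph0.
have P10 : P1 != 0.
  by apply: contraNneq f0 => P10; rewrite fE P10 -[0]/(0%:P) evC rmorph0 mul0r.
have [r1 e1] := closed_field_poly_normal P1; have [r2 e2] := closed_field_poly_normal P2.
have val w : place iota w -> w f = \sum_(z <- r1) w (t - iota z) - \sum_(z <- r2) w (t - iota z).
  move=> wP; rewrite fE (placeM wP) ?inE ?invr_neq0 ?ev_neq0 // (placeV wP) ?ev_neq0 //.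
  by rewrite (place_ev wP P10 e1) (place_ev wP P20 e2).
by rewrite !val //; congr (_ - _); apply: eq_bigr.
Qed.

Lemma place_dvd v (e : int) : place iota v ->
  (forall c, (e %| v (t - iota c)%R)%Z) -> forall f, f != 0 -> (e %| v f)%Z.
Proof.
move=> vP ve f f0.
have [P1 [P2 [h fE]]] := t_gen f.
have P20 : P2 != 0 by apply: contraNneq h => ->; rewrite -[0]/(0%:P) evC rmorph0.
have P10 : P1 != 0.
  by apply: contraNneq f0 => P10; rewrite fE P10 -[0]/(0%:P) evC rmorph0 mul0r.
have [r1 e1] := closed_field_poly_normal P1; have [r2 e2] := closed_field_poly_normal P2.
have dv r : (e %| \sum_(z <- r) v (t - iota z)%R)%Z.
  by apply: (big_ind (fun n => (e %| n)%Z)) => // *; exact: rpredD.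
rewrite fE (placeM vP) ?inE ?invr_neq0 ?ev_neq0 // (placeV vP) ?ev_neq0 //.
by rewrite (place_ev vP P10 e1) (place_ev vP P20 e2) rpredB.
Qed.

(** The places of [C(t)]: the pole of [t] and the zeros of the [t - c]. *)
Lemma place_cases v : place iota v ->
  (forall c, v (t - iota c) = -1) \/ (exists c0, forall c, v (t - iota c) = (c == c0)%:Z).
Proof.
move=> vP; have nz := transcendental_const t_trans.
case: (vP) => v0 vM vD vC [w w0 w1].
have shift c c' : Num.min (v (t - iota c)) 0 <= v (t - iota c').
  have [->|cc] := eqVneq c' c; first by rewrite ge_min lexx.
  have k : iota (c - c') != 0 by rewrite fmorph_eq0 subr_eq0 eq_sym.
  have e : t - iota c' = t - iota c + iota (c - c') by rewrite rmorphB; ring.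
  by rewrite e -(vC (c - c')) vD // -e.
have unit_e (e : int) : (forall c, (e %| v (t - iota c)%R)%Z) -> e = 1 \/ e = -1.
  by move=> h; have := place_dvd vP h w0; rewrite w1 dvdz1; lia.
have [[c0 neg]|nneg] := pselect (exists c0, v (t - iota c0) < 0).
  left; have same c : v (t - iota c) = v (t - iota c0).
    have := shift c0 c; have := shift c c0; rewrite !minEle.
    by case: ifP; case: ifP; lia.
  have [c|e|e] := unit_e (v (t - iota c0)); first by rewrite same dvdzz.
    by move: neg; rewrite e.
  by move=> c; rewrite same.
right; have ge0 c : 0 <= v (t - iota c).
  by rewrite leNgt; apply/negP => h; apply: nneg; exists c.
have [[c0 pos]|npos] := pselect (exists c0, 0 < v (t - iota c0)); last first.
  have [c|/eqP//|/eqP//] := unit_e 0.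
  rewrite dvd0z eq_le ge0 andbT leNgt; apply/negP => h; apply: npos; by exists c.
exists c0; have zero c : c != c0 -> v (t - iota c) = 0.
  move=> cc; apply/eqP; rewrite eq_le ge0 andbT.
  have k : iota (c - c0) != 0 by rewrite fmorph_eq0 subr_eq0.
  have e : (t - iota c0) + - (t - iota c) = iota (c - c0) by rewrite rmorphB; ring.
  have vN : v (- (t - iota c)) = v (t - iota c).
    have m1 : (-1 : K) = iota (-1) by rewrite rmorphN rmorph1.
    by rewrite -mulN1r m1 vM ?vC ?add0r // -m1 oppr_eq0 oner_eq0.
  have := vD (t - iota c0) (- (t - iota c)).
  rewrite e vN vC oppr_eq0 => /(_ (nz _) (nz _) k); rewrite minEle.
  by case: ifP; lia.
have [c|e1|e1] := unit_e (v (t - iota c0)).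
- have [->|cc] := eqVneq c c0; first exact: dvdzz.
  by rewrite zero // dvdz0.
- by move=> c; have [->|cc] := eqVneq c c0; [exact: e1|exact: zero].
- by move: pos; rewrite e1.
Qed.
(** A field of genus 0: if [f] has the finite part of the divisor [- A], then the functions
    [f * t ^ i] for [i <= deg A] lie in the Riemann-Roch space of [A]. *)
Lemma riemann_roch_rational (A : (K -> int) -> int) (n : nat) : divisor iota A ->
  deg_divisor iota A = n -> exists f, f != 0 /\
  forall i, (i <= n)%N -> riemann_roch_space iota A (f * t ^+ i).
Proof.
move=> finA degA; have nz := transcendental_const t_trans.
pose S : seq (K -> int) := finmap.enum_fset (fset_set (place iota `&` [set v | A v != 0])).
have SE v : (v \in S) = (v \in place iota `&` [set v | A v != 0]).
  exact: (in_fset_set finA).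
have SP v : v \in S -> place iota v /\ A v != 0 by rewrite SE inE.
have SA v : place iota v -> A v != 0 -> v \in S by move=> vP Av; rewrite SE inE.
have uS : uniq S by exact: finmap.fset_uniq.
have deg : \sum_(v <- S) A v = n%:Z.
  rewrite -degA /deg_divisor (fsbigE S) //.
  - rewrite [RHS]big_mkcond big_seq [RHS]big_seq; apply: eq_bigr => v vS.
    by rewrite mem_set //; case: (SP _ vS).
  - by move=> v; rewrite /= => /SP[].
  - move=> v vP vS; apply/eqP; apply: contraNT vS; exact: SA.
pose infinite v := `[< forall c, v (t - iota c) = -1 >].
pose zero v := xget 0 [set c | v (t - iota c) = 1].
have finE v : place iota v -> ~~ infinite v -> forall c, v (t - iota c) = (c == zero v)%:Z.
  move=> vP /asboolPn vf; have [|[c0 h]] := place_cases vP; first by move/vf.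
  have : v (t - iota (zero v)) = 1.
    by apply: (@xgetPex _ _ [set c | v (t - iota c) = 1]); exists c0 => /=; rewrite h eqxx.
  by rewrite h; have [-> _|_ /eqP] := eqVneq (zero v) c0.
pose F v : K := if infinite v then 1 else (t - iota (zero v)) ^ (- A v).
have F0 v : F v != 0 by rewrite /F; case: ifP => _; rewrite ?oner_neq0 // expfz_neq0.
pose f := \prod_(v <- S) F v.
have f0 : f != 0 by rewrite prodf_seq_neq0; apply/allP => v _; rewrite F0.
exists f; split=> // i i_n; right=> w wP.
have t0 : t != 0 by have := nz 0; rewrite rmorph0 subr0.
have ti0 : t ^+ i != 0 by rewrite expf_neq0.
rewrite (placeM wP) ?inE // (placeX _ wP) // (place_prod _ wP) //.
have vF v : w (F v) = if infinite v then 0 else - A v * w (t - iota (zero v)).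
  by rewrite /F; case: ifP => _; rewrite ?(place1 wP) // (placeXz _ wP).
have [winf|wfin] := boolP (infinite w).
  have wt : w t = -1 by have := asboolW winf 0; rewrite rmorph0 subr0.
  have infE v : v \in S -> infinite v = (v == w).
    move=> vS; apply/idP/eqP => [vinf|-> //]; apply: (place_eq _ wP); first by case: (SP _ vS).
    by move=> c; rewrite (asboolW winf) (asboolW vinf).
  have -> : \sum_(v <- S) w (F v) = n%:Z - A w.
    rewrite -deg; have [wS|wS] := boolP (w \in S).
      rewrite !(bigD1_seq w) //= vF winf add0r addrAC subrr add0r.
      rewrite big_seq_cond [RHS]big_seq_cond; apply: eq_bigr => v /andP[vS vw].
      by rewrite vF infE // (negPf vw) (asboolW winf) mulrN1 opprK.
    have -> : A w = 0 by apply/eqP; apply: contraNT wS; exact: SA.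
    rewrite subr0 big_seq [RHS]big_seq; apply: eq_bigr => v vS.
    have vw : v != w by apply: contraNneq wS => <-.
    by rewrite vF infE // (negPf vw) (asboolW winf) mulrN1 opprK.
  by rewrite wt mulNrn; lia.
have wt : 0 <= w t by have := finE _ wP wfin 0; rewrite rmorph0 subr0 => ->.
suff -> : \sum_(v <- S) w (F v) = - A w by rewrite lerDl mulrn_wge0.
have term v : v \in S -> v != w -> w (F v) = 0.
  move=> vS vw; rewrite vF; case: ifPn => // vfin.
  have vP : place iota v by case: (SP _ vS).
  rewrite finE //; case: eqP => [e|_]; last by rewrite mulr0.
  case/negP: vw; apply/eqP; apply: (place_eq vP wP) => c.
  by rewrite !finE // e.
have [wS|wS] := boolP (w \in S).
  rewrite (bigD1_seq w) //= big_seq_cond big1 ?addr0; last by move=> v /andP[vS vw]; rewrite term.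
  by rewrite vF (negPf wfin) finE // eqxx mulr1.
have -> : A w = 0 by apply/eqP; apply: contraNT wS; exact: SA.
rewrite oppr0 big_seq big1 // => v vS; rewrite term //.
by apply: contraNneq wS => <-.
Qed.

Lemma has_dim_dependent (V : set K) n (g : 'I_n.+1 -> K) : has_dim iota V n ->
  (forall i, V (g i)) -> exists u : 'I_n.+1 -> C, (exists i, u i != 0) /\
  \sum_i iota (u i) * g i = 0.
Proof.
move=> [e [eV spn]] gV.
have /choice[c cP] : forall i, exists c : {ffun 'I_n -> C}, g i = \sum_(j < n) iota (c j) * e j.
  by move=> i; have [c [cE _]] := spn _ (gV i); exists c.
pose M := \matrix_(i < n.+1, j < n) c i j.
have : kermx M != 0.
  rewrite -mxrank_eq0 mxrank_ker -lt0n subn_gt0.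
  exact: leq_ltn_trans (rank_leq_col M) _.
case/rowV0Pn => u; rewrite sub_kermx => /eqP uM u0.
exists (fun i => u 0 i); split.
  by move: u0; case/matrix0Pn => i0 [j uj]; exists j; rewrite -(ord1 i0).
under eq_bigr do rewrite cP mulr_sumr.
rewrite exchange_big /= big1 // => j _.
transitivity (iota ((u *m M) 0 j) * e j); last by rewrite uM mxE rmorph0 mul0r.
rewrite mxE rmorph_sum mulr_suml; apply: eq_bigr => i _.
by rewrite mxE rmorphM mulrA.
Qed.

(** The [deg A + 1] functions [f * t ^ i] are linearly independent, whereas a divisor that
    attains the genus 1 has a space of dimension [deg A]. *)
Theorem rational_genus : ~ has_genus iota 1.
Proof.
move=> [_ [A [n [finA dimA /eqP]]]]; rewrite -addrA -subr_eq0 => /eqP dA.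
have degA : deg_divisor iota A = n by lia.
have [f [f0 fV]] := riemann_roch_rational finA degA.
have [u [[i ui] ]] := has_dim_dependent dimA (fun i : 'I_n.+1 => fV i (leq_ord i)).
have -> : \sum_i iota (u i) * (f * t ^+ i) = f * ev t (\poly_(i < n.+1) (if insub i is Some j then u j else 0)).
  rewrite /ev (@horner_coef_wide _ n.+1); last by rewrite size_map_poly size_poly.
  rewrite mulr_sumr; apply: eq_bigr => j _.
  by rewrite coef_map coef_poly ltn_ord valK mulrCA.
move/eqP; rewrite mulf_eq0 (negPf f0) => /eqP/t_trans/polyP/(_ i).
by rewrite coef_poly ltn_ord valK coef0 => /eqP; rewrite (negPf ui).
Qed.
End Places.
Lemma closed_sqrt (c : C) : exists k, k ^+ 2 = c.
Proof.
have /closed_rootP[k] : size ('X^2 - c%:P : {poly C}) != 1%N by rewrite size_XnsubC.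
by rewrite rootE !hornerE subr_eq0 => /eqP; exists k.
Qed.

Lemma transcendental_transfer t x : transcendental x -> ratf t x -> transcendental t.
Proof.
move=> xt [P1 [P2 [h xE]]]; apply: not_const_transcendental => c tE.
have := transcendental_const xt (P1.[c] / P2.[c]).
have e P : ev t P = iota P.[c] by rewrite tE /ev horner_map.
by rewrite xE !e fmorph_div subrr eqxx.
Qed.

(** A conic is rational: [s ^+ 2 = k ^+ 2 * (x - e1) * (x - e2)] is parametrized by the slope
    [s / (x - e1)] of the lines through the point [(e1, 0)]. *)
Theorem conic_rational x w (r : C) (E : {poly C}) : transcendental x ->
  w ^+ 2 = (x - iota r) ^+ 2 * ev x E -> (size E <= 3)%N ->
  exists t, [/\ transcendental t, ratf t x & ratf t w].
Proof.
move=> xt wE sE; have nz := transcendental_const xt.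
pose s := w / (x - iota r).
have s2 : s ^+ 2 = ev x E by rewrite expr_div_n wE mulrC mulKf // expf_neq0.
suff [t tx ts] : exists2 t, ratf t x & ratf t s.
  exists t; split=> //; first exact: transcendental_transfer xt tx.
  rewrite -[w](divfK (nz r)); apply: ratfM => //.
  by apply: ratfD => //; apply: ratfN; exact: ratf_const.
have [l lE] := closed_field_poly_normal E.
have [k kE] := closed_sqrt (lead_coef E).
have E0 : E = 0 -> ratf x s.
  move=> e; suff -> : s = 0 by rewrite -(rmorph0 iota); exact: ratf_const.
  by apply/eqP; rewrite -sqrf_eq0 s2 e -[0]/(0%:P) evC rmorph0.
have [e|lc0] := eqVneq E 0; first by exists x; [exact: ratf_id|exact: E0].
have {}lc0 : lead_coef E != 0 by rewrite lead_coef_eq0.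
have k0 : iota k != 0 by rewrite fmorph_eq0 -sqrf_eq0 kE.
rewrite (ev_factor x lE) -kE rmorphXn in s2.
have : (size l <= 2)%N.
  by move: sE; rewrite lE size_scale // size_prod_XsubC.
have pm f : s ^+ 2 = f ^+ 2 -> ratf x f -> ratf x s.
  by move/eqP; rewrite eqf_sqr => /orP[] /eqP -> //; exact: ratfN.
have lin c : ratf x (x - iota c).
  by apply: ratfD; [exact: ratf_id|apply: ratfN; exact: ratf_const].
case: l lE s2 => [|e1 [|e2 []]] //= _; rewrite ?big_cons big_nil ?mulr1 => s2 _.
- by exists x; [exact: ratf_id|apply: pm s2 _; exact: ratf_const].
- exists s; last exact: ratf_id.
  have -> : x = s ^+ 2 / iota k ^+ 2 + iota e1 by rewrite s2; field.
  apply: ratfD; last exact: ratf_const.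
  apply: ratfM; first by apply: ratfX; exact: ratf_id.
  by apply: ratfV; apply: ratfX; exact: ratf_const.
have [e12|e12] := eqVneq e1 e2.
  exists x; first exact: ratf_id.
  by apply: (pm (iota k * (x - iota e1))); [rewrite s2 e12; ring|apply: ratfM; [exact: ratf_const|exact: lin]].
pose t := s / (x - iota e1).
have t2 : t ^+ 2 * (x - iota e1) = iota k ^+ 2 * (x - iota e2).
  by rewrite expr_div_n s2; field.
have d0 : t ^+ 2 - iota k ^+ 2 != 0.
  apply/eqP => /eqP; rewrite subr_eq0 => /eqP e; move: t2; rewrite e.
  move/(mulfI (expf_neq0 2 k0))/eqP; rewrite (inj_eq (addrI _)) eqr_opp.
  by rewrite (inj_eq (fmorph_inj iota)) (negPf e12).
have t2f : ratf t (t ^+ 2) by apply: ratfX; exact: ratf_id.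
have k2f : ratf t (iota k ^+ 2) by apply: ratfX; exact: ratf_const.
have tx : ratf t x.
  have -> : x = (t ^+ 2 * iota e1 - iota k ^+ 2 * iota e2) / (t ^+ 2 - iota k ^+ 2).
    apply: (mulIf d0); rewrite divfK //; apply/eqP; rewrite -subr_eq0.
    have -> : x * (t ^+ 2 - iota k ^+ 2) - (t ^+ 2 * iota e1 - iota k ^+ 2 * iota e2) =
       t ^+ 2 * (x - iota e1) - iota k ^+ 2 * (x - iota e2) by ring.
    by rewrite t2 subrr.
  apply: ratfM.
    by apply: ratfD; [|apply: ratfN]; apply: ratfM => //; exact: ratf_const.
  by apply: ratfV; apply: ratfD => //; exact: ratfN.
exists t => //; rewrite -[s](divfK (nz e1)); apply: ratfM; first exact: ratf_id.
by apply: ratfD => //; apply: ratfN; exact: ratf_const.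
Qed.
End RationalFunctionField.

(** * The function field of the kernel *)

Lemma map_poly_quadratic (A B : nzRingType) (f : {rmorphism A -> B}) (a b c : A) :
  map_poly f (a%:P * 'X^2 + b%:P * 'X + c%:P) = (f a)%:P * 'X^2 + (f b)%:P * 'X + (f c)%:P.
Proof. have fM q d : map_poly f (d%:P * q) = (f d)%:P * map_poly f q by rewrite rmorphM /= map_polyC.
have fD q r : map_poly f (q + r) = map_poly f q + map_poly f r by rewrite rmorphD.
by rewrite !fD !fM map_polyXn map_polyX map_polyC. Qed.

Section Swap.
Context {A : idomainType}.
Implicit Types u f g : {poly {poly A}}.

Lemma swapXY_unit u : u \is a GRing.unit -> swapXY u \is a GRing.unit.
Proof.
move=> h; apply/unitrP; exists (swapXY u^-1).
by rewrite -!rmorphM /= mulVr // mulrV // rmorph1.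
Qed.

Lemma swapXY_irreducible u : irreducible_elt u -> irreducible_elt (swapXY u).
Proof.
move=> [u0 uu uf]; split; first by rewrite swapXY_eq0.
  by apply: contra uu => /swapXY_unit; rewrite swapXYK.
move=> f g e; have : u = swapXY f * swapXY g by rewrite -[LHS]swapXYK e rmorphM.
by case/uf => /swapXY_unit; rewrite swapXYK => h; [left|right].
Qed.
End Swap.

Section SwapField.
Context {C K : fieldType} (iota : {rmorphism C -> K}).

Lemma eval2_swap (P : {poly {poly C}}) (x y : K) : eval2 iota (swapXY P) y x = eval2 iota P x y.
Proof. by rewrite /eval2 -swapXY_map horner2_swapXY. Qed.

Lemma function_field_swap (Q : {poly {poly C}}) x y :
  is_function_field iota Q x y -> is_function_field iota (swapXY Q) y x.
Proof.
move=> [Qv Qg]; split=> [P|f].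
  rewrite -[P]swapXYK eval2_swap; split.
    by case/Qv => S e; exists (swapXY S); rewrite e rmorphM.
  by case=> S e; apply/Qv; exists (swapXY S); rewrite -[swapXY P]swapXYK e rmorphM /= swapXYK.
have [P1 [P2 [h ->]]] := Qg f; exists (swapXY P1), (swapXY P2).
by rewrite !eval2_swap.
Qed.
End SwapField.

Section WalkField.
Context {R : realType}.
Implicit Types (p : int -> int -> R) (q : {poly R}).
Local Notation complexify := (map_poly (real_complex R)).

Lemma walk_kernelE p : walk_kernel p =
  - ((coef_at p)%:P * 'X^2 + (coef_bt p)%:P * 'X + (coef_ct p)%:P).
Proof.
rewrite /walk_kernel /steps !big_cons !big_nil /= /coef_at /coef_bt /coef_ct.
rewrite !(polyCD, polyCM, polyC_exp, polyCN).
by ring.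
Qed.

Lemma walk_kernel_transpose p : swapXY (walk_kernel p) = walk_kernel (transpose p).
Proof.
have sC (a : R) : swapXY a%:P%:P = a%:P%:P by rewrite swapXY_polyC map_polyC.
rewrite /walk_kernel /steps !big_cons !big_nil /= /transpose.
rewrite !(rmorphB, rmorphD, rmorphM, rmorphXn, rmorph0) /= !sC !swapXY_X !swapXY_Y.
by ring.
Qed.

Lemma walk_kernelCE p : walk_kernelC p =
  - ((complexify (coef_at p))%:P * 'X^2 + (complexify (coef_bt p))%:P * 'X +
     (complexify (coef_ct p))%:P).
Proof.
by rewrite /walk_kernelC walk_kernelE rmorphN /= map_poly_quadratic.
Qed.

Lemma walk_kernelC_transpose p : swapXY (walk_kernelC p) = walk_kernelC (transpose p).
Proof.
by rewrite /walk_kernelC -walk_kernel_transpose swapXY_map.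
Qed.

Context {K : fieldType}.
Variable iota : {rmorphism R[i] -> K}.

Record walk_field p (x y : K) : Prop := WalkField {
  wf_irr : irreducible_elt (walk_kernelC p);
  wf_sizeX : size (walk_kernelC p) = 3%N;
  wf_sizeY : sizeY (walk_kernelC p) = 3%N;
  wf_fun : is_function_field iota (walk_kernelC p) x y }.

Lemma walk_field_transpose p x y : walk_field p x y -> walk_field (transpose p) y x.
Proof.
move=> [irr sX sY ff]; split; rewrite -walk_kernelC_transpose.
- exact: swapXY_irreducible.
- by rewrite -sizeYE.
- by rewrite sizeYE swapXYK.
- exact: function_field_swap.
Qed.

Lemma evalKE q (z : K) : evalK iota q z = ev iota z (complexify q).
Proof. by rewrite /evalK /ev map_poly_comp. Qed.

Section Theory.
Variables (p : int -> int -> R) (x y : K).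
Hypothesis wf : walk_field p x y.

Lemma coef_at_neq0 : coef_at p != 0.
Proof.
have := wf_sizeX wf; rewrite walk_kernelCE => sX; apply/eqP => e.
move: sX; rewrite e rmorph0 polyC0 mul0r add0r size_polyN => sX.
have : (size ((complexify (coef_bt p))%:P * 'X + (complexify (coef_ct p))%:P)%R <= 2)%N.
  by rewrite size_MXaddC; case: ifP => // _; rewrite ltnS size_polyC leq_b1.
by rewrite sX.
Qed.

Lemma coef_ct_neq0 : coef_ct p != 0.
Proof.
apply/eqP => e; have [Q0 Qu Qf] := wf_irr wf; have sX := wf_sizeX wf.
have QE : walk_kernelC p = 'X *
    - ((complexify (coef_at p))%:P * 'X + (complexify (coef_bt p))%:P).
  by rewrite walk_kernelCE e rmorph0 polyC0; ring.
have unit_size (P : {poly {poly R[i]}}) : P \is a GRing.unit -> size P = 1%N.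
  by rewrite poly_unitE => /andP[/eqP].
case: (Qf _ _ QE) => /unit_size; first by rewrite size_polyX.
move=> s1; move: sX; rewrite QE mulrC size_mulX ?s1 //.
by rewrite -size_poly_eq0 s1.
Qed.

Lemma transcendental_y : transcendental iota y.
Proof.
move=> P; have <- : eval2 iota P%:P x y = ev iota y P.
  by rewrite /eval2 map_polyC hornerC.
have [Qv _] := wf_fun wf; case/Qv => S PE.
have [S0|S0] := eqVneq S 0; first by move: PE; rewrite S0 mul0r => /eqP; rewrite polyC_eq0 => /eqP.
have [Q0 _ _] := wf_irr wf.
have := congr1 (fun g : {poly {poly R[i]}} => size g) PE.
rewrite size_polyC size_mul // (wf_sizeX wf) addn3 /=.
by move: S0; rewrite -size_poly_gt0; case: (P != 0); lia.
Qed.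

Lemma evalK_neq0 q : q != 0 -> evalK iota q y != 0.
Proof.
move=> q0; rewrite evalKE; apply: contraNneq q0 => /transcendental_y/eqP.
by rewrite map_poly_eq0.
Qed.

Lemma walk_curve : evalK iota (coef_at p) y * x ^+ 2 + evalK iota (coef_bt p) y * x +
  evalK iota (coef_ct p) y = 0.
Proof.
have [Qv _] := wf_fun wf; have : eval2 iota (walk_kernelC p) x y = 0.
  by apply/Qv; exists 1; rewrite mul1r.
rewrite /eval2 walk_kernelCE rmorphN /= map_poly_quadratic expr2.
rewrite !evalKE /ev !(hornerN, hornerD, hornerM, hornerX, hornerC).
by move/eqP; rewrite oppr_eq0 => /eqP.
Qed.

Lemma x_neq0 : x != 0.
Proof.
apply/eqP => x0; have := walk_curve; rewrite x0 expr0n !mulr0 !add0r => /eqP.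
by apply/negP/evalK_neq0; exact: coef_ct_neq0.
Qed.

Lemma evalKM q1 q2 z : evalK iota (q1 * q2) z = evalK iota q1 z * evalK iota q2 z.
Proof. by rewrite !evalKE rmorphM evM. Qed.
Lemma evalKD q1 q2 z : evalK iota (q1 + q2) z = evalK iota q1 z + evalK iota q2 z.
Proof. by rewrite !evalKE rmorphD evD. Qed.
Lemma evalKN q z : evalK iota (- q) z = - evalK iota q z.
Proof. by rewrite !evalKE rmorphN evN. Qed.

Lemma walk_disc : (2 * evalK iota (coef_at p) y * x + evalK iota (coef_bt p) y) ^+ 2 =
  evalK iota (disct p) y.
Proof.
have e4 : 4%:R = (4%:R : R)%:P by rewrite polyC_natr.
have k4 : evalK iota 4%:R y = 4 by rewrite e4 evalKE map_polyC evC /= !rmorph_nat.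
rewrite /disct (expr2 (coef_bt p)) [RHS]evalKD evalKN !evalKM k4.
have := walk_curve; move: (evalK iota _ y) (evalK iota _ y) (evalK iota _ y) => c b a e.
transitivity (b * b - 4 * a * c + 4 * a * (a * x ^+ 2 + b * x + c)); first by ring.
by rewrite e mulr0 addr0.
Qed.

Lemma walk_generated t : ratf iota t x -> ratf iota t y -> forall f, ratf iota t f.
Proof.
move=> tx ty f; have [_ /(_ f)[P1 [P2 [h ->]]]] := wf_fun wf.
by apply: ratfM; [|apply: ratfV]; exact: ratf_eval2.
Qed.

(** Where the discriminant has a double root, the curve is birational to a conic. *)
Lemma disct_simple : has_genus iota 1 -> forall (r : R) (E : {poly R}), (size E <= 3)%N ->
  disct p <> ('X - r%:P) ^+ 2 * E.
Proof.
move=> g1 r E sE DE.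
have two : (2 : K) != 0.
  by have -> : 2 = iota 2; [rewrite rmorph_nat|rewrite fmorph_eq0 pnatr_eq0].
have a0 := evalK_neq0 coef_at_neq0.
have [||t [tt ty tw]] := @conic_rational _ _ iota y
  (2 * evalK iota (coef_at p) y * x + evalK iota (coef_bt p) y)
  (real_complex R r) (complexify E) transcendental_y.
- have evL : evalK iota ('X - r%:P) y = y - iota (real_complex R r).
    by rewrite evalKD evalKN !evalKE map_polyX map_polyC evX evC.
  by rewrite walk_disc DE (expr2 ('X - _)) !evalKM evL -expr2 evalKE.
- by rewrite size_map_poly.
apply: (@rational_genus _ _ iota t) g1 => //; apply: walk_generated => //.
have -> : x = ((2 * evalK iota (coef_at p) y * x + evalK iota (coef_bt p) y) -
   evalK iota (coef_bt p) y) / (2 * evalK iota (coef_at p) y).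
  by field; rewrite two a0.
have twoC : ratf iota t 2 by rewrite -(rmorph_nat iota); exact: ratf_const.
have ek q : ratf iota t (evalK iota q y) by rewrite evalKE; exact: ratf_ev.
by apply: ratfM; [apply: ratfD => //; exact: ratfN|apply: ratfV; exact: ratfM].
Qed.

(** The norm to [C(y)]: the zeros of a nonzero function lie over finitely many values
    of [y]. *)
Lemma norm_poly (eta : {rmorphism K -> K}) (P : {poly {poly R[i]}}) : is_eta iota p x y eta ->
  eval2 iota P x y != 0 -> exists N : {poly R[i]}, N != 0 /\
  forall X Y : R[i], (walk_kernelC p).[X, Y] = 0 -> P.[X, Y] = 0 -> N.[Y] = 0.
Proof.
move=> [_ etaC etay etax] P0.
set Q := walk_kernelC p; have sQ : size Q = 3%N := wf_sizeX wf.
have Qn0 : Q != 0 by rewrite -size_poly_eq0 sQ.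
have := Pdiv.Idomain.divp_eq P Q; set k := scalp P Q; set S := P %/ Q; set T := P %% Q => dv.
have sT : (size T <= 2)%N by have := ltn_modp P Q; rewrite Qn0 sQ ltnS => ->.
pose a := complexify (coef_at p); pose b := complexify (coef_bt p); pose c := complexify (coef_ct p).
have QE : Q = - (a%:P * 'X^2 + b%:P * 'X + c%:P) by exact: walk_kernelCE.
pose A := T`_1; pose B := T`_0.
have TE : T = A%:P * 'X + B%:P.
  apply/polyP => i; rewrite coefD coefCM coefX coefC.
  case: i => [|[|i]] /=; rewrite ?mulr0 ?mulr1 ?add0r ?addr0 //.
  by rewrite nth_default // (leq_trans sT).
have lQ : lead_coef Q = - a.
  rewrite lead_coefE sQ QE coefN !coefD !coefCM coefXn coefX coefC /=.
  by rewrite mulr1 mulr0 !addr0.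
(* [a] times the norm of the remainder [A x + B] of [P]. *)
exists (A ^+ 2 * c - A * b * B + a * B ^+ 2); split.
  have ay : ev iota y a != 0 by rewrite -evalKE; apply: evalK_neq0; exact: coef_at_neq0.
  have x0 := x_neq0.
  have Tx : ev iota y A * x + ev iota y B != 0.
    have -> : ev iota y A * x + ev iota y B = ev iota y ((- a) ^+ k) * eval2 iota P x y.
      transitivity (eval2 iota T x y).
        rewrite TE /eval2; move: A B {TE} => A B; rewrite rmorphD rmorphM /= !map_polyC map_polyX.
        by rewrite !(hornerD, hornerM, hornerC, hornerX).
      have Q0 : eval2 iota Q x y = 0.
        by have [Qv _] := wf_fun wf; apply/Qv; exists 1; rewrite mul1r.
      have -> : T = ((- a) ^+ k)%:P * P - S * Q by rewrite -lQ mul_polyC dv; ring.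
      rewrite /eval2 rmorphB !rmorphM /= map_polyC !(hornerD, hornerN, hornerM, hornerC).
      by move: Q0; rewrite /eval2 => ->; rewrite mulr0 subr0.
    by rewrite mulf_neq0 // ev_neq0 ?expf_neq0 ?oppr_eq0 ?map_poly_eq0 ?coef_at_neq0 //; exact: transcendental_y.
  have eta_ev (g : {poly R[i]}) : eta (ev iota y g) = ev iota y g.
    rewrite /ev !horner_coef rmorph_sum; apply: eq_bigr => i _.
    by rewrite coef_map rmorphM rmorphXn etay etaC.
  have : (ev iota y A * x + ev iota y B) * eta (ev iota y A * x + ev iota y B) != 0.
    by rewrite mulf_neq0 ?fmorph_eq0.
  rewrite rmorphD rmorphM !eta_ev => prod0.
  have xx : ev iota y a * (x * eta x) = ev iota y c.
    by rewrite etax !evalKE; field; rewrite x0 ay.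
  have xDx : ev iota y a * (x + eta x) = - ev iota y b.
    apply: (mulIf x0); transitivity (ev iota y a * x ^+ 2 + ev iota y a * (x * eta x)); first by ring.
    rewrite xx; have := walk_curve; rewrite !evalKE -/a -/b -/c => e.
    by apply/eqP; rewrite -subr_eq0 mulNr opprK; apply/eqP; rewrite -e; ring.
  apply: contraNneq (mulf_neq0 ay prod0) => N0.
  apply/eqP; rewrite -(_ : ev iota y (A ^+ 2 * c - A * b * B + a * B ^+ 2) = 0); last first.
    by rewrite N0 -[0]/(0%:P) evC rmorph0.
  rewrite !expr2 !(evD, evN, evM) -xx -[ev iota y b]opprK -xDx; ring.
move=> X Y; rewrite -/Q => Q0 P0'.
have cv : a.[Y] * X ^+ 2 + b.[Y] * X + c.[Y] = 0.
  move: Q0; rewrite QE !expr2 !(hornerN, hornerD, hornerM, hornerX, hornerC).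
  by move/eqP; rewrite oppr_eq0 => /eqP.
have T0 : A.[Y] * X + B.[Y] = 0.
  have := congr1 (fun g : {poly {poly R[i]}} => g.[X, Y]) dv.
  rewrite -mul_polyC TE !(hornerD, hornerM, hornerC, hornerX) P0' Q0 !mulr0 add0r => <- //.
rewrite !(hornerD, hornerN, hornerM, horner_exp).
transitivity ((A.[Y] * X + B.[Y]) * (a.[Y] * (B.[Y] - A.[Y] * X) - A.[Y] * b.[Y]) +
   A.[Y] ^+ 2 * (a.[Y] * X ^+ 2 + b.[Y] * X + c.[Y])); first by ring.
by rewrite T0 cv mul0r mulr0 addr0.
Qed.
End Theory.
End WalkField.

(** * The group acting on the parameter of the oval *)

Section Generic.
Context {R : realType}.
Implicit Types P Q : R -> Prop.

(** All but countably many parameters. *)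
Definition generic P : Prop := countable [set t | ~ P t].

Lemma genericW P Q : (forall t, P t -> Q t) -> generic P -> generic Q.
Proof. by move=> PQ; apply: sub_countable; apply: subset_card_le => t /= nQ /PQ. Qed.

Lemma generic_and P Q : generic P -> generic Q -> generic (fun t => P t /\ Q t).
Proof.
move=> cP cQ; rewrite /generic.
apply: (@sub_countable _ _ _ ([set t | ~ P t] `|` [set t | ~ Q t])); last first.
  rewrite -bigcup2E; apply: bigcup_countable => // -[|[|i]] _ //=; exact: countable0.
by apply: subset_card_le => t /= /not_andP.
Qed.

Lemma generic_all P : (forall t, P t) -> generic P.
Proof.
move=> h; rewrite /generic (_ : [set t | ~ P t] = set0) ?countable0 //.
by apply/seteqP; split=> // t /=; case.
Qed.

Lemma generic_ex P : generic P -> exists t, P t.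
Proof.
move=> cP; apply: contrapT => /forallNP nP.
have : (@lebesgue_measure R `[0%R, 1%R]%classic = 0)%E.
  apply: countable_lebesgue_measure0; apply: sub_countable cP.
  by apply: subset_card_le => t _ /=.
by rewrite lebesgue_measure_itv /= lte_fin ltr01 oppr0 adde0 => /eqP; rewrite onee_eq0.
Qed.

Lemma generic_comp (tau : R -> R) P : injective tau -> generic P -> generic (P \o tau).
Proof.
rewrite /generic => inj cP; have /eq_countable <- : (tau @` [set t | ~ (P \o tau) t] #= [set t | ~ (P \o tau) t])%card.
  by apply: inj_card_eq => x y _ _; exact: inj.
by apply: sub_countable cP; apply: subset_card_le => _ [t nP <-].
Qed.

Lemma generic_seq (I : eqType) (r : seq I) (P : I -> R -> Prop) :
  (forall i, generic (P i)) -> generic (fun t => forall i, i \in r -> P i t).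
Proof.
move=> h; elim: r => [|i r IHr]; first exact: generic_all.
apply: genericW (generic_and (h i) IHr) => t [Pi Pr] j.
by rewrite inE => /orP[/eqP ->|/Pr].
Qed.
End Generic.

(** The functions of the curve, along the parametrized oval. Two functions that agree at all but
    countably many parameters are equal: this transfers the identities between automorphisms
    to identities between translations and reflections of the real line. *)
Section Parametrization.
Context {R : realType} {K : fieldType}.
Variables (iota : {rmorphism R[i] -> K}) (p : int -> int -> R) (x y : K).
Hypothesis p_prob : transition_probabilities p.
Hypothesis wf : walk_field iota p x y.
Variables xi eta : {rmorphism K -> K}.
Hypotheses (xiP : is_xi iota p x y xi) (etaP : is_eta iota p x y eta).
Variables (e1 e4 : R) (U V G : R -> R).
Hypothesis flow : oval_flow (inv_kernel p) e1 e4 U V G.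
Hypothesis q2_neq0 : forall t, quad_v (inv_kernel p) (U t) 2 != 0.
Variable s : R.
Hypothesis V_refl : forall t, V (s - t) = V t.
Hypothesis U_refl : forall t,
  quad_u (inv_kernel p) (V t) 2 * (U t + U (s - t)) = - quad_u (inv_kernel p) (V t) 1.

Local Notation complexify := (map_poly (real_complex R)).
Local Notation rc := (real_complex R).
Let wfT := walk_field_transpose wf.

Definition abscissa t : R := 1 + (U t)^-1.
Definition ordinate t : R := 1 + (V t)^-1.
Definition affine t : Prop := U t != 0 /\ V t != 0.
Definition eval_oval t (P : {poly {poly R[i]}}) : R[i] := P.[rc (abscissa t), rc (ordinate t)].

Lemma generic_abscissa (N : {poly R[i]}) : N != 0 ->
  generic (fun t => U t != 0 -> N.[rc (abscissa t)] != 0).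
Proof.
move=> N0; have [r NE] := closed_field_poly_normal N.
apply: (@genericW _ (fun t => forall z, z \in r -> U t <> (complex.Re z - 1)^-1)).
  move=> t h U0; apply/eqP => Nz.
  have : root N (rc (abscissa t)) by rewrite rootE Nz.
  rewrite NE rootZ ?lead_coef_eq0 // root_prod_XsubC => /h; apply.
  by rewrite /abscissa /= addrAC subrr add0r invrK.
apply: generic_seq => z; apply: sub_countable (oval_countable flow (complex.Re z - 1)^-1).
by apply: subset_card_le => t /= /contrapT.
Qed.

Lemma generic_coef_x (q : {poly R}) : q != 0 -> generic (fun t => U t != 0 -> q.[abscissa t] != 0).
Proof.
move=> q0; have := @generic_abscissa (complexify q); rewrite map_poly_eq0 => /(_ q0).
apply: genericW => t h /h; rewrite horner_map; apply: contraNneq => ->.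
by rewrite rmorph0.
Qed.

Lemma generic_affine : generic affine.
Proof.
have U0 : generic (fun t => U t != 0).
  apply: sub_countable (oval_countable flow 0); apply: subset_card_le => t /=.
  by move=> /negP; rewrite negbK => /eqP.
have a0 : coef_a p != 0 by exact: coef_at_neq0 wfT.
apply: genericW (generic_and U0 (generic_coef_x a0)) => t [ut /(_ ut)].
move=> aX; split=> //; apply: contraNneq aX => vt.
have [q0 _ _] := quad_v_inv p ut; have := oval_curve flow t.
rewrite /biquad vt !mulr0 !add0r q0 => /eqP.
by rewrite mulf_eq0 (negPf (expf_neq0 2 ut)).
Qed.

Lemma walk_kernelC_at (X Y : R) : (walk_kernelC p).[rc X, rc Y] =
  rc (- ((coef_a p).[X] * Y ^+ 2 + (coef_b p).[X] * Y + (coef_c p).[X])).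
Proof.
rewrite coef_swap walk_kernelCE; move: (coef_at p) (coef_bt p) (coef_ct p) => a b c.
rewrite !expr2 !(hornerN, hornerD, hornerM, hornerX, hornerC) !horner_map.
by rewrite rmorphN !rmorphD !rmorphM.
Qed.

Lemma affine_curve t : affine t -> (walk_kernelC p).[rc (abscissa t), rc (ordinate t)] = 0.
Proof.
move=> [u0 v0]; rewrite walk_kernelC_at; have := oval_curve flow t.
have k : U t ^+ 2 * V t ^+ 2 != 0 by rewrite mulf_neq0 ?expf_neq0.
rewrite (biquad_inv p u0 v0) => /eqP; rewrite mulf_eq0 (negPf k) /= => /eqP ->.
by rewrite oppr0 rmorph0.
Qed.

Lemma eval_oval_eq0 P t : eval2 iota P x y = 0 -> affine t -> eval_oval t P = 0.
Proof.
have [Qv _] := wf_fun wf; case/Qv => S -> /affine_curve e.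
by rewrite /eval_oval hornerM hornerM e mulr0.
Qed.

(** The zeros lie over finitely many abscissas, by [norm_poly] with the roles of the two
    coordinates exchanged. *)
Lemma eval_oval_neq0 P : eval2 iota P x y != 0 -> generic (fun t => eval_oval t P != 0).
Proof.
rewrite -eval2_swap => P0.
have [N [N0 NP]] := norm_poly wfT (eta := xi) xiP P0.
apply: genericW (generic_and generic_affine (generic_abscissa N0)) => t [aff /(_ aff.1)].
apply: contra_neq => Pt; apply: (NP (rc (ordinate t))).
  by rewrite -walk_kernelC_transpose horner2_swapXY affine_curve.
by rewrite horner2_swapXY.
Qed.

(** The function [f] of the curve takes the value [F t] at almost every point of the oval. It is
    expressed by a quotient of polynomials, since [f] itself has no values. *)
Definition rep (f : K) (F : R -> R[i]) : Prop := exists P1 P2,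
  [/\ eval2 iota P2 x y != 0, f * eval2 iota P2 x y = eval2 iota P1 x y &
      generic (fun t => F t * eval_oval t P2 = eval_oval t P1)].

Lemma eval2M P1 P2 (f g : K) : eval2 iota (P1 * P2) f g = eval2 iota P1 f g * eval2 iota P2 f g.
Proof. by rewrite /eval2 rmorphM /= !hornerM. Qed.
Lemma eval2D P1 P2 (f g : K) : eval2 iota (P1 + P2) f g = eval2 iota P1 f g + eval2 iota P2 f g.
Proof. by rewrite /eval2 rmorphD /= !hornerD. Qed.
Lemma eval2N P (f g : K) : eval2 iota (- P) f g = - eval2 iota P f g.
Proof. by rewrite /eval2 rmorphN /= !hornerN. Qed.

Lemma eval_ovalM t P1 P2 : eval_oval t (P1 * P2) = eval_oval t P1 * eval_oval t P2.
Proof. by rewrite /eval_oval !hornerM. Qed.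
Lemma eval_ovalD t P1 P2 : eval_oval t (P1 + P2) = eval_oval t P1 + eval_oval t P2.
Proof. by rewrite /eval_oval !hornerD. Qed.
Lemma eval_ovalN t P : eval_oval t (- P) = - eval_oval t P.
Proof. by rewrite /eval_oval !hornerN. Qed.

Lemma rep_ext f F F' : generic (fun t => F t = F' t) -> rep f F -> rep f F'.
Proof.
move=> FF' [P1 [P2 [h e g]]]; exists P1, P2; split=> //.
by apply: genericW (generic_and FF' g) => t [<-].
Qed.

Lemma rep_unique f F F' : rep f F -> rep f F' -> generic (fun t => F t = F' t).
Proof.
move=> [P1 [P2 [h e g]]] [R1 [R2 [h' e' g']]].
have PR : eval2 iota (P1 * R2 - R1 * P2) x y = 0.
  by rewrite eval2D eval2N !eval2M -e -e'; ring.
have gen := generic_and (generic_and generic_affine (generic_and g g'))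
  (generic_and (eval_oval_neq0 h) (eval_oval_neq0 h')).
apply: genericW gen => t [[aff [k k']] [n n']]; apply: (mulIf n); apply: (mulIf n').
rewrite k -mulrA [eval_oval t P2 * _]mulrC mulrA k'; apply/eqP; rewrite -subr_eq0.
by rewrite -!eval_ovalM -eval_ovalN -eval_ovalD eval_oval_eq0.
Qed.

Lemma rep_zero f F : rep f F -> generic (fun t => F t = 0) -> f = 0.
Proof.
move=> [P1 [P2 [h e g]]] F0; apply/eqP; apply/negP => /negP f0.
have P1n : eval2 iota P1 x y != 0 by rewrite -e mulf_neq0.
have [t [[k n] F0t]] := generic_ex (generic_and (generic_and g (eval_oval_neq0 P1n)) F0).
by move: n; rewrite -k F0t mul0r eqxx.
Qed.

Lemma rep_exists f : exists P1 P2, rep f (fun t => eval_oval t P1 / eval_oval t P2).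
Proof.
have [_ /(_ f)[P1 [P2 [h e]]]] := wf_fun wf; exists P1, P2, P1, P2; split=> //.
  by rewrite e divfK.
by apply: genericW (eval_oval_neq0 h) => t n; rewrite divfK.
Qed.

Lemma repD f g F F' : rep f F -> rep g F' -> rep (f + g) (fun t => F t + F' t).
Proof.
move=> [P1 [P2 [h e k]]] [R1 [R2 [h' e' k']]]; exists (P1 * R2 + R1 * P2), (P2 * R2); split.
- by rewrite eval2M mulf_neq0.
- by rewrite eval2D !eval2M -e -e'; ring.
- apply: genericW (generic_and k k') => t [ek ek']; rewrite !(eval_ovalM, eval_ovalD) -ek -ek'.
  by ring.
Qed.

Lemma repM f g F F' : rep f F -> rep g F' -> rep (f * g) (fun t => F t * F' t).
Proof.
move=> [P1 [P2 [h e k]]] [R1 [R2 [h' e' k']]]; exists (P1 * R1), (P2 * R2); split.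
- by rewrite eval2M mulf_neq0.
- by rewrite !eval2M -e -e'; ring.
- apply: genericW (generic_and k k') => t [] ek ek'; rewrite !eval_ovalM -ek -ek'.
  by ring.
Qed.

Lemma repV f F : f != 0 -> rep f F -> rep f^-1 (fun t => (F t)^-1).
Proof.
move=> f0 [P1 [P2 [h e k]]]; have P1n : eval2 iota P1 x y != 0 by rewrite -e mulf_neq0.
exists P2, P1; split=> //; first by rewrite -e mulKf.
apply: genericW (generic_and k (eval_oval_neq0 P1n)) => t [ek]; rewrite -ek.
by rewrite mulf_eq0 negb_or => /andP[F0 _]; rewrite mulKf.
Qed.

Lemma rep_eval_oval P : rep (eval2 iota P x y) (fun t => eval_oval t P).
Proof.
have e1' : eval2 iota 1 x y = 1 by rewrite /eval2 rmorph1 !hornerC.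
exists P, 1; rewrite e1' oner_neq0 mulr1; split=> //; apply: generic_all => t.
by rewrite -eval_ovalM mulr1.
Qed.

Lemma rep_const c : rep (iota c) (fun=> c).
Proof.
have := rep_eval_oval c%:P%:P; rewrite /eval2 map_polyC hornerC /= map_polyC hornerC.
by apply: rep_ext; apply: generic_all => t; rewrite /eval_oval !hornerC.
Qed.

Lemma rep_x : rep x (fun t => rc (abscissa t)).
Proof.
have := rep_eval_oval 'X; rewrite /eval2 map_polyX hornerX hornerC.
by apply: rep_ext; apply: generic_all => t; rewrite /eval_oval hornerX hornerC.
Qed.

Lemma rep_y : rep y (fun t => rc (ordinate t)).
Proof.
have := rep_eval_oval 'X%:P; rewrite /eval2 map_polyC hornerC /= map_polyX hornerX.
by apply: rep_ext; apply: generic_all => t; rewrite /eval_oval hornerC hornerX.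
Qed.

Lemma rep_ev f F (P : {poly R[i]}) : rep f F -> rep (ev iota f P) (fun t => P.[F t]).
Proof.
move=> h; elim/poly_ind: P => [|P c IHP].
  rewrite -[0]/(0%:P) evC; have := rep_const 0.
  by apply: rep_ext; apply: generic_all => t; rewrite hornerC.
rewrite evD evM evX evC; have := repD (repM IHP h) (rep_const c).
by apply: rep_ext; apply: generic_all => t; rewrite !hornerE.
Qed.

Lemma rep_eval2 f g F F' (P : {poly {poly R[i]}}) : rep f F -> rep g F' ->
  rep (eval2 iota P f g) (fun t => P.[F t, F' t]).
Proof.
move=> h h'; elim/poly_ind: P => [|P c IHP].
  have := rep_const 0; rewrite /eval2 !rmorph0 !horner0.
  by apply: rep_ext; apply: generic_all => t; rewrite !horner0.
have -> : eval2 iota (P * 'X + c%:P) f g = eval2 iota P f g * f + ev iota g c.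
  by rewrite eval2D eval2M /eval2 map_polyX !map_polyC !hornerX !hornerC.
have := repD (repM IHP h) (rep_ev c h').
by apply: rep_ext; apply: generic_all => t; rewrite !hornerE.
Qed.

(** The map [h] corresponds to the change of parameter [tau]. *)
Definition acts (h : K -> K) (tau : R -> R) : Prop := forall f F, rep f F -> rep (h f) (F \o tau).

Lemma acts_morphism (h : {rmorphism K -> K}) (tau : R -> R) : injective tau ->
  fixes_constants iota h -> rep (h x) (fun t => rc (abscissa (tau t))) ->
  rep (h y) (fun t => rc (ordinate (tau t))) -> acts h tau.
Proof.
move=> inj hC hx hy f F [P1 [P2 [P20 e g]]].
have hE P : h (eval2 iota P x y) = eval2 iota P (h x) (h y).
  rewrite /eval2; elim/poly_ind: P => [|P c IHP]; first by rewrite !rmorph0 !horner0 rmorph0.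
  rewrite !rmorphD !rmorphM /= !map_polyX !map_polyC !(hornerD, hornerM, hornerX, hornerC) -IHP.
  rewrite rmorphD rmorphM; congr (_ + _).
  rewrite !horner_coef rmorph_sum; apply: eq_bigr => i _.
  by rewrite coef_map rmorphM rmorphXn hC.
have hP P : rep (h (eval2 iota P x y)) (fun t => eval_oval (tau t) P).
  by rewrite hE; exact: rep_eval2.
have hP20 : h (eval2 iota P2 x y) != 0 by rewrite fmorph_eq0.
have -> : h f = h (eval2 iota P1 x y) * (h (eval2 iota P2 x y))^-1.
  by rewrite -e rmorphM mulfK.
apply: rep_ext (repM (hP P1) (repV hP20 (hP P2))).
apply: genericW (generic_comp inj (generic_and g (eval_oval_neq0 P20))) => t /= [<- n].
by rewrite mulfK.
Qed.

Lemma generic_coef_y (q : {poly R}) : q != 0 -> generic (fun t => q.[ordinate t] != 0).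
Proof.
move=> q0; have : eval2 iota (complexify q)%:P x y != 0.
  rewrite /eval2 map_polyC hornerC -/(ev iota y (complexify q)) -evalKE.
  exact: (evalK_neq0 wf q0).
move/eval_oval_neq0; apply: genericW => t; rewrite /eval_oval hornerC horner_map.
by apply: contraNneq => ->; rewrite rmorph0.
Qed.

Lemma rep_evalK f F q : rep f (fun t => rc (F t)) -> rep (evalK iota q f) (fun t => rc q.[F t]).
Proof.
move=> h; rewrite evalKE; apply: rep_ext (rep_ev (complexify q) h).
by apply: generic_all => t; rewrite horner_map.
Qed.

(** By Vieta's formulas, [c / (a y)] is the ordinate of the other point over the same abscissa,
    which is the point of parameter [- t]. *)
Lemma acts_xi : acts xi (fun t => - t).
Proof.
case: xiP => _ xiC xix xiy.
have ax := evalK_neq0 wfT (coef_at_neq0 wfT); have y0 := x_neq0 wfT.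
have a0 : coef_a p != 0 by exact: coef_at_neq0 wfT.
have c0 : coef_c p != 0 by exact: coef_ct_neq0 wfT.
apply: (acts_morphism (@oppr_inj R) xiC).
  by rewrite xix; apply: rep_ext rep_x; apply: generic_all => t; rewrite /abscissa (oval_even flow).
rewrite xiy.
apply: rep_ext (repM (rep_evalK (coef_c p) rep_x)
  (repV (mulf_neq0 y0 ax) (repM rep_y (rep_evalK (coef_a p) rep_x)))).
have gen := generic_and (generic_and generic_affine (generic_comp oppr_inj generic_affine))
  (generic_and (generic_coef_x a0) (generic_coef_x c0)).
apply: genericW gen => t [[[u0 v0] [_ v'0]] [/(_ u0) aX /(_ u0) cX]].
rewrite -!rmorphM -fmorphV -rmorphM; congr (rc _).
have [Q0 Q1 Q2] := quad_v_inv p u0; rewrite -/(abscissa t) in Q0 Q1 Q2.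
have u20 : U t ^+ 2 != 0 by rewrite expf_neq0.
have vieta : ordinate t * ordinate (- t) * (coef_a p).[abscissa t] = (coef_c p).[abscissa t].
  apply: (vieta_inv (b := (coef_b p).[abscissa t])) => //.
  - by have := q2_neq0 t; rewrite Q2 mulf_eq0 (negPf u20).
  - apply: (mulfI u20); rewrite mulr0 -(oval_curve flow t) /biquad Q0 Q1 Q2; ring.
  - by apply: (mulfI u20); rewrite mulrA -Q2 (oval_vieta flow) Q1; ring.
have Y0 : ordinate t != 0.
  by apply: contraNneq cX => Y0; rewrite -vieta Y0 !mul0r.
by rewrite -vieta; field; rewrite ?Y0 ?aX.
Qed.

Lemma coef_sum_neq0 : coef_at p + coef_bt p + coef_ct p != 0.
Proof.
have a0 : coef_a p != 0 by exact: coef_at_neq0 wfT.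
have := coef_a_gt0 p_prob a0 ltr01; rewrite coef_aE expr1n !mulr1 => a1.
apply/eqP => e; have : (coef_at p + coef_bt p + coef_ct p)`_2 = 0 by rewrite e coef0.
rewrite /coef_at /coef_bt /coef_ct !(coefD, coefCM, coefXn, coefX, coefC) /= !(mulr0, addr0, mulr1).
by lra.
Qed.

Lemma acts_eta : acts eta (fun t => s - t).
Proof.
case: etaP => _ etaC etay etax.
have ay := evalK_neq0 wf (coef_at_neq0 wf); have x0 := x_neq0 wf.
have inj : injective (fun t : R => s - t) by move=> t t' /addrI/oppr_inj.
apply: (acts_morphism inj etaC); last first.
  by rewrite etay; apply: rep_ext rep_y; apply: generic_all => t; rewrite /ordinate V_refl.
rewrite etax.
apply: rep_ext (repM (rep_evalK (coef_ct p) rep_y)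
  (repV (mulf_neq0 x0 ay) (repM rep_x (rep_evalK (coef_at p) rep_y)))).
have gen := generic_and (generic_and generic_affine (generic_comp inj generic_affine))
  (generic_and (generic_coef_y coef_sum_neq0) (generic_and
  (generic_coef_y (coef_at_neq0 wf)) (generic_coef_y (coef_ct_neq0 wf)))).
apply: genericW gen => t [[[u0 v0] [u'0 _]] [sY [aY cY]]].
rewrite -!rmorphM -fmorphV -rmorphM; congr (rc _).
have [Q0 Q1 Q2] := quad_u_inv p v0; rewrite -/(ordinate t) in Q0 Q1 Q2.
have v20 : V t ^+ 2 != 0 by rewrite expf_neq0.
have vieta : abscissa t * abscissa (s - t) * (coef_at p).[ordinate t] = (coef_ct p).[ordinate t].
  apply: (vieta_inv (b := (coef_bt p).[ordinate t])) => //.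
  - by rewrite -!hornerD.
  - by apply: (mulfI v20); rewrite mulr0 -(oval_curve flow t) biquad_sym Q0 Q1 Q2; ring.
  - by apply: (mulfI v20); rewrite mulrA -Q2 U_refl Q1; ring.
have X0 : abscissa t != 0.
  by apply: contraNneq cY => X0; rewrite -vieta X0 !mul0r.
by rewrite -vieta; field; rewrite ?X0 ?aY.
Qed.

Local Notation period := (G e4 *+ 2).

Lemma acts_comp h h' tau tau' : acts h tau -> acts h' tau' -> acts (h \o h') (tau' \o tau).
Proof. by move=> hh hh' f F /hh'/hh. Qed.

Lemma acts_ext h tau tau' : tau =1 tau' -> acts h tau -> acts h tau'.
Proof. by move=> /funext ->. Qed.

Lemma acts_inv h g tau tau' : acts h tau -> cancel g h ->
  cancel tau tau' -> cancel tau' tau -> acts g tau'.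
Proof.
move=> hh gK tK tK' f F fF; have [P1 [P2 gF]] := rep_exists (g f).
have := hh _ _ gF; rewrite gK => fF'.
apply: rep_ext gF.
apply: genericW (generic_comp (can_inj tK') (rep_unique fF' fF)) => t /=.
by rewrite tK'.
Qed.

(** A function of the curve is represented by a function of the point of the oval, hence by
    a periodic function of the parameter. *)
Lemma acts_period h h' tau tau' : acts h tau -> acts h' tau' ->
  (forall t, exists k : int, tau' t = tau t + k%:~R * period) -> h = h'.
Proof.
move=> hh hh' per; apply/funext => f; have [P1 [P2 fF]] := rep_exists f.
apply/eqP; rewrite -subr_eq0; apply/eqP.
have rD := repD (hh _ _ fF) (repM (rep_const (-1)) (hh' _ _ fF)).
rewrite rmorphN rmorph1 mulN1r in rD; apply: (rep_zero rD).
apply: generic_all => t /=; have [k ->] := per t.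
have [Uk Vk] := oval_periodic flow (tau t) k.
have e P : eval_oval (tau t + k%:~R * period) P = eval_oval (tau t) P.
  by rewrite /eval_oval /abscissa /ordinate Uk Vk.
by rewrite !e mulN1r subrr.
Qed.

Lemma acts_unique h tau tau' : acts h tau -> acts h tau' ->
  generic (fun t => exists k : int, tau' t = tau t + k%:~R * period).
Proof.
move=> hh hh'.
have gen := generic_and (rep_unique (hh _ _ rep_x) (hh' _ _ rep_x))
  (rep_unique (hh _ _ rep_y) (hh' _ _ rep_y)).
apply: genericW gen => t /= [[/addrI/invr_inj eU] [/addrI/invr_inj eV]].
have [||k e] := @oval_period _ _ _ _ _ _ _ flow (tau t) (tau' t - tau t).
- by rewrite addrC subrK.
- by rewrite addrC subrK.
by exists k; rewrite -e addrC subrK.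
Qed.

Definition translation (n : int) (t : R) : R := t + n%:~R * s.
Definition reflection (n : int) (t : R) : R := - t + n%:~R * s.

Lemma generated_acts h : walk_group xi eta h ->
  exists n, acts h (translation n) \/ acts h (reflection n).
Proof.
elim=> {h} [|f|f g _ [n hf] _ [k hg]|f g _ [n hf] fK gK].
- by exists 0; left=> f F; apply: rep_ext; apply: generic_all => t; rewrite /= /translation mul0r addr0.
- case=> ->; [exists 0; right; apply: acts_ext acts_xi|exists 1; right; apply: acts_ext acts_eta].
    by move=> t; rewrite /reflection mul0r addr0.
  by move=> t; rewrite /reflection mul1r addrC.
- case: hf hg => hf [] hg; [exists (n + k); left|exists (k - n); right|
    exists (n + k); right|exists (k - n); left]; apply: acts_ext (acts_comp hf hg) => t /=;
    rewrite /translation /reflection ?rmorphB ?rmorphD /=; ring.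
- case: hf => hf; [exists (- n); left|exists n; right]; apply: (acts_inv hf gK) => t;
    rewrite /translation /reflection ?rmorphN /=; ring.
Qed.

Definition word (k : nat) (b : bool) : K -> K :=
  iter k (fun h => (xi \o eta) \o h) (if b then xi : K -> K else id).

Lemma word_generated k b : walk_group xi eta (word k b).
Proof.
elim: k => [|k IHk].
  by case: b; [apply: generated_in; left|exact: generated_id].
apply: generated_comp IHk; apply: generated_comp; apply: generated_in; first by left.
by right.
Qed.

Lemma word_acts k b : acts (word k b) (if b then reflection (- k%:Z) else translation k%:Z).
Proof.
elim: k => [|k IHk].
  case: b => /=; first by apply: acts_ext acts_xi => t; rewrite /reflection oppr0 mul0r addr0.
  by move=> f F; apply: rep_ext; apply: generic_all => t; rewrite /= /translation mul0r addr0.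
apply: acts_ext (acts_comp (acts_comp acts_xi acts_eta) IHk) => t /=.
rewrite /translation /reflection; case: b {IHk} => /=; rewrite ?rmorphN /= -addn1 PoszD rmorphD /=; ring.
Qed.

Definition commensurable (n : nat) : Prop := exists k : int, n%:R * s = k%:~R * period.

Lemma not_generic_half c : ~ generic (fun t => exists j : int, t *+ 2 = c + j%:~R * period).
Proof.
move=> gen; pose f (j : int) := (c + j%:~R * period) / 2.
have cf : countable (range f).
  by apply: sub_countable (card_image_le f setT) (countableP _).
have gen' : generic (fun t => ~ range f t).
  apply: sub_countable cf; apply: subset_card_le => t /= /contrapT //.
have [t [[j e] nt]] := generic_ex (generic_and gen gen').
by apply: nt; exists j => //; rewrite /f -e mulr2n; lra.
Qed.

(** Two words that define the same automorphism act in the same way modulo the period. A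
    translation and a reflection agree at countably many parameters only. *)
Lemma word_inj k b k' b' : (k <= k')%N -> word k b = word k' b' ->
  b = b' /\ commensurable (k' - k).
Proof.
move=> kk e; have h := word_acts k' b'; rewrite -e in h.
have := acts_unique (word_acts k b) h; rewrite /translation /reflection {h e}.
case: b b' => [] [] gen.
- have [t [j e]] := generic_ex gen; split=> //; exists (- j).
  rewrite natrB // mulrBl rmorphN mulNr; move: e; rewrite !rmorphN /= => e.
  by apply/eqP; rewrite -subr_eq0; apply/eqP; move: e; rewrite /=; lra.
- case: (@not_generic_half (- (k + k')%:R * s)).
  apply: genericW gen => t [j e]; exists j; rewrite natrD.
  by move: e; rewrite !rmorphN /= mulr2n; lra.
- case: (@not_generic_half (- (k + k')%:R * s)).
  apply: genericW gen => t [j e]; exists (- j); rewrite natrD rmorphN mulNr.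
  by move: e; rewrite !rmorphN /= mulr2n; lra.
have [t [j e]] := generic_ex gen; split=> //; exists j.
by rewrite natrB // mulrBl; move: e => /=; lra.
Qed.

Lemma walk_group_infinite N : (forall n, (0 < n)%N -> ~ commensurable n) ->
  ~ (walk_group xi eta #= `I_N)%card.
Proof.
move=> inf cN.
have inj : {in `I_N.+1 &, injective (fun k => word k false)}.
  move=> k k' _ _; wlog kk : k k' / (k <= k')%N.
    by move=> h; case/orP: (leq_total k k') => /h // h' /esym/h'.
  move=> /(word_inj kk)[_ com]; apply/eqP; rewrite eqn_leq kk /= leqNgt; apply/negP => lt.
  by apply: (inf (k' - k)%N) com; rewrite subn_gt0.
have : (`I_N.+1 #<= `I_N)%card.
  rewrite -(card_le_eqr cN) -(card_le_eql (inj_card_eq inj)).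
  by apply: subset_card_le => _ [k _ <-]; exact: word_generated.
by rewrite card_le_II ltnn.
Qed.

Lemma walk_group_finite N : (0 < N)%N -> commensurable N ->
  (forall n, (0 < n < N)%N -> ~ commensurable n) -> (walk_group xi eta #= `I_(2 * N))%card.
Proof.
move=> N0 [j comN] minN.
pose f k := if (k < N)%N then word k false else word (k - N) true.
have inj : {in `I_(2 * N) &, injective f}.
  move=> k k'; rewrite !inE /= => kN k'N.
  have winj a b a' b' : (a < N)%N -> (a' < N)%N -> word a b = word a' b' -> a = a' /\ b = b'.
    move=> aN a'N; wlog aa : a b a' b' aN a'N / (a <= a')%N.
      move=> h; case/orP: (leq_total a a') => /h h'; first exact: h'.
      by move=> /esym/h' [] // -> ->.
    move=> /(word_inj aa)[-> com]; split=> //; apply/eqP; rewrite eqn_leq aa /= leqNgt.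
    by apply/negP => lt; apply: (minN (a' - a)%N) com; lia.
  rewrite /f; case: ltnP => h; case: ltnP => h' /winj [] //; lia.
have red (n : int) : exists2 k, (k < N)%N & exists i : int, n = k%:Z + i * N%:Z.
  exists `|(n %% N%:Z)%Z|%N.
    by have := @ltz_pmod n N%:Z; have := @modz_ge0 n N%:Z; lia.
  exists (n %/ N%:Z)%Z; rewrite {1}(divz_eq n N%:Z).
  by have := @modz_ge0 n N%:Z; lia.
have <- : f @` `I_(2 * N) = walk_group xi eta; last exact: inj_card_eq.
apply/seteqP; split=> [_ [k _ <-]|h /generated_acts[n [hn|hn]]].
- by rewrite /f; case: ifP => _; exact: word_generated.
- have [k kN [i nE]] := red n; exists k; first by rewrite /=; lia.
  rewrite /f kN; apply: acts_period (word_acts k false) hn _ => t.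
  exists (i * j); rewrite /translation nE !rmorphD !rmorphM /= -addrA -mulrA -comN.
  by rewrite -[N%:~R]/(N%:R : R); ring.
have [k kN [i nE]] := red (- n); exists (k + N)%N; first by rewrite /=; lia.
rewrite /f ltnNge leq_addl /= addnK; apply: acts_period (word_acts k true) hn _ => t.
exists (- (i * j)); rewrite -[n]opprK nE /reflection !rmorphN !rmorphD !rmorphM /= !mulNr -mulrA -comN.
by rewrite -[N%:~R]/(N%:R : R); ring.
Qed.

(** The [2 N] words are the elements of the dihedral group generated by the reflections
    [t -> - t] and [t -> s - t], when [s] has order [N] modulo the period. *)
Theorem walk_group_card N : (0 < N)%N -> (walk_group xi eta #= `I_(2 * N))%card <->
  commensurable N /\ forall n, (0 < n < N)%N -> ~ commensurable n.
Proof.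
move=> N0; split=> [cN|[]]; last exact: walk_group_finite.
have [[n [n0 com]]|inf] := pselect (exists n, (0 < n)%N /\ commensurable n); last first.
  by case: (@walk_group_infinite (2 * N)) => // n n0 com; apply: inf; exists n.
have ex : exists n, `[< (0 < n)%N /\ commensurable n >] by exists n; apply/asboolP.
case: (ex_minnP ex) => M /asboolP[M0 comM] minM.
have cM : (walk_group xi eta #= `I_(2 * M))%card.
  apply: walk_group_finite => // k /andP[k0 kM] comk.
  by have := minM k (asboolT (conj k0 comk)); rewrite leqNgt kM.
have /card_eq_II e : (`I_(2 * N) #= `I_(2 * M))%card.
  by apply: card_eq_trans cM; rewrite card_eq_sym.
have -> : N = M by lia.
split=> // k /andP[k0 kM] comk.
by have := minM k (asboolT (conj k0 comk)); rewrite leqNgt kM.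
Qed.
End Parametrization.

(** * The three periods as values of the elliptic integral *)

Section Integrals.
Context {R : realType}.

Lemma elliptic_antiderivative (a b : R) (E : {poly R}) : a < b ->
  (forall u, a <= u <= b -> 0 < E.[u]) ->
  exists G : R -> R, [/\ continuous G, G a = 0, 0 < G b &
    forall u, a < u < b -> is_derive u 1 G (Num.sqrt ((u - a) * (b - u) * E.[u]))^-1].
Proof.
move=> ab E0; pose m := (a + b) / 2; pose r := (b - a) / 2.
have r0 : 0 < r by rewrite /r; lra.
have mr : m - r = a by rewrite /m /r; lra.
have mDr : m + r = b by rewrite /m /r; lra.
have E0' u : m - r <= u <= m + r -> 0 < E.[u] by rewrite mr mDr; exact: E0.
have [Th [T [Th0 ThK TK dTh dT]]] := clock_exists r0 E0'.
have GE u : a <= u <= b -> clamped_integral m r Th u = clock_integral m r Th u.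
  by move=> uI; rewrite clamped_integralE // mr mDr.
exists (clamped_integral m r Th); split.
- exact: (clamped_integral_continuous r0 E0' Th0 ThK TK dTh dT).
- by rewrite GE ?lexx ?ltW // -{1}mr (clock_integral_left m r0 Th0).
- rewrite GE ?lexx ?ltW // -mDr (clock_integral_right m r0).
  by rewrite -(pmulrn_lgt0 _ (ltn0Sn 1)); exact: (clock_period_gt0 r0 E0' Th0 dTh).
move=> u uI; rewrite -{1}mr -mDr.
by apply: (clamped_integral_derive r0 E0' dTh); rewrite mr mDr.
Qed.

Lemma inv_sqrt_continuous (P : {poly R}) (x : R) : 0 < P.[x] ->
  {for x, continuous (fun x => (Num.sqrt P.[x])^-1)}.
Proof.
move=> P0; apply: cvgV; first by rewrite gt_eqF // sqrtr_gt0.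
by apply: (@continuous_comp _ _ _ (horner P) (@Num.sqrt R));
  [exact: continuous_horner|exact: sqrt_continuous].
Qed.

Lemma is_derive_inv_sub1 (x : R) : x - 1 != 0 ->
  is_derive x 1 (fun x : R => (x - 1)^-1) (- ((x - 1)^-1 ^+ 2)).
Proof.
move=> x1.
have d : is_derive x 1 (fun x : R => x - 1) 1 by apply: is_derive_eq; rewrite subr0.
have := @is_deriveV R (fun x => x - 1) x 1 1 x1 d.
by rewrite /GRing.scale /= mulr1 exprVn.
Qed.

Lemma cvg_inv_sub1 (x : R) : x - 1 != 0 -> {for x, continuous (fun x : R => (x - 1)^-1)}.
Proof.
move=> x1; apply: cvgV => //; apply: cvgB; [exact: cvg_id|exact: cvg_cst].
Qed.

Lemma cvg_inv_sub1_pinfty : (x - 1)^-1 @[x --> (+oo : set_system R)] --> (0 : R).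
Proof.
apply/gtr0_cvgV0; first by near=> x; rewrite subr_gt0; near: x; by apply: nbhs_pinfty_gt; rewrite num_real.
apply/cvgryPge => A; near=> x; rewrite lerBrDr; near: x; by apply: nbhs_pinfty_ge; rewrite num_real.
Unshelve. all: by end_near. Qed.

Lemma cvg_inv_sub1_ninfty : (x - 1)^-1 @[x --> (-oo : set_system R)] --> (0 : R).
Proof.
apply/ltr0_cvgV0; first by near=> x; rewrite subr_lt0; near: x; by apply: nbhs_ninfty_lt; rewrite num_real.
apply/cvgrNyPle => A; near=> x; rewrite lerBlDr; near: x; by apply: nbhs_ninfty_le; rewrite num_real.
Unshelve. all: by end_near. Qed.

Section Periods.
Variables (p : int -> int -> R) (x1 x2 x3 : R) (x4 : option R) (lc : R).
Hypothesis p_prob : transition_probabilities p.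
Hypotheses (a_neq0 : coef_a p != 0) (c_neq0 : coef_c p != 0).
Hypothesis br : simple_branch_points (disc p) x1 x2 x3 x4 lc.

Local Notation e1 := (arc_left x1).
Local Notation e4 := (arc_right x4).
Local Notation q := (inv_kernel p).

(** On [[x1, x2]], the opposite of the discriminant has the shape treated by
    [elliptic_antiderivative]. *)
Lemma omega1_gt0 : exists2 tau : R, 0 < tau & omega1 (disc p) x1 x2 = (tau*i)%C.
Proof.
have e12 := branch12 br; have e23 := branch23 br; have e1N := branch1N br.
have [x31 l1] := branch_signs p_prob a_neq0 c_neq0 br.
pose far : {poly R} := if x4 is Some r then (r - 1)^-1 *: ('X - r%:P) else (-1)%:P.
pose E := lead1 x4 lc *: (('X - x3%:P) * far).
have EE x : E.[x] = lead1 x4 lc * ((x - x3) * far_factor x4 x).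
  rewrite /E /far /far_factor; case: (x4) => [r|];
    rewrite !(hornerZ, hornerM, hornerD, hornerN, hornerX, hornerC); first by ring.
  by ring.
have farN x : x1 <= x <= x2 -> far_factor x4 x < 0.
  move=> /andP[h1 h2]; case: br => f l _ _ _ g1 g2 far4 _.
  by apply: (far_factor_lt0 p_prob a_neq0 c_neq0 f l e12 e23 e1N g1 g2 far4); lra.
have E0 x : x1 <= x <= x2 -> 0 < E.[x].
  move=> xI; rewrite EE mulr_gt0 // nmulr_lgt0 ?farN //.
  by case/andP: xI; lra.
have DE x : - (disc p).[x] = (x - x1) * (x2 - x) * E.[x].
  case: br => f l _ _ _ g1 g2 far4 _.
  by rewrite EE (discE_far p_prob a_neq0 c_neq0 f l e12 e23 e1N g1 g2 far4); ring.
have [G [Gc G0 Gb dG]] := elliptic_antiderivative e12 E0.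
exists (2%:R * G x2); first by rewrite mulr_gt0.
rewrite /omega1; congr ((_ * _)*i)%C.
pose g x : R := (Num.sqrt (- (disc p).[x]))^-1.
have d1 x : x1 < x < x2 -> is_derive x 1 G (g x) by move=> xI; rewrite /g DE; exact: dG.
have cg x : x1 < x < x2 -> {for x, continuous g}.
  move=> xI; have N0 : 0 < (- disc p).[x].
    by rewrite hornerN oppr_gt0 (branch_lt0 p_prob a_neq0 c_neq0 br).
  have -> : g = fun x => (Num.sqrt (- disc p).[x])^-1 by apply/funext => z; rewrite hornerN.
  exact: inv_sqrt_continuous.
have g0 x : x1 < x < x2 -> 0 <= g x by rewrite invr_ge0 sqrtr_ge0.
rewrite -[RHS]subr0 -[X in _ - X]G0; apply: (Rintegral_oo e12 d1 cg g0).
  by apply: cvg_at_right_filter; exact: Gc.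
by apply: cvg_at_left_filter; exact: Gc.
Qed.

Variables (U V G : R -> R).
Hypothesis flow : oval_flow q e1 e4 U V G.

Let F (x : R) : R := - G ((x - 1)^-1).

(** In the coordinate [u = 1 / (x - 1)], the differential [dx / sqrt D] is
    [- du / sqrt (disc_v q u)]. *)
Lemma inversion_derive (x : R) : x - 1 != 0 -> e1 < (x - 1)^-1 < e4 ->
  0 < (disc p).[x] /\
  is_derive x 1 F (Num.sqrt (disc p).[x])^-1.
Proof.
move=> x1n uI; have u0 : (x - 1)^-1 != 0 by rewrite invr_neq0.
have DE : disc_v q (x - 1)^-1 = (x - 1)^-1 ^+ 4 * (disc p).[x].
  have xE : 1 + (x - 1)^-1^-1 = x by rewrite invrK; ring.
  by rewrite disc_v_inv // xE.
have k4 : 0 < (x - 1)^-1 ^+ 4 by rewrite exprn_even_gt0.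
have D0 : 0 < (disc p).[x].
  rewrite -(pmulr_rgt0 _ k4) -DE (disc_v_arc p_prob a_neq0 c_neq0 br).
  case/andP: (uI) => h1 h2; rewrite mulr_gt0 ?mulr_gt0 ?subr_gt0 //.
  by apply: (arc_disc_gt0 p_prob a_neq0 c_neq0 br); rewrite !ltW.
split=> //.
have d := @is_derive1_comp R G (fun x => (x - 1)^-1) x _ _ (oval_G_derive flow uI)
  (is_derive_inv_sub1 x1n).
have dN := @is_deriveN _ _ _ _ _ _ _ d.
suff e : - ((Num.sqrt (disc_v q (x - 1)^-1))^-1 * - (x - 1)^-1 ^+ 2) = (Num.sqrt (disc p).[x])^-1.
  by rewrite -e; exact: dN.
have -> : disc_v q (x - 1)^-1 = ((x - 1)^-1 ^+ 2) ^+ 2 * (disc p).[x] by rewrite DE -exprM.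
rewrite sqrtrM ?sqr_ge0 // sqrtr_sqr ger0_norm ?sqr_ge0 // mulrN opprK invfM mulrAC mulVf ?mul1r //.
by rewrite expf_neq0.
Qed.

Lemma inversion_continuous (x : R) : x - 1 != 0 ->
  {for x, continuous F}.
Proof.
move=> x1n; apply: cvgN; apply: (@continuous_comp _ _ _ (fun x : R => (x - 1)^-1) G).
  exact: cvg_inv_sub1.
exact: (oval_G_continuous flow).
Qed.

Lemma inversion_limit (A : set_system R) : Filter A -> (x - 1)^-1 @[x --> A] --> (0 : R) ->
  F x @[x --> A] --> - G 0.
Proof.
move=> FA h; apply: cvgN.
by apply: continuous_cvg => //; exact: (oval_G_continuous flow).
Qed.

Local Notation f := (fun x => (Num.sqrt (disc p).[x])^-1).

Lemma inversion_left_ray : 0 <= e4 ->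
  lebesgue_measure.-integrable `]-oo, x1[%classic (EFin \o f) /\
  \int[lebesgue_measure]_(x in `]-oo, x1]) f x = G 0.
Proof.
move=> e40; have x1l := x1_lt1 br.
have dom x : x < x1 -> x - 1 != 0 /\ e1 < (x - 1)^-1 < e4.
  move=> xx; have xn : x - 1 < 0 by lra.
  split; first by rewrite lt_eqF.
  apply/andP; split; first by rewrite /arc_left ltf_nV2 ?negrE; lra.
  by apply: lt_le_trans e40; rewrite invr_lt0.
have x1n : x1 - 1 != 0 by lra.
have d1 x : x < x1 -> is_derive x 1 F (f x).
  by move=> /dom[h1 h2]; have [] := inversion_derive h1 h2.
have cg x : x < x1 -> {for x, continuous f}.
  by move=> /dom[h1 h2]; have [D0 _] := inversion_derive h1 h2; exact: inv_sqrt_continuous.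
have g0 x : x < x1 -> 0 <= f x by rewrite invr_ge0 sqrtr_ge0.
have lim1 : F x @[x --> (-oo : set_system R)] --> - G 0.
  by apply: inversion_limit; exact: cvg_inv_sub1_ninfty.
have lim2 := cvg_at_left_filter (inversion_continuous x1n).
have [h ->] := Rintegral_Nyo d1 cg g0 lim1 lim2.
by split=> //; rewrite /F -/(arc_left x1) (oval_G_left flow) oppr0 sub0r opprK.
Qed.

Lemma inversion_right_ray (s : R) : 1 < s -> (s - 1)^-1 <= e4 ->
  lebesgue_measure.-integrable `]s, +oo[%classic (EFin \o f) /\
  \int[lebesgue_measure]_(x in `[s, +oo[) f x = G (s - 1)^-1 - G 0.
Proof.
move=> s1 se4; have e10 := arc_left_lt0 br.
have dom x : s < x -> x - 1 != 0 /\ e1 < (x - 1)^-1 < e4.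
  move=> xx; have xn : 0 < x - 1 by lra.
  split; first by rewrite gt_eqF.
  apply/andP; split; first by apply: lt_trans e10 _; rewrite invr_gt0.
  by apply: lt_le_trans se4; rewrite ltf_pV2 ?posrE; lra.
have s1n : s - 1 != 0 by lra.
have d1 x : s < x -> is_derive x 1 F (f x).
  by move=> /dom[h1 h2]; have [] := inversion_derive h1 h2.
have cg x : s < x -> {for x, continuous f}.
  by move=> /dom[h1 h2]; have [D0 _] := inversion_derive h1 h2; exact: inv_sqrt_continuous.
have g0 x : s < x -> 0 <= f x by rewrite invr_ge0 sqrtr_ge0.
have lim1 := cvg_at_right_filter (inversion_continuous s1n).
have lim2 : F x @[x --> (+oo : set_system R)] --> - G 0.
  by apply: inversion_limit; exact: cvg_inv_sub1_pinfty.
have [h ->] := Rintegral_oy d1 cg g0 lim1 lim2.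
by split=> //; rewrite /F opprK addrC.
Qed.

(** In the coordinate [u = 1 / (x - 1)] the arc from [u0] to [x1], possibly through infinity,
    is the segment [[e1, u0]]. *)
Lemma omega3E (s : option R) :
  (if s is Some r then r != 1 else true) ->
  e1 <= (if s is Some r then (r - 1)^-1 else 0) <= e4 ->
  omega3 (disc p) s x1 = G (if s is Some r then (r - 1)^-1 else 0) *+ 2.
Proof.
move=> sn sI; rewrite /omega3 -[RHS]mulr_natl; congr (_ * _).
have x1l := x1_lt1 br; have x1n : x1 - 1 != 0 by lra.
case: s sn sI => [r|] rn /andP[rI1 rI2] /=; last by have [] := inversion_left_ray rI2.
have r1 : r - 1 != 0 by rewrite subr_eq0.
case: ifPn => rx1.
  have [->|rx] := eqVneq r x1; first by rewrite set_itv1 Rintegral_set1 (oval_G_left flow).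
  have {rx1} rx1 : r < x1 by rewrite lt_neqAle rx.
  have dom x : r < x < x1 -> x - 1 != 0 /\ e1 < (x - 1)^-1 < e4.
    move=> /andP[rx' xx]; have xn : x - 1 < 0 by lra.
    split; first by rewrite lt_eqF.
    apply/andP; split; first by rewrite /arc_left ltf_nV2 ?negrE; lra.
    by apply: lt_le_trans rI2; rewrite ltf_nV2 ?negrE; lra.
  have d1 x : r < x < x1 -> is_derive x 1 F (f x).
    by move=> /dom[h1 h2]; have [] := inversion_derive h1 h2.
  have cg x : r < x < x1 -> {for x, continuous f}.
    by move=> /dom[h1 h2]; have [D0 _] := inversion_derive h1 h2; exact: inv_sqrt_continuous.
  have g0 x : r < x < x1 -> 0 <= f x by rewrite invr_ge0 sqrtr_ge0.
  have lim1 := cvg_at_right_filter (inversion_continuous r1).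
  have lim2 := cvg_at_left_filter (inversion_continuous x1n).
  rewrite (Rintegral_oo rx1 d1 cg g0 lim1 lim2).
  by rewrite /F -/(arc_left x1) (oval_G_left flow) oppr0 sub0r opprK.
rewrite -ltNge in rx1.
have r1' : 1 < r.
  rewrite ltNge; apply/negP => rle; have rl : r - 1 < 0 by rewrite lt_neqAle r1 subr_le0.
  by move: rI1; rewrite /arc_left lef_nV2 ?negrE; lra.
have e40 : 0 <= e4 by apply: le_trans rI2; rewrite invr_ge0; lra.
have [iL L] := inversion_left_ray e40; have [iR Rr] := inversion_right_ray r1' rI2.
have AB : [disjoint `[r, +oo[%classic & `]-oo, x1]%classic].
  apply/disj_setPS => x [] /=; rewrite !in_itv /= andbT => h1 h2; lra.
have mR : measurable_fun `[r, +oo[%classic (EFin \o f).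
  by apply/emeasurable_fun_itv_obnd_cbndP; exact: measurable_int iR.
have mL : measurable_fun `]-oo, x1]%classic (EFin \o f).
  by apply/emeasurable_fun_itv_bndo_bndcP; exact: measurable_int iL.
have f0 x : (0 <= (EFin \o f) x)%E by rewrite lee_fin invr_ge0 sqrtr_ge0.
have finR : (\int[lebesgue_measure]_(x in `[r, +oo[) (EFin \o f) x \is a fin_num)%E.
  by rewrite -integral_itv_obnd_cbnd; [exact: integrable_fin_num|exact: measurable_int iR].
have finL : (\int[lebesgue_measure]_(x in `]-oo, x1]) (EFin \o f) x \is a fin_num)%E.
  by rewrite -integral_itv_bndo_bndc; [exact: integrable_fin_num|exact: measurable_int iL].
have -> : \int[lebesgue_measure]_(x in `[r, +oo[ `|` `]-oo, x1]) f x =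
    \int[lebesgue_measure]_(x in `[r, +oo[) f x + \int[lebesgue_measure]_(x in `]-oo, x1]) f x.
  have mU : measurable_fun (`[r, +oo[ `|` `]-oo, x1])%classic (EFin \o f).
    by apply/measurable_funU.
  have f0' x : (`[r, +oo[ `|` `]-oo, x1])%classic x -> (0 <= (EFin \o f) x)%E by [].
  have sumE := @ge0_integral_setU _ _ _ lebesgue_measure _ _ _ _ _ mU f0' AB.
  transitivity (fine (\int[lebesgue_measure]_(x in `[r, +oo[ `|` `]-oo, x1]) (EFin \o f) x)%E) => //.
  by rewrite sumE //; apply: fineD.
by rewrite L Rr subrK.
Qed.

(** The homography that exchanges the two ovals: it maps [x2] and [x3] to [e1] and [e4], and
    the two other branch points to the two other ones. *)
Let ratio : R := (x3 - x1) / ((1 - x1) * - far_factor x4 x2).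
Let den (x : R) : R := (x3 - x) + ratio * (x - x2).
Let swap (x : R) : R := (e1 * (x3 - x) + e4 * ratio * (x - x2)) / den x.

Lemma far_factor_lt0' x : - x3 < x <= x3 -> far_factor x4 x < 0.
Proof.
case: br => f l e12 e23 e1N g1 g2 far4 _.
exact: (far_factor_lt0 p_prob a_neq0 c_neq0 f l e12 e23 e1N g1 g2 far4).
Qed.

Lemma discE_far' x :
  (disc p).[x] = lead1 x4 lc * ((x - x1) * (x - x2) * (x - x3) * far_factor x4 x).
Proof.
case: br => f l e12 e23 e1N g1 g2 far4 _.
exact: (discE_far p_prob a_neq0 c_neq0 f l e12 e23 e1N g1 g2 far4).
Qed.

Lemma ratio_gt0 : 0 < ratio.
Proof.
have x1l := x1_lt1 br; have := branch12 br; have := branch23 br; have := branch1N br => h1 h2 h3.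
have ff : 0 < - far_factor x4 x2 by rewrite oppr_gt0 far_factor_lt0'; lra.
by rewrite divr_gt0 ?mulr_gt0 //; lra.
Qed.

Lemma den_gt0 x : x2 <= x <= x3 -> 0 < den x.
Proof.
move=> /andP[h2 h3]; have r0 := ratio_gt0; have e23 := branch23 br; rewrite /den.
have [->|n] := eqVneq x x3; first by rewrite subrr add0r mulr_gt0 // subr_gt0.
have k : 0 <= ratio * (x - x2) by rewrite mulr_ge0 ?(ltW r0) ?subr_ge0.
have k' : x < x3 by rewrite lt_neqAle n.
lra.
Qed.

Lemma swap_factors x : x2 <= x <= x3 ->
  [/\ swap x - e1 = (e4 - e1) * ratio * (x - x2) / den x,
      e4 - swap x = (e4 - e1) * (x3 - x) / den x &
      (1 - x1) * (1 + (1 - x2) * swap x) * (1 - (x3 - 1) * swap x) =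
      - ratio * (x3 - x2) ^+ 2 * (x - x1) * far_factor x4 x / den x ^+ 2].
Proof.
move=> xI; have d0 := den_gt0 xI; have dn : den x != 0 by rewrite gt_eqF.
have x1l := x1_lt1 br; have := branch12 br; have := branch23 br; have := branch1N br => h1 h2 h3.
have x1n : x1 - 1 != 0 by lra.
have x1n' : 1 - x1 != 0 by lra.
have ff : far_factor x4 x2 != 0 by rewrite lt_eqF // far_factor_lt0'; lra.
split; first by rewrite /swap /den in dn *; field.
  by rewrite /swap /den in dn *; field.
have l1 : (1 + (1 - x2) * swap x) * den x = (x - x1) * (x3 - x2) / (1 - x1).
  transitivity ((x3 - x) * (1 + (1 - x2) * e1) + ratio * (x - x2) * (1 + (1 - x2) * e4)).
    by rewrite /swap mulrDl mulrA mulrVK ?unitfE // /den; ring.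
  have -> : 1 + (1 - x2) * e4 = - far_factor x4 x2.
    rewrite /arc_right /far_factor; case: (x4) (branch4_far br) => [r|] far; last by ring.
    have [x31 _] := branch_signs p_prob a_neq0 c_neq0 br.
    by field; case: far; lra.
  by rewrite /ratio /arc_left; field; rewrite ?x1n ?x1n' ?ff.
have l2 : (1 - (x3 - 1) * swap x) * den x =
    (x3 - x1) * (x3 - x2) * (- far_factor x4 x) / ((1 - x1) * - far_factor x4 x2).
  transitivity ((x3 - x) * (1 - (x3 - 1) * e1) + ratio * (x - x2) * (1 - (x3 - 1) * e4)).
    by rewrite /swap mulrBl mulrA mulrVK ?unitfE // /den; ring.
  have -> : 1 - (x3 - 1) * e4 = - far_factor x4 x3.
    rewrite /arc_right /far_factor; case: (x4) (branch4_far br) => [r|] far; last by ring.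
    have [x31 _] := branch_signs p_prob a_neq0 c_neq0 br.
    by field; case: far; lra.
  rewrite /ratio /arc_left.
  transitivity ((x3 - x1) / ((1 - x1) * - far_factor x4 x2) *
    (- (x3 - x) * far_factor x4 x2 - (x - x2) * far_factor x4 x3)).
    by field; rewrite ?x1n ?x1n' ?ff.
  have -> : - (x3 - x) * far_factor x4 x2 - (x - x2) * far_factor x4 x3 =
     (x3 - x2) * - far_factor x4 x.
    rewrite /far_factor; case: (x4) => [r|]; [ring|ring].
  by ring.
apply: (mulIf (expf_neq0 2 dn)); rewrite divfK ?expf_neq0 //.
transitivity ((1 - x1) * ((1 + (1 - x2) * swap x) * den x) * ((1 - (x3 - 1) * swap x) * den x)).
  by ring.
by rewrite l1 l2 /ratio; field; rewrite ?x1n' ?ff.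
Qed.

Lemma swap_derive x : x2 <= x <= x3 ->
  is_derive x 1 swap ((e4 - e1) * ratio * (x3 - x2) / den x ^+ 2).
Proof.
move=> xI; have d0 := den_gt0 xI; have dn : den x != 0 by rewrite gt_eqF.
have dd : is_derive x 1 den (ratio - 1).
  by apply: is_derive_eq; rewrite /GRing.scale /=; ring.
have dnum : is_derive x 1 (fun x : R => e1 * (x3 - x) + e4 * ratio * (x - x2)) (e4 * ratio - e1).
  by apply: is_derive_eq; rewrite /GRing.scale /=; ring.
have dV := @is_deriveV R den x _ 1 dn dd.
have := @is_deriveM _ _ _ _ _ _ _ _ dnum dV.
rewrite /GRing.scale /= => h.
suff <- : (e1 * (x3 - x) + e4 * ratio * (x - x2)) * (- den x ^- 2 * (ratio - 1)) +
  (den x)^-1 * (e4 * ratio - e1) = (e4 - e1) * ratio * (x3 - x2) / den x ^+ 2 by exact: h.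
by rewrite /den in dn *; field.
Qed.

Lemma omega2E : omega2 (disc p) x2 x3 = G e4 *+ 2.
Proof.
rewrite /omega2 -[RHS]mulr_natl; congr (_ * _).
have e23 := branch23 br; have r0 := ratio_gt0; have e14 := arc_lt p_prob a_neq0 c_neq0 br.
have swap2 : swap x2 = e1.
  by rewrite /swap /den subrr !mulr0 !addr0 mulfK // subr_eq0 gt_eqF.
have swap3 : swap x3 = e4.
  have k : ratio * (x3 - x2) != 0 by rewrite gt_eqF // mulr_gt0 // subr_gt0.
  by rewrite /swap /den subrr !mulr0 !add0r -[e4 * ratio * _]mulrA mulfK.
have sc x : x2 <= x <= x3 -> {for x, continuous (G \o swap)}.
  move=> xI; apply: (@continuous_comp _ _ _ swap G); last exact: (oval_G_continuous flow).
  have dn : den x != 0 by rewrite gt_eqF // den_gt0.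
  have lin (a b c d : R) : {for x, continuous (fun x : R => a * (b - x) + c * (x - d))}.
    apply: cvgD; apply: cvgM; try exact: cvg_cst.
      by apply: cvgB; [exact: cvg_cst|exact: cvg_id].
    by apply: cvgB; [exact: cvg_id|exact: cvg_cst].
  have cd : {for x, continuous den}.
    have -> : den = fun x => 1 * (x3 - x) + ratio * (x - x2) by apply/funext => z; rewrite mul1r.
    exact: lin.
  by apply: cvgM; [exact: lin|exact: cvgV].
have d1 x : x2 < x < x3 -> is_derive x 1 (G \o swap) (f x).
  move=> /andP[h2 h3]; have xI : x2 <= x <= x3 by rewrite !ltW.
  have d0 := den_gt0 xI; have [f1 f2 f3] := swap_factors xI.
  have k0 : 0 < e4 - e1 by rewrite subr_gt0.
  have k4 : 0 < (e4 - e1) * ratio by exact: mulr_gt0.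
  have k5 : 0 < x - x2 by rewrite subr_gt0.
  have k6 : 0 < x3 - x by rewrite subr_gt0.
  have k7 : 0 < x3 - x2 by rewrite subr_gt0.
  have k1 : 0 < swap x - e1 by rewrite f1; apply: divr_gt0 => //; exact: mulr_gt0.
  have k2 : 0 < e4 - swap x by rewrite f2; apply: divr_gt0 => //; exact: mulr_gt0.
  have uI : e1 < swap x < e4 by rewrite -subr_gt0 k1 -subr_gt0.
  have d := @is_derive1_comp R G swap x _ _ (oval_G_derive flow uI) (swap_derive xI).
  have D0 : 0 < (disc p).[x].
    by apply: (branch_gt0 p_prob a_neq0 c_neq0 br); rewrite h2.
  set m := _ / den x ^+ 2 in d.
  have m0 : 0 < m by apply: divr_gt0; [exact: mulr_gt0|exact: exprn_gt0].
  suff e : disc_v q (swap x) = m ^+ 2 * (disc p).[x].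
    by move: d; rewrite e sqrtrM ?sqr_ge0 // sqrtr_sqr gtr0_norm // invfM mulrAC mulVf ?mul1r ?gt_eqF.
  rewrite (disc_v_arc p_prob a_neq0 c_neq0 br) arc_discE f1 f2 discE_far'.
  transitivity ((e4 - e1) * ratio * (x - x2) / den x * ((e4 - e1) * (x3 - x) / den x) * (lead1 x4 lc *
     ((1 - x1) * (1 + (1 - x2) * swap x) * (1 - (x3 - 1) * swap x)))); first by ring.
  by rewrite f3 /m; field; rewrite gt_eqF.
have cg x : x2 < x < x3 -> {for x, continuous f}.
  move=> /andP[h2 h3]; apply: inv_sqrt_continuous.
  by apply: (branch_gt0 p_prob a_neq0 c_neq0 br); rewrite h2.
have g0 x : x2 < x < x3 -> 0 <= f x by rewrite invr_ge0 sqrtr_ge0.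
have lim1 : (G \o swap) x @[x --> x2^'+] --> G e1.
  by rewrite -swap2; apply: cvg_at_right_filter; apply: sc; rewrite lexx ltW.
have lim2 : (G \o swap) x @[x --> x3^'-] --> G e4.
  by rewrite -swap3; apply: cvg_at_left_filter; apply: sc; rewrite lexx ltW.
by rewrite (Rintegral_oo e23 d1 cg g0 lim1 lim2) (oval_G_left flow) subr0.
Qed.
End Periods.
End Integrals.

(** * The order of the group *)

Local Open Scope card_scope.
Local Open Scope ring_scope.
Local Open Scope complex_scope.

Section Arithmetic.
Context {R : realType}.
Implicit Types (T L : R) (n : nat).

Let integral T L n := exists k : int, n%:R * T = k%:~R * L.
Let half T L n := exists k : int, n%:R * T = L / 2 + k%:~R * L.

Lemma integral_double T L n : integral T L n.*2 -> integral T L n \/ half T L n.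
Proof.
move=> [k e]; have [j kE] : exists j : int, k = j + j \/ k = j + j + 1.
  exists (k %/ 2)%Z; have := divz_eq k 2; have := @ltz_pmod k 2; have := @modz_ge0 k 2.
  by move: (k %/ 2)%Z (k %% 2)%Z => j b b0 b2 ->; lia.
move: e; rewrite -addnn natrD; case: kE => -> e; [left|right]; exists j; move: e;
  rewrite !rmorphD ?rmorph1 /=; lra.
Qed.

Lemma half_double T L n : half T L n -> integral T L n.*2.
Proof.
move=> [k e]; exists (k + k + 1).
by rewrite -addnn natrD !rmorphD rmorph1 /=; move: e; lra.
Qed.

Lemma integral_not_half T L n : L != 0 -> integral T L n -> ~ half T L n.
Proof.
move=> L0 [k ek] [j]; rewrite ek => e.
have : (k + k)%:~R = (j + j + 1)%:~R :> R.
  by apply: (mulIf L0); rewrite !rmorphD rmorph1 /=; move: e; lra.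
by move/intr_inj; lia.
Qed.

(** The translation by [T] has even order [2 m] modulo [L] exactly when [m T] is, for the
    first time, the half period. *)
Lemma order_half_period T L m : (0 < m)%N -> L != 0 ->
  (integral T L m.*2 /\ forall n, (0 < n < m.*2)%N -> ~ integral T L n) <->
  (half T L m /\ forall k, (0 < k < m)%N -> ~ half T L k).
Proof.
move=> m0 L0; split=> [[im min]|[hm min]].
  split=> [|k /andP[k0 km] /half_double ik]; last first.
    by apply: min ik; rewrite double_gt0 k0 ltn_double.
  have [im'|//] := integral_double im; case: (min m) => //.
  by rewrite m0 -addnn -[X in (X < _)%N]addn0 ltn_add2l.
split; first exact: half_double.
move=> n /andP[n0 nm] comn.
have ex : exists n, `[< (0 < n)%N /\ integral T L n >] by exists n; apply/asboolP.
case: (ex_minnP ex) => N /asboolP[N0 [kN eN]] minN.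
have Nn : (N <= n)%N by apply: minN; apply/asboolP.
have [k2 e2] := half_double hm.
have /eqP dvN : (m.*2 %% N)%N == 0%N.
  rewrite -leqn0 leqNgt; apply/negP => r0.
  have : integral T L (m.*2 %% N)%N.
    exists (k2 - (m.*2 %/ N)%N%:Z * kN).
    have e := divn_eq m.*2 N; move: e2; rewrite {1}e natrD natrM mulrDl -mulrA eN.
    by rewrite rmorphB rmorphM /= -[((m.*2 %/ N)%N : int)%:~R]/((m.*2 %/ N)%N%:R : R); lra.
  by move=> h; have := minN _ (asboolT (conj r0 h)); rewrite leqNgt ltn_pmod.
have {dvN} dvN : (N %| m.*2)%N by rewrite /dvdn dvN.
have notm : ~ integral T L m by move=> h; exact: (integral_not_half L0 h hm).
have mul a : integral T L (N * a)%N.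
  by exists (a%:Z * kN); rewrite natrM mulrAC eN rmorphM /= -[(a : int)%:~R]/(a%:R : R); ring.
have [odN|evN] := boolP (odd N).
  apply: notm; have : (N %| m)%N by rewrite -(@Gauss_dvdr _ 2) ?coprimen2 // mul2n.
  by move/dvdnP => [a ->]; rewrite mulnC; exact: mul.
have NE : N = N./2.*2 by rewrite halfK (negPf evN) subn0.
have N'0 : (0 < N./2)%N by rewrite -double_gt0 -NE.
have [|iN'|hN'] := @integral_double T L N./2.
- by rewrite -NE; exists kN.
- have := minN _ (asboolT (conj N'0 iN')); lia.
by apply: min hN'; lia.
Qed.
End Arithmetic.

Section SimpleBranches.
Context {R : realType}.

(** Two equal roots would make the discriminant the product of a square [(X - r) ^ 2] and a
    polynomial of degree at most 2. *)
Lemma simple_branches (D : {poly R}) x1 x2 x3 (x4 : option R) :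
  branch_points D x1 x2 x3 x4 ->
  (forall (r : R) (E : {poly R}), (size E <= 3)%N -> D <> ('X - r%:P) ^+ 2 * E) ->
  exists lc, simple_branch_points D x1 x2 x3 x4 lc.
Proof.
move=> [[_ /eqpP[[c1 c2] /= /andP[c10 c20] DE]] [l12 l23 l34] le12 sub /andP[x20 le23]] nd.
pose tail : {poly R} := if x4 is Some r then 'X - r%:P else 1.
pose lc := c2 / c1.
have {}DE : D = lc *: (('X - x1%:P) * ('X - x2%:P) * ('X - x3%:P) * tail).
  apply: (scalerI c10); rewrite DE scalerA mulrC divfK //; congr (_ *: _).
  by rewrite /tail; case: (x4) => [r|]; rewrite /= !big_cons big_nil !mulr1 ?mulrA.
have st : (size tail <= 2)%N.
  by rewrite /tail; case: (x4) => [r|]; rewrite ?size_XsubC ?size_poly1.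
have sz (P1 P2 : {poly R}) : (size P1 <= 2)%N -> (size P2 <= 2)%N -> (size (lc *: (P1 * P2)) <= 3)%N.
  move=> s1 s2; apply: leq_trans (size_scale_leq _ _) _.
  apply: leq_trans (size_polyMleq _ _) _; rewrite -subn1 leq_subLR.
  exact: (leq_add s1 s2).
have sX (a : R) : (size ('X - a%:P)%R <= 2)%N by rewrite size_XsubC.
have n12 : x1 <> x2.
  move=> e; apply: (nd x2 (lc *: (('X - x3%:P) * tail))); first exact: sz.
  by rewrite DE e -!mul_polyC; ring.
have n23 : x2 <> x3.
  move=> e; apply: (nd x3 (lc *: (('X - x1%:P) * tail))); first exact: sz.
  by rewrite DE e -!mul_polyC; ring.
have n34 : x4 <> Some x3.
  move=> e; apply: (nd x3 (lc *: (('X - x1%:P) * ('X - x2%:P)))); first exact: sz.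
  by rewrite DE /tail e -!mul_polyC; ring.
have n14 : x4 <> Some x1.
  move=> e; apply: (nd x1 (lc *: (('X - x2%:P) * ('X - x3%:P)))); first exact: sz.
  by rewrite DE /tail e -!mul_polyC; ring.
exists lc; split=> //.
- move=> x; rewrite DE /quartic_factor /tail hornerZ; case: (x4) => [r|];
    by rewrite !(hornerM, hornerXsubC, hornerC).
- by rewrite mulf_neq0 // invr_neq0.
- by rewrite lt_neqAle le12 andbT; apply/eqP.
- by rewrite lt_neqAle le23 andbT; apply/eqP.
- by move: l12; rewrite /= (ger0_norm x20) ler_norml => /andP[].
- have := sub x1; rewrite /= !in_itv /= lexx le12 => /(_ isT) /andP[] //.
- have := sub x2; rewrite /= !in_itv /= lexx le12 => /(_ isT) /andP[] //.
case: (x4) l34 n34 => // r /= l34 n34.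
have x30 : 0 <= x3 by lra.
move: l34; rewrite (ger0_norm x30); have [r0|r0] := leP 0 r.
  by rewrite (ger0_norm r0) => h; left; rewrite lt_neqAle h andbT; apply/eqP => e; apply: n34; rewrite e.
by rewrite (ltr0_norm r0) => h; right; lra.
Qed.
End SimpleBranches.

Theorem proposition2p9 (R : realType) (p : int -> int -> R)
  (p_prob : transition_probabilities p)
  (Q_irr : irreducible_elt (walk_kernelC p))
  (Q_degX : size (walk_kernelC p) = 3%N) (Q_degY : sizeY (walk_kernelC p) = 3%N)
  (K : fieldType) (iota : {rmorphism R[i] -> K}) (x y : K)
  (K_funfield : is_function_field iota (walk_kernelC p) x y)
  (genus1 : has_genus iota 1%N)
  (xi eta : {rmorphism K -> K})
  (xiP : is_xi iota p x y xi) (etaP : is_eta iota p x y eta)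
  (x1 x2 x3 : R) (x4 : option R)
  (branch_x : branch_points (disc p) x1 x2 x3 x4)
  (y1 y2 y3 : R) (y4 : option R)
  (branch_y : branch_points (disct p) y1 y2 y3 y4)
  (Xy1 : option R)
  (Xy1P : roots_in_degree 2 (walk_kernel_at p y1) [:: Xy1; Xy1])
  (m : nat) (m_gt0 : (0 < m)%N) :
  let w1 : R[i] := omega1 (disc p) x1 x2 in
  let w2 : R[i] := (omega2 (disc p) x2 x3)%:C in
  let w3 : R[i] := (omega3 (disc p) Xy1 x1)%:C in
  walk_group xi eta #= `I_(4 * m)%N <->
  (wp w1 w2 (m%:R * w3) = wp w1 w2 (w2 / 2%:R) /\
   forall k : nat, (0 < k < m)%N ->
     wp w1 w2 (k%:R * w3) <> wp w1 w2 (w2 / 2%:R)).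
Proof.
have wf : walk_field iota p x y by split.
have wfT := walk_field_transpose wf.
have at0 := coef_at_neq0 wf; have ct0 := coef_ct_neq0 wf.
have a0 : coef_a p != 0 := coef_at_neq0 wfT.
have c0 : coef_c p != 0 := coef_ct_neq0 wfT.
have [lc brx] := simple_branches branch_x (disct_simple wfT genus1).
have [lc' bry] := simple_branches branch_y (disct_simple wf genus1).
have [U [V [G flow]]] := walk_oval p_prob a0 c0 at0 ct0 brx.
have [uI cur crit] := critical_point p_prob a0 c0 at0 ct0 brx bry Xy1P.
have [s [sE V_refl U_refl]] := oval_reflection flow uI cur crit.
have q2 t := quad_v2_neq0 p_prob a0 c0 at0 ct0 brx (oval_range flow t).
have [tau tau0 ->] := omega1_gt0 p_prob a0 c0 brx.
have neq1 := critical_neq1 p_prob a0 c0 at0 ct0 brx bry Xy1P.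
rewrite (omega2E p_prob a0 c0 brx flow) (omega3E p_prob a0 c0 brx flow neq1 uI).
rewrite -/(critical_u Xy1) /=.
set L := G (arc_right x4) *+ 2; set T := G (critical_u Xy1) *+ 2.
have L0 : 0 < L by rewrite pmulrn_lgt0 // (oval_G_right flow).
have wpE (k : nat) : wp (tau*i) L%:C (k%:R * T%:C) = wp (tau*i) L%:C (L%:C / 2%:R) <->
    exists n : int, k%:R * T = L / 2 + n%:~R * L.
  have -> : k%:R * T%:C = (k%:R * T)%:C by rewrite rmorphM rmorph_nat.
  exact: wp_half_period.
have m20 : (0 < m.*2)%N by rewrite double_gt0.
have -> : (4 * m = 2 * m.*2)%N by rewrite -mul2n mulnA.
rewrite (walk_group_card p_prob wf xiP etaP flow q2 V_refl U_refl m20).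
have comE n : commensurable (arc_right x4) G s n <-> exists k : int, n%:R * T = k%:~R * L.
  rewrite /commensurable -/L; case: sE => ->; first by [].
  by split=> -[k e]; exists (- k); rewrite rmorphN mulNr -e -/T mulrN ?opprK.
have order := order_half_period T m_gt0 (lt0r_neq0 L0).
split=> [[/comE h1 h2]|[/wpE h1 h2]].
  have [hm hk] := order.1 (conj h1 (fun n nI h => h2 n nI ((comE n).2 h))).
  by split; [exact/wpE|move=> k kI /wpE; exact: hk].
have [hm hk] := order.2 (conj h1 (fun n nI h => h2 n nI ((wpE n).2 h))).
by split; [exact/comE|move=> k kI /comE; exact: hk].
Qed.
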